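(* Let $\alpha=2$, let $m\ge 0$ be an integer, let $2>\alpha_1>\dots>\alpha_m>0$ with $2-\alpha_m\le 1$, and let $c>0$, $c_j>0$ for $j=1,\dots,m$. Let $A$ be a closed linear unbounded operator, densely defined in a Banach space $X$, which is a generator of a bounded cosine family $S_2(t)$ in $X$. Let $S(t)$ be the bounded solution operator of the problem $$cD_t^{2}u(t)+\sum_{j=1}^m c_j D_t^{\alpha_j}u(t)=Au(t),\ t>0;\qquad u(0)=v\in X,\ u_t(0)=0.$$ Then the subordination relation $S(t)=\int_0^\infty\phi(t,\tau)S_2(\tau)\,\mathrm{d}\tau$, $t>0$, has the form $$S(t)=\int_0^{t/\sqrt{c}} \phi(t,\tau)S_2(\tau)\,\mathrm{d}\tau,\qquad t>0,$$ where $\phi(t,\tau)=-w_x(x,t)|_{x=\tau}$, $t,\tau>0$, and $w$ is the propagation function.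
   Context: If $m=0$, the sums over $j$ are empty and the conditions on the $\alpha_j$ and $c_j$ are void. $D_t^\beta$ is the Caputo derivative of order $\beta>0$ in time. Put $g(s)=c s^{2}+\sum_{j=1}^m c_j s^{\alpha_j}$ (principal branches). Cosine family: $S_2(t)$ is the strongly continuous cosine family generated by $A$, i.e. the solution operator of the well-posed problem $u''(t)=Au(t)$, $t>0$, $u(0)=v$, $u'(0)=0$; its Laplace transform is $s(s^2-A)^{-1}$. Bounded means $\sup_{t\ge0}\|S_2(t)\|<\infty$. Solution operator: let $k$ be the function with Laplace transform $\widehat k(s)=1/g(s)$. The multi-term problem is rewritten as the Volterra equation $u(t)=v+\int_0^t k(t-\tau)Au(\tau)\,\mathrm{d}\tau$, and its solution operator is the resolvent of this equation: a strongly continuous family $S(t)$, $t\ge 0$, of bounded linear operators on $X$ with $S(0)=I$, $S(t)D(A)\subset D(A)$, $AS(t)v=S(t)Av$ and $S(t)v=v+\int_0^t k(t-\tau)AS(\tau)v\,\mathrm{d}\tau$ for all $v\in D(A)$, $t\ge0$. Bounded means $\sup_{t\ge0}\|S(t)\|<\infty$. Its Laplace transform is $\frac{g(s)}{s}(g(s)-A)^{-1}$. Under the stated hypotheses such a bounded solution operator exists and satisfies the subordination relation $S(t)=\int_0^\infty\phi(t,\tau)S_2(\tau)\,\mathrm{d}\tau$, with $\phi(t,\tau)$ a probability density function in $\tau$. Propagation function: $w(x,t)$ is the solution of $cD_t^{2}w+\sum_{j=1}^m c_jD_t^{\alpha_j}w=w_{xx}$ for $x,t>0$, with $w(x,0)=w_t(x,0)=0$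 for $x>0$, $w(0,t)=H(t)$ (the Heaviside unit step function) and $w\to0$ as $x\to\infty$ for $t>0$. Its Laplace transform with respect to $t$ is $\frac1s\exp(-x\sqrt{g(s)})$.
   Formalization: For m=0, and for m=1 with α₁=1, φ(t,·) has a Dirac mass at t/√c and −w_x is no function; so φ(t,·) is taken as a probability measure with φ([a,b))=w(a,t)−w(b,t), the PDE for w is read in time-integrated form, and the formula with the pointwise −w_x is stated when w(·,t) is C¹. *)

(* Defs.v *)
From HB Require Import structures.
From mathcomp Require Import all_boot all_order all_algebra.
From mathcomp Require Import all_classical all_reals all_analysis.

Set Implicit Arguments.
Unset Strict Implicit.
Unset Printing Implicit Defensive.

Import Order.TTheory GRing.Theory Num.Theory.
Import numFieldNormedType.Exports.

Local Open Scope classical_set_scope.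
Local Open Scope ring_scope.

Section BochnerIntegral.
Context {R : realType} {X : normedModType R}.
Context d (T : measurableType d).

(* The X-valued simple function \sum_i 1_(E_i) x_i and its integral over D. *)
Definition simple_fun (n : nat) (E : nat -> set T) (x : nat -> X) (a : T) : X :=
  \sum_(i < n) (\1_(E i) a : R) *: x i.

Definition simple_integral (mu : set T -> \bar R) (D : set T)
    (n : nat) (E : nat -> set T) (x : nat -> X) : X :=
  \sum_(i < n) fine (mu (D `&` E i)) *: x i.

(* f is Bochner integrable over D, with integral I.  Measurability of the
   distances together with L^1 convergence gives strong measurability of f. *)
Definition bochner_integral (mu : {measure set T -> \bar R}) (D : set T)
    (f : T -> X) (I : X) : Prop :=
  exists (n : nat -> nat) (E : nat -> nat -> set T) (x : nat -> nat -> X),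
    [/\ forall p i, measurable (E p i) /\ (mu (E p i) < +oo)%E,
        forall p, measurable_fun D (fun a => `|simple_fun (n p) (E p) (x p) a - f a|),
        (\int[mu]_(a in D) (`|simple_fun (n p) (E p) (x p) a - f a|)%:E)%E
          @[p --> \oo] --> 0%E
      & simple_integral mu D (n p) (E p) (x p) @[p --> \oo] --> I].

End BochnerIntegral.

Section Operators.
Context {R : realType} {X : completeNormedModType R}.

(* An operator with domain D is a total function A used only on D. *)
Definition linear_operator (D : set X) (A : X -> X) : Prop :=
  [/\ D 0,
      forall (a : R) u v, D u -> D v -> D (a *: u + v)
    & forall (a : R) u v, D u -> D v -> A (a *: u + v) = a *: A u + A v].

Definition closed_operator (D : set X) (A : X -> X) : Prop :=
  closed [set p : X * X | D p.1 /\ p.2 = A p.1].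

Definition unbounded_operator (D : set X) (A : X -> X) : Prop :=
  ~ exists M : R, forall v, D v -> `|A v| <= M * `|v|.

(* Only the values at t >= 0 matter. *)
Definition strongly_continuous_family (S : R -> X -> X) : Prop :=
  [/\ forall t, 0 <= t -> forall (a : R) u v, S t (a *: u + v) = a *: S t u + S t v,
      forall t, 0 <= t -> continuous (S t)
    & forall v, {within `[0, +oo[, continuous (fun t => S t v)}].

Definition bounded_family (S : R -> X -> X) : Prop :=
  exists M : R, forall t v, 0 <= t -> `|S t v| <= M * `|v|.

(* Cosine families are even, so they are given by their values at t >= 0. *)
Definition cosine_family (C : R -> X -> X) : Prop :=
  [/\ strongly_continuous_family C,
      forall v, C 0 v = v
    & forall s t v, 0 <= s -> s <= t ->
        C (t + s) v + C (t - s) v = 2 *: C t (C s v)].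

(* (D, A) is the infinitesimal generator C''(0) of C. *)
Definition generates_cosine (D : set X) (A : X -> X) (C : R -> X -> X) : Prop :=
  cosine_family C /\
  forall v y, (D v /\ A v = y) <->
    ((2 / h ^+ 2) *: (C h v - v) @[h --> 0^'+] --> y).

(* The resolvent of u(t) = v + \int_0^t k(t - tau) A u(tau) dtau. *)
Definition solution_operator (k : R -> R) (D : set X) (A : X -> X)
    (S : R -> X -> X) : Prop :=
  [/\ strongly_continuous_family S,
      forall v, S 0 v = v,
      forall t v, 0 <= t -> D v -> D (S t v) /\ A (S t v) = S t (A v)
    & forall t v, 0 <= t -> D v ->
        bochner_integral (@lebesgue_measure R) `[0, t]
          (fun tau => k (t - tau) *: A (S tau v)) (S t v - v)].

End Operators.

Section Kernels.
Context {R : realType}.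
Let mu := @lebesgue_measure R.

Definition charfun (m : nat) (c : R) (cs al : 'I_m -> R) (s : R) : R :=
  c * s ^+ 2 + \sum_(j < m) cs j * s `^ al j.

(* F is the Laplace transform of k at all large real s, which determines k up
   to a null set; at such s the principal branches are the real powers. *)
Definition has_laplace_transform (k F : R -> R) : Prop :=
  \forall s \near +oo,
    mu.-integrable `[0, +oo[ (fun t => (expR (- s * t) * k t)%:E) /\
    \int[mu]_(t in `[0, +oo[) (expR (- s * t) * k t) = F s.

Definition Gamma (b : R) : R :=
  \int[mu]_(x in `]0, +oo[) (x `^ (b - 1) * expR (- x)).

(* Riemann-Liouville integral J^b of order b > 0. *)
Definition frac_integral (b : R) (f : R -> R) (t : R) : R :=
  (Gamma b)^-1 * \int[mu]_(tau in `[0, t]) ((t - tau) `^ (b - 1) * f tau).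

(* w = w x t is the solution of
     c D_t^2 w + \sum_j c_j D_t^(al_j) w = w_xx  (x, t > 0),
     w(x,0) = w_t(x,0) = 0,  w(0,t) = H(t),  w(x,t) --> 0 as x --> +oo.
   In general w jumps across the front t = sqrt c * x (for m = 0 it is
   H(t - sqrt c * x)), so the equation is integrated three times in t:
   for a Caputo derivative of order b <= 2 with vanishing initial data,
   J^3 D_t^b w = J^(3-b) w, and J^3 w is twice differentiable in x.
   The growth bound is the usual uniqueness class for the quarter-plane problem;
   right-continuity in t is the convention H(0) = 1 for the value at a jump. *)
Definition propagation_function (m : nat) (c : R) (cs al : 'I_m -> R)
    (w : R -> R -> R) : Prop :=
  [/\ [/\ forall x, 0 < x -> measurable_fun (`]0, +oo[ : set R) (w x),
          exists M a : R, forall x t, 0 < x -> 0 < t -> `|w x t| <= M * expR (a * t)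
        & forall x t, 0 < x -> 0 < t -> w x tau @[tau --> t^'+] --> w x t],
      forall x t, 0 < x -> 0 < t ->
        derivable (fun y => frac_integral 3 (w y) t) x 1 /\
        is_derive x 1 (derive1 (fun y => frac_integral 3 (w y) t))
          (c * frac_integral 1 (w x) t
           + \sum_(j < m) cs j * frac_integral (3 - al j) (w x) t),
      forall x, 0 < x -> w x 0 = 0 /\ (w x t / t @[t --> 0^'+] --> 0),
      forall t, 0 < t -> w 0 t = 1 /\ (w x t @[x --> 0^'+] --> w 0 t)
    & forall t, 0 < t -> w x t @[x --> +oo] --> 0].

(* phi(dtau) = - w_x(tau, t) dtau on ]0, +oo[, in the Lebesgue-Stieltjes sense.
   In general - w_x(., t) is only a measure: it is a Dirac mass at t / sqrt c for
   m = 0, and has an atom there for m = 1, al_1 = 1.  Intervals are closed on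
   the left because w(., t) is left-continuous (w right-continuous in t). *)
Definition neg_x_derivative (w : R -> R -> R) (t : R)
    (phi : set (measurableTypeR R) -> \bar R) : Prop :=
  forall a b : R, 0 < a -> a <= b -> phi `[a, b[%classic = (w a t - w b t)%:E.

Definition continuously_derivable_in_x (w : R -> R -> R) (t : R) : Prop :=
  forall x, 0 < x ->
    derivable (fun y => w y t) x 1 /\ {for x, continuous (derive1 (fun y => w y t))}.

End Kernels.

(* Main.v *)
Require Import Defs.
From HB Require Import structures.
From mathcomp Require Import all_boot all_order all_algebra.
From mathcomp Require Import all_classical all_reals all_analysis.
From mathcomp Require Import measurable_realfun.
From mathcomp Require Import ring lra zify.

Set Implicit Arguments.
Unset Strict Implicit.
Unset Printing Implicit Defensive.

Import Order.TTheory GRing.Theory Num.Theory.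
Import numFieldNormedType.Exports.

Local Open Scope classical_set_scope.
Local Open Scope ring_scope.

(** Put lam s = sqrt (c s^2 + \sum_j cs j * s ^ al j). The hypotheses on the exponents
    amount to 1 <= al j < 2. Everything is compared through Laplace transforms in time,
    at large real s.

    The transform of the propagation function w(x, .) is e^(- x lam s) / s
    ([propagation_transform_pos]): in the transformed equation u'' = (lam s)^2 u the
    growing exponential is excluded by the growth bound, and the boundary value fixes
    the remaining constant.

    The shape of w is then a matter of positivity. Since the exponents lie between 1
    and 2, lam s and s / lam s are geometric means of functions with a positive
    semidefinite Loewner kernel, and this class contains the powers with exponent in
    [0, 1] and is closed under geometric means ([pick_geomean], [pick_powR]). Confluence
    of the nodes of the kernel gives the sign of the odd derivatives, linear growth that
    of the even ones ([pick_bernstein]). Hence lam s / s and e^(- x lam s) are completely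
    monotone. A right-continuous function whose transform has alternating differences is
    nonnegative ([alt_lap_ge0], a form of Bernstein's theorem proved with Bernstein
    polynomials in e^(-t)). It follows that w decreases from 1 to 0 in x and increases in
    t; and because lam s >= sqrt c * s, it vanishes for x > t / sqrt c
    ([extension_support]). So - w_x(., t) is a probability measure phi t on
    [0, t / sqrt c] ([propagation_measure]).

    For the operators, let f be a continuous linear functional. The Laplace integral q
    of an orbit of the cosine family C at l is l (l^2 - A)^-1 v ([cosine_resolvent]).
    Inserting it into the transformed Volterra equation shows that the transform of
    f (S(t) v) at s is lam s / s times that of f (C(t) v) at lam s
    ([solution_transform]). The function int f (C(x) v) phi t (dx) of t has the same
    transform: this is a computation with w for step functions in place of the orbit,
    and steps approximate ([lap_subordinate]). Both functions are right-continuous in t,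
    hence equal ([subordination_functional]). The Bochner integrals exist because orbits
    are continuous ([bochner_exists]), and functionals separate points
    ([functional_separation]). The support of phi t gives the upper limit t / sqrt c; if
    w is continuously differentiable in x, then - w_x is a density of phi t. *)

(** * Positive semidefinite kernels and Pick functions *)

Lemma cvg_bigsum (R : realType) (V : normedModType R) (T : Type)
    (F : set_system T) (FF : Filter F) (I : Type) (r : seq I) (f : I -> T -> V) (l : I -> V) :
  (forall i, f i x @[x --> F] --> l i) ->
  (\sum_(i <- r) f i x) @[x --> F] --> \sum_(i <- r) l i.
Proof.
move=> fl; elim: r => [|a r IH].
  by under eq_fun do rewrite big_nil; rewrite big_nil; exact: cvg_cst.
under eq_fun do rewrite big_cons; rewrite big_cons; exact: cvgD.
Qed.

Lemma cvg_ge0 (R : realType) (T : Type) (F : set_system T) (FF : ProperFilter F)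
    (f : T -> R) (l : R) : (\forall x \near F, 0 <= f x) -> f x @[x --> F] --> l -> 0 <= l.
Proof. by move=> f0 fl; apply: (@closed_cvg T R F FF f (fun x => 0 <= x) (@closed_ge R 0) f0 l fl). Qed.

Section Kernels.
Context {R : realType}.
Implicit Types (K : R -> R -> R) (f g d e u x : R -> R).

Definition psd K := forall (n : nat) (z c : 'I_n -> R), (forall i, 0 < z i) ->
  0 <= \sum_i \sum_j c i * c j * K (z i) (z j).

Lemma psd_ext K K' : (forall z w : R, 0 < z -> 0 < w -> K z w = K' z w) ->
  psd K -> psd K'.
Proof.
move=> KK pK n z c z0; have := pK n z c z0.
by under eq_bigr do under eq_bigr do rewrite KK//.
Qed.

Lemma psd0 : psd (fun _ _ => 0).
Proof. by move=> n z c _; rewrite big1// => i _; rewrite big1// => j _; rewrite mulr0. Qed.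

Lemma psdD K K' : psd K -> psd K' -> psd (fun z w => K z w + K' z w).
Proof.
move=> pK pK' n z c z0.
under eq_bigr do under eq_bigr do rewrite mulrDr.
under eq_bigr do rewrite big_split.
by rewrite big_split addr_ge0 ?pK ?pK'.
Qed.

Lemma psdZ u K : psd K -> psd (fun z w => u z * u w * K z w).
Proof.
move=> pK n z c z0; have := pK n z (fun i => c i * u (z i)) z0.
congr (_ <= _); apply: eq_bigr => i _; apply: eq_bigr => j _; ring.
Qed.

Lemma psdZ_ge0 (a : R) K : 0 <= a -> psd K -> psd (fun z w => a * K z w).
Proof.
move=> a0 pK; have := psdZ (fun=> Num.sqrt a) pK.
apply: psd_ext => z w _ _; rewrite -expr2 sqr_sqrtr//.
Qed.

Lemma psd_sum (I : Type) (r : seq I) (K : I -> R -> R -> R) : (forall i, psd (K i)) ->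
  psd (fun z w => \sum_(i <- r) K i z w).
Proof.
move=> pK; elim: r => [|a r IH].
  by apply: psd_ext psd0 => z w _ _; rewrite big_nil.
by apply: psd_ext (psdD (pK a) IH) => z w _ _; rewrite big_cons.
Qed.

Lemma psd_cvg (Kn : nat -> R -> R -> R) K : (forall n, psd (Kn n)) ->
  (forall z w : R, 0 < z -> 0 < w -> Kn n z w @[n --> \oo] --> K z w) -> psd K.
Proof.
move=> pK cK n z c z0.
apply: (@cvg_ge0 _ _ \oo _ (fun k => \sum_i \sum_j c i * c j * Kn k (z i) (z j))).
  by apply: nearW => k; exact: pK.
apply: cvg_bigsum => i; apply: cvg_bigsum => j.
by apply: cvgM; [exact: cvg_cst|exact: cK].
Qed.

(** Schur multiplication by a Cauchy matrix 1 / (x i + x j): with the Cayley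
    transform xi = (x - 1) / (x + 1), which has modulus < 1,
    1 / (x + y) = (1 - xi) (1 - eta) / 2 * \sum_k (xi * eta) ^ k. *)
Lemma psd_cauchy x K : (forall z : R, 0 < z -> 0 < x z) -> psd K ->
  psd (fun z w => K z w / (x z + x w)).
Proof.
move=> x0 pK.
pose xi z := (x z - 1) / (x z + 1).
pose Kn n z w := 2^-1 * ((1 - xi z) * (1 - xi w) *
  series (geometric 1 (xi z * xi w)) n * K z w).
have xi1 z : 0 < z -> `|xi z| < 1.
  move=> z0; have := x0 _ z0 => xz.
  rewrite /xi normrM normfV (gtr0_norm (_ : 0 < x z + 1)) ?ltr_pdivrMr ?mul1r; [|lra|lra].
  by rewrite ltr_norml; apply/andP; split; lra.
apply: (@psd_cvg Kn) => [n|z w z0 w0].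
  apply: psdZ_ge0; first by rewrite invr_ge0.
  have /(psdZ (fun z => 1 - xi z)) : psd (fun z w => \sum_(0 <= k < n) (xi z ^+ k * xi w ^+ k * K z w)).
    by apply: psd_sum => k; exact: (psdZ (fun z => xi z ^+ k)).
  apply: psd_ext => z w z0 w0.
  rewrite /series/= mulr_sumr -mulrA mulr_suml mulr_sumr.
  by apply: eq_bigr => k _; rewrite mul1r [(xi z * _) ^+ _]exprMn !mulrA.
have -> : K z w / (x z + x w) = 2^-1 * ((1 - xi z) * (1 - xi w) * (1 / (1 - xi z * xi w)) * K z w).
  have := x0 _ z0; have := x0 _ w0; rewrite /xi; move: (x z) (x w) => a b b0 a0.
  have -> : 1 - (a - 1) / (a + 1) * ((b - 1) / (b + 1)) = 2 * (a + b) / ((a + 1) * (b + 1)).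
    by field; apply/andP; split; lra.
  by field; apply/and3P; split; lra.
apply: cvgM; first exact: cvg_cst.
apply: cvgM; last exact: cvg_cst.
apply: cvgM; first exact: cvg_cst.
apply: cvg_geometric_series; rewrite normrM.
by apply: mulr_ilt1 => //; exact: xi1.
Qed.

(** The kernel of divided differences, with d standing for the derivative of f on
    the diagonal. *)
Definition loewner f d z w := if z == w then d z else (f z - f w) / (z - w).

(** By Loewner's theorem these are the functions that continue analytically to the
    upper half-plane with nonnegative imaginary part. Working with the kernel keeps
    the argument on the real line. *)
Definition pick f d := psd (loewner f d).

Lemma pick_ext f d g e : (forall z : R, 0 < z -> f z = g z) -> (forall z : R, 0 < z -> d z = e z) ->
  pick f d -> pick g e.
Proof.
move=> fg de; apply: psd_ext => z w z0 w0; rewrite /loewner !fg// de//.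
Qed.

Lemma pick_cst (a : R) : pick (fun=> a) (fun=> 0).
Proof. by apply: psd_ext psd0 => z w _ _; rewrite /loewner; case: ifP => // _; rewrite subrr mul0r. Qed.

Lemma pick_id : pick id (fun=> 1).
Proof.
have : psd (fun z w => 1 * 1 * 1).
  move=> n z c z0; rewrite (_ : \sum_i _ = (\sum_i c i) ^+ 2) ?sqr_ge0// expr2 mulr_suml.
  by apply: eq_bigr => i _; rewrite mulr_sumr; apply: eq_bigr => j _; rewrite !mulr1.
apply: psd_ext => z w _ _; rewrite /loewner; case: ifPn => [_|zw]; first ring.
by rewrite divff ?subr_eq0//; ring.
Qed.

Lemma pickD f d g e : pick f d -> pick g e -> pick (fun z => f z + g z) (fun z => d z + e z).
Proof.
move=> pf pg; apply: psd_ext (psdD pf pg) => z w _ _; rewrite /loewner; case: ifP => // _.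
by rewrite -mulrDl; congr (_ / _); ring.
Qed.

Lemma pickZ (a : R) f d : 0 <= a -> pick f d -> pick (fun z => a * f z) (fun z => a * d z).
Proof.
move=> a0 pf; apply: psd_ext (psdZ_ge0 a0 pf) => z w _ _; rewrite /loewner; case: ifP => // _.
by rewrite mulrA -mulrBr.
Qed.

(** The kernel of -1 / f is K_f(z, w) / (f(z) f(w)). *)
Lemma pickNV f d : (forall z : R, 0 < z -> f z != 0) -> pick f d ->
  pick (fun z => - (f z)^-1) (fun z => d z / f z ^+ 2).
Proof.
move=> f0 pf; apply: psd_ext (psdZ (fun z => (f z)^-1) pf) => z w z0 w0.
have fz := f0 _ z0; have fw := f0 _ w0.
rewrite /loewner; case: eqVneq => [->|zw].
  by rewrite mulrC expr2 invfM.
have zw' : z - w != 0 by rewrite subr_eq0.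
by field; rewrite fz fw zw'.
Qed.

(** With x = sqrt (g / f), one has f = r / x and g = r x for r = sqrt (f g), and
    solving for the increment of r gives
    K_r(z, w) = (x(z) x(w) K_f(z, w) + K_g(z, w)) / (x(z) + x(w)). *)
Lemma pick_geomean f d g e : (forall z : R, 0 < z -> 0 < f z) -> (forall z : R, 0 < z -> 0 < g z) ->
  pick f d -> pick g e ->
  pick (fun z => Num.sqrt (f z * g z)) (fun z => (d z * g z + f z * e z) / (2 * Num.sqrt (f z * g z))).
Proof.
move=> f0 g0 pf pg.
pose r z := Num.sqrt (f z * g z); pose x z := r z / f z.
have r0 z : 0 < z -> 0 < r z by move=> z0; rewrite sqrtr_gt0 mulr_gt0 ?f0 ?g0.
have x0 z : 0 < z -> 0 < x z by move=> z0; rewrite divr_gt0 ?r0 ?f0.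
have fE z : 0 < z -> f z = r z / x z.
  by move=> z0; rewrite /x invfM invrK mulrA divff ?mul1r// gt_eqF ?r0.
have gE z : 0 < z -> g z = r z * x z.
  move=> z0; rewrite /x mulrA -expr2 sqr_sqrtr ?mulr_ge0 ?ltW ?f0 ?g0//.
  by rewrite mulrAC divff ?mul1r// gt_eqF ?f0.
apply: psd_ext (psd_cauchy x0 (psdD (psdZ x pf) pg)) => z w z0 w0.
have := r0 _ z0; have := r0 _ w0; have := x0 _ z0; have := x0 _ w0 => xw xz rw rz.
rewrite /loewner -/(r z) -/(r w) ; case: eqVneq => [zw|zw].
  subst w; rewrite gE// fE//; field; apply/andP; split; lra.
have zw' : z - w != 0 by rewrite subr_eq0.
rewrite !fE// !gE//; field; rewrite zw' /=; apply/and3P; split; try lra.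
Qed.

Lemma pick_cvg (fn dn : nat -> R -> R) f d : (forall n, pick (fn n) (dn n)) ->
  (forall z : R, 0 < z -> fn n z @[n --> \oo] --> f z) ->
  (forall z : R, 0 < z -> dn n z @[n --> \oo] --> d z) -> pick f d.
Proof.
move=> pf cf cd; apply: (@psd_cvg (fun n => loewner (fn n) (dn n))) => // z w z0 w0; rewrite /loewner; case: eqP => _.
  exact: cd.
by apply: cvgM; [apply: cvgB; exact: cf|exact: cvg_cst].
Qed.

Lemma pick_powR_mid (a b : R) :
  pick (fun z => z `^ a) (fun z => a * z `^ (a - 1)) ->
  pick (fun z => z `^ b) (fun z => b * z `^ (b - 1)) ->
  pick (fun z => z `^ ((a + b) / 2)) (fun z => ((a + b) / 2) * z `^ ((a + b) / 2 - 1)).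
Proof.
move=> pa pb.
have := pick_geomean (fun z z0 => powR_gt0 a z0) (fun z z0 => powR_gt0 b z0) pa pb.
have E z : 0 < z -> Num.sqrt (z `^ a * z `^ b) = z `^ ((a + b) / 2).
  move=> z0; rewrite -powRD; last by rewrite (gt_eqF z0) implybT.
  by rewrite powRrM -[LHS]powR12_sqrt// powR_ge0.
apply: pick_ext => z z0; rewrite E//.
have zD (p q : R) : z `^ p * z `^ q = z `^ (p + q) by rewrite powRD// (gt_eqF z0) implybT.
rewrite -mulrA zD mulrCA zD.
have -> : (z `^ (a - 1 + b)) = z `^ ((a + b) / 2 - 1) * z `^ ((a + b) / 2).
  by rewrite zD; congr (_ `^ _); field.
have -> : (z `^ (a + (b - 1))) = z `^ ((a + b) / 2 - 1) * z `^ ((a + b) / 2).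
  by rewrite zD; congr (_ `^ _); field.
by field; rewrite gt_eqF// powR_gt0.
Qed.

(** Bisection: the midpoint of two exponents is the geometric mean of two powers, and
    the exponents 0 and 1 give a constant and the identity. *)
Lemma pick_powR_dyadic (n k : nat) : (k <= 2 ^ n)%N ->
  pick (fun z => z `^ (k%:R / (2 ^ n)%:R)) (fun z => (k%:R / (2 ^ n)%:R) * z `^ (k%:R / (2 ^ n)%:R - 1)).
Proof.
elim: n k => [k|n IH k] kn.
  have : (k == 0) || (k == 1)%N by case: k kn => [|[|]].
  move=> /orP[] /eqP ->; rewrite expn0 ?mul0r ?divr1.
    by apply: pick_ext (pick_cst 1) => z z0; rewrite ?powRr0 ?mul0r.
  by apply: pick_ext pick_id => z z0; rewrite ?powRr1 ?ltW// subrr powRr0 mul1r.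
set N := (2 ^ n)%N in IH *; rewrite expnS -/N in kn *.
have H2 : N%:R != 0 :> R by rewrite pnatr_eq0 expn_eq0.
have E (j : nat) : j.*2%:R / (2 * N)%:R = j%:R / N%:R :> R.
  by rewrite -mul2n !natrM; field; rewrite H2.
have [ek|ok] : (k = k./2.*2) \/ (k = k./2.*2.+1).
- by have := odd_double_half k; case: odd => <- /=; [right|left]; lia.
- by rewrite ek E; apply: IH; lia.
- have k1 : (k./2 <= N)%N by lia.
  have k2 : (k./2.+1 <= N)%N by lia.
  have := pick_powR_mid (IH _ k1) (IH _ k2).
  have -> : (k./2%:R / N%:R + k./2.+1%:R / N%:R) / 2 = k%:R / (2 * N)%:R :> R.
    by rewrite [in RHS]ok -[_.+1]addn1 -[in RHS]addn1 natrD -mul2n !natrM natrD; field; rewrite H2.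
  by [].
Qed.

Lemma pick_powR (b : R) : 0 <= b <= 1 -> pick (fun z => z `^ b) (fun z => b * z `^ (b - 1)).
Proof.
move=> /andP[b0 b1].
pose k n := `|Num.floor (b * (2 ^ n)%:R)|%N.
pose bn n : R := (k n)%:R / (2 ^ n)%:R.
have P2 n : 0 < (2 ^ n)%:R :> R by rewrite ltr0n expn_gt0.
have kE n : (k n)%:R = (Num.floor (b * (2 ^ n)%:R))%:~R :> R.
  by rewrite /k natr_absz ger0_norm// floor_ge0 mulr_ge0// ltW.
have bnb : bn n @[n --> \oo] --> b.
  apply/cvgrPdist_le => e e0.
  have : (2^-1 : R) ^+ n @[n --> \oo] --> 0 by apply: cvg_expr; rewrite ger0_norm; lra.
  move/cvgrPdist_le => /(_ _ e0); apply: filterS => n.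
  rewrite sub0r normrN ger0_norm ?exprn_ge0//; apply: le_trans.
  have -> : b - bn n = (b * (2 ^ n)%:R - (k n)%:R) / (2 ^ n)%:R.
    by rewrite /bn; field; rewrite gt_eqF.
  rewrite kE normrM normfV (gtr0_norm (P2 n)) exprVn natrX ler_piMl ?invr_ge0 ?exprn_ge0//.
  have /andP[f1 f2] := floor_itv (b * (2 ^ n)%:R).
  move: f1 f2; rewrite natrX intrD => f1 f2.
  by rewrite ler_norml; apply/andP; split; lra.
have cpow (z c : R) : 0 < z -> z `^ (bn n + c) @[n --> \oo] --> z `^ (b + c).
  move=> z0; rewrite /powR gt_eqF//.
  apply: continuous_cvg; first exact: continuous_expR.
  by apply: cvgM; [apply: cvgD => //; exact: cvg_cst|exact: cvg_cst].
apply: (@pick_cvg (fun n z => z `^ (bn n)) (fun n z => bn n * z `^ (bn n - 1))).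
- move=> n; apply: pick_powR_dyadic.
  rewrite -(ler_nat R) kE (le_trans (floor_le _))// ler_piMl// ltW//.
- by move=> z z0; have := cpow z 0 z0; under eq_fun do rewrite addr0; rewrite addr0.
- by move=> z z0; apply: cvgM => //; exact: cpow.
Qed.

End Kernels.

(** * Smooth functions on the open half-line *)

Section Smooth.
Context {R : realType}.
Implicit Types (f g d e u x : R -> R).

(** Nothing is required outside the open half-line, where powers and roots degenerate. *)
Fixpoint smooth_upto n f : Prop := if n is m.+1 then
  exists2 df, (forall s : R, 0 < s -> is_derive s 1 f (df s)) & smooth_upto m df
  else True.

Definition smooth f := forall n, smooth_upto n f.

Lemma near_pos (s : R) (P : R -> Prop) : 0 < s -> (forall z : R, 0 < z -> P z) -> \forall z \near s, P z.
Proof. by move=> s0 H; apply: filterS (lt_nbhsr s0) => z; exact: H. Qed.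

Lemma smooth_upto_ext n f g : (forall s : R, 0 < s -> f s = g s) -> smooth_upto n f -> smooth_upto n g.
Proof.
case: n => [//|n] fg [df fdf sdf]; exists df => // s s0.
by apply: (near_eq_is_derive _ (fdf s s0)); exact: near_pos fg.
Qed.

Lemma smooth_upto_pred n f : smooth_upto n.+1 f -> smooth_upto n f.
Proof. by elim: n f => [//|n IH] f [df fdf /IH ?]; exists df. Qed.

Lemma smooth_uptoD n f g : smooth_upto n f -> smooth_upto n g -> smooth_upto n (fun s => f s + g s).
Proof.
elim: n f g => [//|n IH] f g [df fdf sf] [dg gdg sg].
by exists (fun s => df s + dg s) => [s s0|]; [apply: is_deriveD; auto|exact: IH].
Qed.

Lemma smooth_uptoM n f g : smooth_upto n f -> smooth_upto n g -> smooth_upto n (fun s => f s * g s).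
Proof.
elim: n f g => [//|n IH] f g Sf Sg; have := Sf; have := Sg => -[dg gdg sg] [df fdf sf].
exists (fun s => f s * dg s + g s * df s) => [s s0|].
  by apply: is_deriveM; auto.
by apply: smooth_uptoD; apply: IH => //; exact: smooth_upto_pred.
Qed.

Lemma smooth_upto_cst n (a : R) : smooth_upto n (fun=> a).
Proof.
elim: n a => [//|n IH] a; exists (fun=> 0) => // s _; exact: is_derive_cst.
Qed.

Lemma smooth_cst a : smooth (fun=> a).
Proof. by move=> n; exact: smooth_upto_cst. Qed.

Lemma smooth_id : smooth id.
Proof. by case=> [//|n]; exists (fun=> 1) => [s _|]; [exact: is_derive_id|exact: smooth_cst]. Qed.

Lemma smoothD f g : smooth f -> smooth g -> smooth (fun s => f s + g s).
Proof. by move=> sf sg n; exact: smooth_uptoD. Qed.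

Lemma smoothM f g : smooth f -> smooth g -> smooth (fun s => f s * g s).
Proof. by move=> sf sg n; exact: smooth_uptoM. Qed.

Lemma smooth_ext f g : (forall s : R, 0 < s -> f s = g s) -> smooth f -> smooth g.
Proof. by move=> fg sf n; apply: smooth_upto_ext fg _. Qed.

Lemma smooth_sum (I : Type) (r : seq I) (f : I -> R -> R) : (forall i, smooth (f i)) ->
  smooth (fun s => \sum_(i <- r) f i s).
Proof.
move=> sf; elim: r => [|a r IH].
  by apply: smooth_ext (smooth_cst 0) => s _; rewrite big_nil.
by apply: smooth_ext (smoothD (sf a) IH) => s _; rewrite big_cons.
Qed.

Lemma smoothX f k : smooth f -> smooth (fun s => f s ^+ k).
Proof.
move=> sf; elim: k => [|k IH]; first by apply: smooth_ext (smooth_cst 1) => s _; rewrite expr0.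
by apply: smooth_ext (smoothM sf IH) => s _; rewrite exprS.
Qed.

(** Bootstrapping: each derivative of f gives, through the equation, one more. Inverses,
    powers and inverse square roots all satisfy such an equation. *)
Lemma smooth_ode f u k : smooth u -> (forall s : R, 0 < s -> is_derive s 1 f (u s * f s ^+ k)) ->
  smooth f.
Proof.
move=> su fdf; elim=> [//|n IH]; exists (fun s => u s * f s ^+ k) => //.
apply: smooth_uptoM => //; elim: k {fdf} => [|k IHk].
  by apply: smooth_upto_ext (smooth_upto_cst n 1) => s _; rewrite expr0.
by apply: smooth_upto_ext (smooth_uptoM IH IHk) => s _; rewrite exprS.
Qed.

Lemma smoothV f : (forall s : R, 0 < s -> f s != 0) -> smooth f -> smooth (fun s => (f s)^-1).
Proof.
move=> f0 sf; have /choice[df fdf] : forall s : R, exists l : R, 0 < s -> is_derive s 1 f l.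
  by move=> s; have [df ? _] := sf 1%N; exists (df s); auto.
have sdf : smooth df.
  move=> n; have [dg gdg sdg] := sf n.+1; apply: smooth_upto_ext sdg => s s0.
  by have /@derive_val <- := gdg s s0; have /@derive_val <- := fdf s s0.
apply: (@smooth_ode _ (fun s => - df s) 2); first by apply: smooth_ext (smoothM (smooth_cst (-1)) sdf) => s _; rewrite mulN1r.
move=> s s0; have := is_deriveV (f0 s s0) (fdf s s0).
by rewrite /GRing.scale/= mulrC exprVn mulrN mulNr.
Qed.

Lemma smooth_powR (a : R) : smooth (fun s => s `^ a).
Proof.
apply: (@smooth_ode _ (fun s => a * s^-1) 1).
  by apply: smoothM; [exact: smooth_cst|apply: smoothV smooth_id => s; exact: lt0r_neq0].
move=> s s0; have := is_derive1_powR a s0.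
by rewrite powRB ?powRr1 ?ltW// ?(gt_eqF s0) ?implybT// expr1 -mulrA [_^-1 * _]mulrC.
Qed.

Lemma smooth_sqrt f : (forall s : R, 0 < s -> 0 < f s) -> smooth f -> smooth (fun s => Num.sqrt (f s)).
Proof.
move=> f0 sf; have /choice[df fdf] : forall s : R, exists l : R, 0 < s -> is_derive s 1 f l.
  by move=> s; have [df ? _] := sf 1%N; exists (df s); auto.
have sdf : smooth df.
  move=> n; have [dg gdg sdg] := sf n.+1; apply: smooth_upto_ext sdg => s s0.
  by have /@derive_val <- := gdg s s0; have /@derive_val <- := fdf s s0.
have dsq (s : R) : 0 < s -> is_derive s 1 (fun s => Num.sqrt (f s)) ((2 * Num.sqrt (f s))^-1 * df s).
  move=> s0; exact: (@is_derive1_comp _ Num.sqrt f s _ _ (is_derive1_sqrt (f0 s s0)) (fdf s s0)).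
pose g s := (Num.sqrt (f s))^-1.
have sq0 s : 0 < s -> 0 < Num.sqrt (f s) by move=> /f0; rewrite sqrtr_gt0.
have sg : smooth g.
  apply: (@smooth_ode _ (fun s => - (2^-1 * df s)) 3).
    by apply: smooth_ext (smoothM (smooth_cst (- 2^-1)) sdf) => s _; rewrite mulNr.
  move=> s s0; have := @is_deriveV _ (fun s => Num.sqrt (f s)) s _ _ (lt0r_neq0 (sq0 s s0)) (dsq s s0).
  congr is_derive; rewrite /GRing.scale/= /g; field; exact/lt0r_neq0/sq0.
apply: smooth_ext (smoothM sf sg) => s s0; rewrite /g -{1}(sqr_sqrtr (ltW (f0 s s0))) expr2 mulfK//.
exact/lt0r_neq0/sq0.
Qed.

(** All derivatives at once, as the sequence needed by Taylor's formula and by sign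
    alternation. *)
Definition der_tower (F : nat -> R -> R) := forall k (s : R), 0 < s -> is_derive s 1 (F k) (F k.+1 s).

Lemma smooth_tower f : smooth f -> exists2 F, F 0 = f & der_tower F.
Proof.
move=> sf; exists (fun k => iter k (@derive1 R R) f); [by []|move=> k s s0].
have : smooth_upto 1 (iter k (@derive1 R R) f).
  have : forall n, smooth_upto (n + k) f -> smooth_upto n (iter k (@derive1 R R) f).
    move=> n; elim: k n => [n|k IH n]; first by rewrite addn0.
    rewrite addnS -addSn => /IH [df fdf sdf]; apply: smooth_upto_ext sdf => z z0.
    by rewrite iterS derive1E; have /@derive_val := fdf z z0.
  by apply; exact: sf.
move=> [df fdf _]; have := fdf s s0 => H.
by rewrite iterS derive1E (@derive_val _ _ _ _ _ _ _ H).
Qed.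

End Smooth.

(** * Confluent divided differences *)

Section Confluent.
Context {R : realType}.
Implicit Types (F : nat -> R -> R) (f g d e u x : R -> R) (s y z h : R).

Definition taylor F (N : nat) s (y : R) := \sum_(k < N) F k s / k`!%:R * y ^+ k.

Lemma taylorS F N s y : taylor F N.+1 s y =
  F 0 s + \sum_(k < N) F k.+1 s / k.+1`!%:R * y ^+ k.+1.
Proof. by rewrite /taylor big_ord_recl expr0 fact0 divr1 mulr1; congr (_ + _). Qed.

Lemma is_derive_taylor F N s y :
  is_derive y 1 (taylor F N.+1 s) (taylor (fun k => F k.+1) N s y).
Proof.
rewrite /taylor.
have -> : (fun y => \sum_(k < N.+1) F k s / k`!%:R * y ^+ k) =
  \sum_(k < N.+1) (fun y : R => F k s / k`!%:R * y ^+ k).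
  by apply/funext => z; rewrite fct_sumE.
apply: is_derive_eq.
  apply: is_derive_sum => k.
  have H : is_derive y 1 (fun y : R => y ^+ k) (k%:R * y ^+ k.-1).
    have := @is_deriveX _ _ (@id R) k y 1 1 (is_derive_id _ _).
    rewrite /GRing.scale/= mulr1; congr is_derive.
    by apply/funext => w; rewrite exprfctE.
  exact: is_deriveZ.
rewrite big_ord_recl/= mul0r scaler0 add0r; apply: eq_bigr => k _.
rewrite /GRing.scale/= /bump/= add1n factS natrM; field.
by rewrite pnatr_eq0 -lt0n fact_gt0/= addrC natr1 pnatr_eq0.
Qed.

Lemma tower_shift F : der_tower F -> der_tower (fun k => F k.+1).
Proof. by move=> dF k; exact: dF. Qed.

Lemma tower_continuous F k s : der_tower F -> 0 < s -> {for s, continuous (F k)}.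
Proof. by move=> dF s0; apply/differentiable_continuous/derivable1_diffP; have [] := dF k s s0. Qed.

(** The derivative of a remainder is the remainder of the shifted tower, one order
    lower: induction by the mean value theorem. *)
Lemma taylor_remainder F N s : der_tower F -> 0 < s ->
  exists2 C : R, 0 <= C & forall y, 0 <= y <= 1 -> `|F 0 (s + y) - taylor F N s y| <= C * y ^+ N.
Proof.
move=> + s0; elim: N F => [|N IH] F dF.
  have cF : {within `[s, s + 1], continuous (fun y => `|F 0 y|)}.
    apply: continuous_in_subspaceT => z; rewrite inE/= in_itv/= => /andP[sz _].
    by apply: continuous_comp; [exact: (tower_continuous dF (lt_le_trans s0 sz))|exact: norm_continuous].
  have [|c _ cmax] := EVT_max _ cF; first lra.
  exists (`|F 0 c|) => // y y01; rewrite /taylor big_ord0 subr0 expr0 mulr1.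
  by apply: cmax; rewrite in_itv/=; lra.
have [C C0 HC] := IH _ (tower_shift dF).
exists C => // y /andP[y0 y1].
have [->|yneq0] := eqVneq y 0.
  rewrite /taylor big_ord_recl/= big1 => [|k _]; last by rewrite expr0n mulr0.
  by rewrite expr0 fact0 divr1 mulr1 addr0 addr0 subrr normr0 mulr_ge0// exprn_ge0.
have ypos : 0 < y by rewrite lt_neqAle eq_sym yneq0.
pose h z := F 0 (s + z) - taylor F N.+1 s z.
have dh z : 0 <= z -> is_derive z 1 h (F 1 (s + z) - taylor (fun k => F k.+1) N s z).
  move=> z0; apply: is_deriveB; last exact: is_derive_taylor.
  have H1 : is_derive z 1 (fun z => s + z) 1.
    by rewrite -[X in is_derive _ _ _ X]add0r; apply: is_deriveD.
  have := @is_derive1_comp _ (F 0) (fun z => s + z) z (F 1 (s + z)) 1 (dF 0 (s + z) _) H1.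
  by rewrite mulr1; apply; lra.
have ch : {within `[0, y], continuous h}.
  apply: continuous_in_subspaceT => z; rewrite inE/= in_itv/= => /andP[z0 _].
  by apply/differentiable_continuous/derivable1_diffP; have [] := dh z z0.
have [z|z + E] := @MVT_segment _ h (fun z => F 1 (s + z) - taylor (fun k => F k.+1) N s z) 0 y y0 _ ch.
  by rewrite in_itv/= => /andP[z0 _]; apply: dh; exact: ltW.
rewrite in_itv/= => /andP[z0 zy].
have h0 : h 0 = 0.
  rewrite /h /taylor big_ord_recl/= big1 => [|k _]; last by rewrite expr0n mulr0.
  by rewrite expr0 fact0 divr1 mulr1 !addr0 subrr.
rewrite h0 !subr0 in E.
rewrite -/(h y) E normrM (gtr0_norm ypos) exprSr mulrA.
apply: ler_wpM2r => //; apply: (le_trans (HC z _)); first lra.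
by apply: ler_wpM2l => //; apply: lerXn2r => //; rewrite nnegrE.
Qed.

(** The last column of the inverse of a Vandermonde matrix; up to the factor n! these
    are the weights of the n-th finite difference. *)
Lemma leading_coef_weights (n : nat) : exists c : 'I_n.+1 -> R,
  forall k, (k <= n)%N -> \sum_i c i * (i%:R ^+ k) = (k == n)%:R.
Proof.
pose V := Vandermonde n.+1 (\row_(j < n.+1) (j%:R : R)).
have uV : V \in unitmx.
  rewrite unitmxE det_Vandermonde unitfE; apply/prodf_neq0 => i _; apply/prodf_neq0 => j ij.
  by rewrite !mxE subr_eq0 eqr_nat gtn_eqF.
pose c : 'cV[R]_n.+1 := invmx V *m delta_mx ord_max 0.
exists (fun i => c i 0) => k kn.
have : V *m c = delta_mx ord_max 0 by rewrite /c mulmxA mulmxV// mul1mx.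
move/matrixP => /(_ (Ordinal (kn : (k < n.+1)%N)) 0); rewrite !mxE/= eqxx andbT => <-.
by apply: eq_bigr => i _; rewrite !mxE mulrC.
Qed.

(** Test the Loewner kernel at s, s + h, ..., s + n h against the weights of the n-th
    difference. The Taylor coefficient t_(k+1) of F enters the divided difference at
    s + h i, s + h j as h^k times the sum over a of i^(k-a) j^a. The weights kill all
    monomials of degree below n in i or in j, so that up to the order h^(2n) only
    k = 2n, a = n survives, and the form is t_(2n+1) h^(2n) + O(h^(2n+1)). *)
Lemma pick_odd_derivative F n s : der_tower F -> pick (F 0) (F 1) -> 0 < s -> 0 <= F (n.*2.+1) s.
Proof.
move=> dF pF s0.
have [c cE] := leading_coef_weights n.
pose t k := F k s / k`!%:R.
suff : 0 <= t n.*2.+1 by rewrite /t pmulr_lge0// invr_gt0 ltr0n fact_gt0.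
have [C C0 HC] := taylor_remainder n.*2.+2 dF s0.
have [C' C'0 HC'] := taylor_remainder n.*2.+1 (tower_shift dF) s0.
pose N : R := n.+1%:R.
have N1 : 1 <= N by rewrite /N ler1n.
pose z h (i : 'I_n.+1) := s + h * i%:R.
pose P h (i j : 'I_n.+1) := \sum_(k < n.*2.+1) t k.+1 * h ^+ k * \sum_(a < k.+1) i%:R ^+ (k - a) * j%:R ^+ a.
pose E := (2 * C + C') * N ^+ n.*2.+2.
have Nge0 : 0 <= N by exact: le_trans N1.
have iN (i : 'I_n.+1) : (i%:R : R) <= N by rewrite ler_nat ltnW.
have err h i j : 0 < h -> h * N <= 1 ->
    `|loewner (F 0) (F 1) (z h i) (z h j) - P h i j| <= E * h ^+ n.*2.+1.
  move=> h0 hN.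
  have hi (k : 'I_n.+1) : 0 <= h * k%:R <= 1.
    by rewrite mulr_ge0 ?ler0n ?(ltW h0)//=; apply: le_trans hN; rewrite ler_wpM2l// ltW.
  have hXi (k : 'I_n.+1) M : (h * k%:R) ^+ M <= h ^+ M * N ^+ M.
    by rewrite exprMn; apply: ler_wpM2l; [exact/exprn_ge0/ltW|apply: lerXn2r; rewrite ?nnegrE].
  rewrite /loewner; case: eqVneq => [ij|ij].
    have {ij} ij : i = j.
      apply/val_inj/eqP; rewrite -(eqr_nat R); apply/eqP.
      by move: ij => /addrI /(mulfI (lt0r_neq0 h0)).
    subst j.
    have -> : P h i i = taylor (fun k => F k.+1) n.*2.+1 s (h * i%:R).
      rewrite /P /taylor; apply: eq_bigr => k _.
      rewrite (eq_bigr (fun=> i%:R ^+ k)) => [|a _]; last by rewrite -exprD subnK// -ltnS.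
      rewrite sumr_const card_ord /t factS natrM exprMn -[_ *+ _]mulr_natl; field.
      by rewrite pnatr_eq0 -lt0n fact_gt0/= addrC natr1 pnatr_eq0.
    apply: (le_trans (HC' _ (hi i))).
    rewrite /E -[_ * N ^+ _ * _]mulrA; apply: ler_pM => //; first by rewrite exprn_ge0//; have /andP[] := hi i.
      by rewrite lerDr mulr_ge0.
    rewrite (le_trans (hXi _ _))// mulrC ler_wpM2r ?(exprn_ge0 _ (ltW h0))//.
    by rewrite [X in _ <= X]exprSr; apply: ler_peMr => //; exact: exprn_ge0.
  have hij : (i%:R : R) - j%:R != 0.
    by rewrite subr_eq0; apply: contra_neq ij => e; rewrite /z e.
  have ijE : z h i - z h j = h * (i%:R - j%:R) by rewrite /z; ring.
  have PE : P h i j = (taylor F n.*2.+2 s (h * i%:R) - taylor F n.*2.+2 s (h * j%:R)) / (z h i - z h j).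
    rewrite !taylorS opprD addrACA subrr add0r -sumrB mulr_suml.
    apply: eq_bigr => k _; rewrite /t -mulrBr !exprMn -mulrBr subrXX ijE /=.
    rewrite (exprS h).
    have fk : ((k.+1)`!%:R : R) != 0 by rewrite pnatr_eq0 -lt0n fact_gt0.
    move: hij fk (lt0r_neq0 h0); move: (i%:R - j%:R) ((k.+1)`!%:R) => d q d0 q0 hn0.
    by field; rewrite ?hn0 ?d0 ?q0.
  rewrite PE -mulrBl.
  have -> : F 0 (z h i) - F 0 (z h j) - (taylor F n.*2.+2 s (h * i%:R) - taylor F n.*2.+2 s (h * j%:R)) =
    (F 0 (z h i) - taylor F n.*2.+2 s (h * i%:R)) - (F 0 (z h j) - taylor F n.*2.+2 s (h * j%:R)) by ring.
  rewrite normrM normfV ijE normrM (gtr0_norm h0).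
  have dij1 : 1 <= `|(i%:R : R) - j%:R|.
    have [lij|lij|eij] := ltngtP i j; last by rewrite eij subrr eqxx in hij.
      by rewrite ler0_norm ?opprB ?subr_le0 ?ler_nat ?(ltnW lij)// lerBrDl natr1 ler_nat.
    by rewrite ger0_norm ?subr_ge0 ?ler_nat ?(ltnW lij)// lerBrDl natr1 ler_nat.
  rewrite ler_pdivrMr; last by rewrite mulr_gt0// (lt_le_trans _ dij1).
  apply: (le_trans (ler_normB _ _)).
  apply: (@le_trans _ _ (2 * C * (h ^+ n.*2.+2 * N ^+ n.*2.+2))).
    rewrite -mulrA mulr_natl mulr2n; apply: lerD.
      by apply: (le_trans (HC _ (hi i))); exact: ler_wpM2l.
    by apply: (le_trans (HC _ (hi j))); exact: ler_wpM2l.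
  have -> : 2 * C * (h ^+ n.*2.+2 * N ^+ n.*2.+2) = 2 * C * N ^+ n.*2.+2 * h ^+ n.*2.+1 * h by rewrite (exprSr h); ring.
  have EE : 2 * C * N ^+ n.*2.+2 * h ^+ n.*2.+1 <= E * h ^+ n.*2.+1.
    apply: ler_wpM2r; first exact/exprn_ge0/ltW.
    by rewrite /E; apply: ler_wpM2r; [exact: exprn_ge0|rewrite lerDl].
  have E0 : 0 <= E * h ^+ n.*2.+1.
    apply: le_trans EE; apply: mulr_ge0; last exact/exprn_ge0/ltW.
    by apply: mulr_ge0; [exact: mulr_ge0|exact: exprn_ge0].
  apply: (le_trans (ler_wpM2r (ltW h0) EE)).
  by apply: ler_wpM2l => //; rewrite ler_peMr// ltW.
pose A := \sum_(i < n.+1) \sum_(j < n.+1) `|c i * c j|.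
(* E h^(2n+1) bounds the Taylor error of an entry of the kernel, and A sums up the weights. *)
have main h : 0 < h -> h * N <= 1 -> - (A * E * h) <= t n.*2.+1.
  move=> h0 hN.
  have zp i : 0 < z h i by rewrite /z ltr_wpDr// mulr_ge0// ltW.
  have := pF _ (z h) c zp.
  rewrite (_ : \sum_i _ = \sum_i \sum_j c i * c j * P h i j +
    \sum_i \sum_j c i * c j * (loewner (F 0) (F 1) (z h i) (z h j) - P h i j)); last first.
    rewrite -big_split/=; apply: eq_bigr => i _; rewrite -big_split/=; apply: eq_bigr => j _; ring.
  have -> : \sum_i \sum_j c i * c j * P h i j = t n.*2.+1 * h ^+ n.*2.
    rewrite /P.
    transitivity (\sum_(k < n.*2.+1) t k.+1 * h ^+ k * \sum_(a < k.+1)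
       (\sum_i c i * i%:R ^+ (k - a)) * (\sum_j c j * j%:R ^+ a)).
      under eq_bigr do under eq_bigr do rewrite mulr_sumr.
      under eq_bigr do rewrite exchange_big/=.
      rewrite exchange_big/=; apply: eq_bigr => k _.
      rewrite mulr_sumr.
      under eq_bigr do under eq_bigr do rewrite !mulr_sumr.
      under eq_bigr do rewrite exchange_big/=.
      rewrite exchange_big/=; apply: eq_bigr => a _.
      rewrite mulr_suml mulr_sumr; apply: eq_bigr => i _.
      rewrite mulr_sumr mulr_sumr; apply: eq_bigr => j _; ring.
    have S0 (k a : nat) : (a <= k)%N -> (k <= n.*2)%N ->
       (\sum_i c i * i%:R ^+ (k - a)) * (\sum_j c j * j%:R ^+ a) = ((k == n.*2) && (a == n))%:R.
      move=> ak kn; have [an|an|an] := ltngtP a n.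
      - by rewrite (cE a (ltnW an)) (ltn_eqF an) mulr0 andbF.
      - have ka : (k - a < n)%N by lia.
        by rewrite (cE (k - a)%N (ltnW ka)) (ltn_eqF ka) mul0r andbF.
      - subst a; rewrite (cE n)// eqxx mulr1 cE; last by lia.
        by rewrite andbT; congr (_%:R); lia.
    rewrite big_ord_recr/= big1 => [|k _]; last first.
      rewrite big1 ?mulr0// => a _; rewrite S0; last 2 first.
      - by rewrite -ltnS.
      - by rewrite ltnW.
      by rewrite ltn_eqF.
    have nn : (n < n.*2.+1)%N by lia.
    rewrite add0r (bigD1 (Ordinal nn))//=.
    have n2 : (n <= n.*2)%N by lia.
    rewrite (S0 n.*2 n n2 (leqnn _)).
    rewrite !eqxx big1 ?addr0 ?mulr1// => a an; rewrite (S0 n.*2 a) ?leqnn//; last by rewrite -ltnS.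
    by rewrite eqxx/=; case: eqP => // an'; case/negP: an; apply/eqP/val_inj.
  move=> H; have : - (A * (E * h ^+ n.*2.+1)) <= t n.*2.+1 * h ^+ n.*2.
    rewrite lerNl -subr_ge0 opprK; apply: le_trans H _; rewrite addrC lerD2r.
    apply: (le_trans (ler_norm _)); rewrite mulr_suml; apply: (le_trans (ler_norm_sum _ _ _)); apply: ler_sum => i _.
    rewrite mulr_suml; apply: (le_trans (ler_norm_sum _ _ _)); apply: ler_sum => j _.
    by rewrite normrM ler_wpM2l// err.
  rewrite exprS; have -> : - (A * (E * (h * h ^+ n.*2))) = - (A * E * h) * h ^+ n.*2 by ring.
  by rewrite ler_pM2r// exprn_gt0.
rewrite leNgt; apply/negP => tneg.
have A0 : 0 <= A by apply: sumr_ge0 => i _; apply: sumr_ge0.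
have E0 : 0 <= E by rewrite /E mulr_ge0 ?exprn_ge0 ?addr_ge0 ?mulr_ge0.
pose h := Num.min N^-1 (- t n.*2.+1 / (2 * (A * E + 1))).
have h0 : 0 < h.
  rewrite lt_min invr_gt0 (lt_le_trans _ N1)//= divr_gt0 ?oppr_gt0// mulr_gt0// ltr_wpDl// mulr_ge0//.
have hN : h * N <= 1.
  by rewrite -ler_pdivlMr ?mul1r ?ge_min ?lexx// (lt_le_trans _ N1).
have := main h h0 hN; rewrite leNgt => /negP; apply.
have h2 : h * (2 * (A * E + 1)) <= - t n.*2.+1.
  rewrite -ler_pdivlMr; first by rewrite ge_min lexx orbT.
  by rewrite mulr_gt0// ltr_wpDl// mulr_ge0.
have AE : 0 <= A * E by rewrite mulr_ge0.
nra.
Qed.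

End Confluent.

(** * Complete monotonicity *)

Section CompletelyMonotone.
Context {R : realType}.
Implicit Types (F : nat -> R -> R) (f g d e u : R -> R) (s y z a b M x : R).

Lemma unbounded_primitive f d x0 a : 0 < a ->
  (forall s, x0 <= s -> is_derive s 1 f (d s)) -> (forall s, x0 <= s -> a <= d s) ->
  forall M, exists2 x1, x0 <= x1 & forall s, x1 <= s -> M <= f s.
Proof.
move=> a0 df da M; exists (Num.max x0 (x0 + (M - f x0) / a)); first by rewrite le_max lexx.
move=> s; rewrite ge_max => /andP[xs Ms].
have cf : {within `[x0, s], continuous f}.
  apply: continuous_in_subspaceT => z; rewrite inE/= in_itv/= => /andP[sz _].
  by apply/differentiable_continuous/derivable1_diffP; have [] := df z sz.
have [z|z] := @MVT_segment _ f d x0 s xs _ cf.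
  by rewrite in_itv/= => /andP[/ltW xz _]; exact: df.
rewrite in_itv/= => /andP[xz zs] E.
have H : (M - f x0) / a <= s - x0 by lra.
rewrite ler_pdivrMr// in H.
have := da z xz; nra.
Qed.

Lemma tower_monotone F k x0 : der_tower F -> 0 < x0 -> (forall s, x0 <= s -> 0 <= F k.+1 s) ->
  forall s, x0 <= s -> F k x0 <= F k s.
Proof.
move=> dF x00 F0 s xs.
have cf : {within `[x0, s], continuous (F k)}.
  apply: continuous_in_subspaceT => z; rewrite inE/= in_itv/= => /andP[sz _].
  exact: (tower_continuous dF (lt_le_trans x00 sz)).
have [z|z] := @MVT_segment _ (F k) (F k.+1) x0 s xs _ cf.
  by rewrite in_itv/= => /andP[/ltW xz _]; exact: dF (lt_le_trans x00 xz).
rewrite in_itv/= => /andP[xz zs] E; have := F0 z xz; nra.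
Qed.

(** A positive even derivative would, through the positivity of the next odd one,
    force growth faster than linear. *)
Lemma tower_even_derivative F C : der_tower F -> (forall n s, 0 < s -> 0 <= F n.*2.+1 s) ->
  (forall s, 1 <= s -> F 0 s <= C * s) -> forall n s, 0 < s -> F n.+1.*2 s <= 0.
Proof.
move=> dF F0 FC n x0 x00; rewrite leNgt; apply/negP => Fp.
pose y := F n.+1.*2 x0.
have base s : x0 <= s -> y <= F n.+1.*2 s.
  by apply: tower_monotone => // z xz; apply: (F0 n.+1); exact: lt_le_trans xz.
have step : forall j k, (k + j = n.*2.+1)%N -> forall M, exists2 x1, x0 <= x1 & forall s, x1 <= s -> M <= F k s.
  elim=> [k|j IH k kj M].
    rewrite addn0 => -> M; apply: (@unbounded_primitive _ (F n.+1.*2) x0 y) => // s xs.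
    exact: dF (lt_le_trans x00 xs).
  have [|x1 x01 H] := IH k.+1 _ 1; first by lia.
  have [|s xs|x2 x12 H2] := @unbounded_primitive (F k) (F k.+1) x1 1 _ _ H M; first lra.
    by apply: dF; rewrite (lt_le_trans x00)// (le_trans x01).
  by exists x2 => //; apply: le_trans x12.
have [|x1 x01 H] := step n.*2 1%N _ (C + 1); first by lia.
have x10 : 0 < x1 by exact: lt_le_trans x01.
have [| | |x2 x12 H2] := @unbounded_primitive (fun s => F 0 s - C * s) (fun s => F 1%N s - C) x1 1 _ _ _ 1; first lra.
- move=> s xs; apply: is_deriveB; first by apply: dF; exact: lt_le_trans xs.
  by rewrite -[X in is_derive _ _ _ X]mulr1; apply: is_deriveZ.
- by move=> s /H; lra.
have := H2 (Num.max x2 1); rewrite le_max lexx => /(_ isT).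
have := FC (Num.max x2 1); rewrite le_max lexx orbT => /(_ isT); lra.
Qed.

(** The minus sign of each differentiation is absorbed in the derivative, so that all
    functions occurring are nonnegative. *)
Fixpoint cm_upto n f : Prop := (forall s, 0 < s -> 0 <= f s) /\
  if n is m.+1 then exists2 df, (forall s, 0 < s -> is_derive s 1 f (- df s)) & cm_upto m df
  else True.

Definition cm f := forall n, cm_upto n f.

Lemma cm_upto_pred n f : cm_upto n.+1 f -> cm_upto n f.
Proof.
elim: n f => [|n IH] f [f0 [df fdf cdf]]; split => //.
by exists df => //; exact: IH.
Qed.

Lemma cm_upto_ext n f g : (forall s, 0 < s -> f s = g s) -> cm_upto n f -> cm_upto n g.
Proof.
move=> fg; case: n => [|n] [f0].
  by split => // s s0; rewrite -fg ?f0.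
move=> [df fdf cdf]; split; first by move=> s s0; rewrite -fg ?f0.
exists df => // s s0; apply: (near_eq_is_derive _ (fdf s s0)); exact: near_pos fg.
Qed.

Lemma cm_ext f g : (forall s, 0 < s -> f s = g s) -> cm f -> cm g.
Proof. by move=> fg cf n; exact: cm_upto_ext fg _. Qed.

Lemma cm_uptoD n f g : cm_upto n f -> cm_upto n g -> cm_upto n (fun s => f s + g s).
Proof.
elim: n f g => [|n IH] f g [f0 Hf] [g0 Hg]; split => //; try by move=> s s0; rewrite addr_ge0 ?f0 ?g0.
move: Hf Hg => [df fdf cf] [dg gdg cg]; exists (fun s => df s + dg s); last exact: IH.
by move=> s s0; rewrite opprD; apply: is_deriveD; [exact: fdf|exact: gdg].
Qed.

Lemma cm_uptoM n f g : cm_upto n f -> cm_upto n g -> cm_upto n (fun s => f s * g s).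
Proof.
elim: n f g => [|n IH] f g Cf Cg; (have [f0 Hf] := Cf); (have [g0 Hg] := Cg); split => //;
  try by move=> s s0; rewrite mulr_ge0 ?f0 ?g0.
move: Hf Hg => [df fdf cf] [dg gdg cg]; exists (fun s => f s * dg s + g s * df s).
  move=> s s0; rewrite opprD -!mulrN; apply: is_deriveM; [exact: fdf|exact: gdg].
by apply: cm_uptoD; apply: IH => //; exact: cm_upto_pred.
Qed.

Lemma cm_upto_cst n a : 0 <= a -> cm_upto n (fun=> a).
Proof.
elim: n a => [//|n IH] a a0; split => //; exists (fun=> 0); last exact: IH.
by move=> s _; rewrite oppr0; exact: is_derive_cst.
Qed.

Lemma tower_cm F : der_tower F -> (forall k s, 0 < s -> 0 <= (-1) ^+ k * F k s) -> cm (F 0).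
Proof.
move=> + + n; elim: n F => [|n IH] F dF F0; split => //; try by move=> s s0; rewrite -[F 0 s]mul1r -[1](expr0 (-1)) F0.
exists (fun s => - F 1 s); first by move=> s s0; rewrite opprK; exact: dF.
apply: (IH (fun k s => - F k.+1 s)).
  by move=> k s s0; apply: is_deriveN; exact: dF.
by move=> k s s0; rewrite mulrN -mulNr -mulN1r -exprS F0.
Qed.

(** The derivative is - x df times the function itself, so the product rule gives an
    induction on the order. *)
Lemma cm_exp f df x : 0 <= x -> (forall s, 0 < s -> is_derive s 1 f (df s)) -> cm df ->
  cm (fun s => expR (- (x * f s))).
Proof.
move=> x0 fdf cdf; elim=> [|n IH]; split => //; try by move=> s s0; exact: expR_ge0.
exists (fun s => (x * df s) * expR (- (x * f s))); last first.
  by apply: cm_uptoM => //; apply: cm_uptoM => //; exact: cm_upto_cst.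
move=> s s0.
have H : is_derive s 1 (fun s => - (x * f s)) (- (x * df s)) by apply: is_deriveN; apply: is_deriveZ; exact: fdf.
have := @is_derive1_comp _ expR _ s _ _ (is_derive_expR _) H.
by rewrite mulrN mulrC.
Qed.

Lemma cmV f df : (forall s, 0 < s -> 0 < f s) -> (forall s, 0 < s -> is_derive s 1 f (df s)) -> cm df ->
  cm (fun s => (f s)^-1).
Proof.
move=> f0 fdf cdf; elim=> [|n IH]; split => //; try by move=> s s0; rewrite invr_ge0 ltW ?f0.
exists (fun s => df s * ((f s)^-1 * (f s)^-1)); last by apply: cm_uptoM => //; exact: cm_uptoM.
move=> s s0; have := is_deriveV (lt0r_neq0 (f0 s s0)) (fdf s s0).
by rewrite /GRing.scale/= mulNr mulrC expr2 invfM.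
Qed.

(** The odd derivatives are nonnegative by the confluent Loewner kernel, and then
    growth at most linear forces the even ones to be nonpositive. *)
Lemma pick_bernstein f d C : (forall s, 0 < s -> is_derive s 1 f (d s)) -> pick f d -> smooth f ->
  (forall s, 1 <= s -> f s <= C * s) -> cm d.
Proof.
move=> fd pf sf fC; have [F F0 dF] := smooth_tower sf.
have E s : 0 < s -> F 1 s = d s.
  move=> s0; have := dF 0 s s0; rewrite F0 => /@derive_val <-.
  by have /@derive_val := fd s s0.
have pF : pick (F 0) (F 1).
  by apply: pick_ext pf => s s0; rewrite ?F0 ?E.
have Fodd n s : 0 < s -> 0 <= F n.*2.+1 s by move=> s0; exact: pick_odd_derivative.
have Feven n s : 0 < s -> F n.+1.*2 s <= 0.
  by apply: (@tower_even_derivative F C) => // z z1; rewrite F0; exact: fC.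
apply: (@cm_ext (F 1)) => //.
apply: (@tower_cm (fun k => F k.+1)); first exact: tower_shift.
move=> k s s0; rewrite -signr_odd.
have := odd_double_half k; case: odd => /= <-; rewrite ?add1n ?add0n.
  by rewrite expr1 mulN1r oppr_ge0 -doubleS Feven.
by rewrite expr0 mul1r Fodd.
Qed.

End CompletelyMonotone.

(** * The square root of the symbol *)

Section Symbol.
Context {R : realType} (m : nat) (c : R) (cs al : 'I_m -> R).
Hypothesis hal : forall j : 'I_m, 1 <= al j < 2.
Hypothesis hc : 0 < c.
Hypothesis hcs : forall j : 'I_m, 0 < cs j.
Implicit Types (s : R).

Local Notation g := (charfun c cs al).
Definition symbol_sqrt s := Num.sqrt (charfun c cs al s).
Local Notation lam := symbol_sqrt.

Lemma charfun_ge s : 0 < s -> c * s ^+ 2 <= g s.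
Proof.
move=> s0; rewrite /charfun lerDl sumr_ge0// => j _.
by rewrite mulr_ge0// ?powR_ge0// ltW.
Qed.

Lemma charfun_gt0 s : 0 < s -> 0 < g s.
Proof. by move=> s0; apply: lt_le_trans (charfun_ge s0); rewrite mulr_gt0// exprn_gt0. Qed.

Lemma symbol_sqrt_gt0 s : 0 < s -> 0 < lam s.
Proof. by move=> s0; rewrite sqrtr_gt0 charfun_gt0. Qed.

Lemma symbol_sqrtK s : 0 < s -> lam s ^+ 2 = g s.
Proof. by move=> s0; rewrite sqr_sqrtr// ltW// charfun_gt0. Qed.

Lemma symbol_sqrt_ge s : 0 < s -> Num.sqrt c * s <= lam s.
Proof.
move=> s0; rewrite -(ler_pXn2r (ltn0Sn 1)) ?nnegrE ?sqrtr_ge0 ?mulr_ge0 ?sqrtr_ge0 ?(ltW s0)//.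
by rewrite symbol_sqrtK// exprMn sqr_sqrtr ?charfun_ge// ltW.
Qed.

Lemma symbol_sqrt_le s : 1 <= s -> lam s <= Num.sqrt (c + \sum_j cs j) * s.
Proof.
move=> s1; have s0 : 0 < s by lra.
have C0 : 0 <= c + \sum_j cs j by apply: addr_ge0; [exact: ltW|apply: sumr_ge0 => j _; exact: ltW].
rewrite -(ler_pXn2r (ltn0Sn 1)) ?nnegrE ?sqrtr_ge0 ?mulr_ge0 ?sqrtr_ge0 ?(ltW s0)//.
rewrite symbol_sqrtK// exprMn sqr_sqrtr// mulrDl lerD2l mulr_suml ler_sum// => j _.
apply: ler_wpM2l; first exact/ltW/hcs.
rewrite -(powR_mulrn 2 (ltW s0)); apply: ler_powR => //.
by case/andP: (hal j) => _ /ltW.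
Qed.

Lemma smooth_charfun : smooth g.
Proof.
apply: smoothD; first by apply: smoothM; [exact: smooth_cst|apply: smoothX; exact: smooth_id].
by apply: smooth_sum => j; apply: smoothM; [exact: smooth_cst|exact: smooth_powR].
Qed.

Lemma smooth_symbol_sqrt : smooth lam.
Proof. by apply: smooth_sqrt smooth_charfun => s; exact: charfun_gt0. Qed.

Lemma smooth_derivative (f : R -> R) : smooth f -> exists df, forall s, 0 < s -> is_derive s 1 f (df s).
Proof. by move=> /(_ 1)[df fdf _]; exists df. Qed.

(** Hiding the derivative spares the formulas for it in composite expressions. *)
Definition is_pick (f : R -> R) := exists2 d, pick f d & forall s, 0 < s -> is_derive s 1 f (d s).

Lemma is_pick_derive (f df : R -> R) : (forall s, 0 < s -> is_derive s 1 f (df s)) ->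
  is_pick f -> pick f df.
Proof.
move=> fdf [d pf fd]; apply: pick_ext pf => // s s0.
by have /@derive_val <- := fd s s0; have /@derive_val := fdf s s0.
Qed.

Lemma is_pick_ext (f h : R -> R) : (forall s, 0 < s -> f s = h s) -> is_pick f -> is_pick h.
Proof.
move=> fh [d pf fd]; exists d; first exact: pick_ext pf.
by move=> s s0; apply: (near_eq_is_derive _ (fd s s0)); exact: near_pos fh.
Qed.

Lemma is_pick_cst (a : R) : is_pick (fun=> a).
Proof. by exists (fun=> 0); [exact: pick_cst|move=> s _; exact: is_derive_cst]. Qed.

Lemma is_pick_id : is_pick id.
Proof. by exists (fun=> 1); [exact: pick_id|move=> s _; exact: is_derive_id]. Qed.

Lemma is_pickD (f h : R -> R) : is_pick f -> is_pick h -> is_pick (fun s => f s + h s).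
Proof.
move=> [d pf fd] [e ph he]; exists (fun s => d s + e s); first exact: pickD.
by move=> s s0; apply: is_deriveD; [exact: fd|exact: he].
Qed.

Lemma is_pickZ (a : R) (f : R -> R) : 0 <= a -> is_pick f -> is_pick (fun s => a * f s).
Proof.
move=> a0 [d pf fd]; exists (fun s => a * d s); first exact: pickZ.
by move=> s s0; apply: is_deriveZ; exact: fd.
Qed.

Lemma is_pick_sum (I : Type) (r : seq I) (f : I -> R -> R) : (forall i, is_pick (f i)) ->
  is_pick (fun s => \sum_(i <- r) f i s).
Proof.
move=> pf; elim: r => [|a r IH].
  by apply: is_pick_ext (is_pick_cst 0) => s _; rewrite big_nil.
by apply: is_pick_ext (is_pickD (pf a) IH) => s _; rewrite big_cons.
Qed.

Lemma is_pickNV (f : R -> R) : (forall s, 0 < s -> f s != 0) -> is_pick f -> is_pick (fun s => - (f s)^-1).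
Proof.
move=> f0 [d pf fd]; exists (fun s => d s / f s ^+ 2); first exact: pickNV.
move=> s s0; have := is_deriveN (is_deriveV (f0 s s0) (fd s s0)).
by rewrite /GRing.scale/= mulNr opprK mulrC.
Qed.

Lemma is_pick_powR (b : R) : 0 <= b <= 1 -> is_pick (fun s => s `^ b).
Proof. by move=> b01; exists (fun s => b * s `^ (b - 1)); [exact: pick_powR|move=> s s0; exact: is_derive1_powR]. Qed.

Lemma is_pick_geomean (f h : R -> R) : (forall s, 0 < s -> 0 < f s) -> (forall s, 0 < s -> 0 < h s) ->
  is_pick f -> is_pick h -> is_pick (fun s => Num.sqrt (f s * h s)).
Proof.
move=> f0 h0 [d pf fd] [e ph he].
exists (fun s => (d s * h s + f s * e s) / (2 * Num.sqrt (f s * h s))); first exact: pick_geomean.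
move=> s s0.
have H : is_derive s 1 (fun s => f s * h s) (f s * e s + h s * d s).
  exact: (is_deriveM (fd s s0) (he s s0)).
have fh0 : 0 < f s * h s by rewrite mulr_gt0 ?f0 ?h0.
have := @is_derive1_comp _ Num.sqrt (fun s => f s * h s) s _ _ (is_derive1_sqrt fh0) H.
by congr is_derive; rewrite mulrC; congr (_ / _); ring.
Qed.

Let G s := c * s + \sum_j cs j * s `^ (al j - 1).

Lemma charfunE s : 0 < s -> g s = s * G s.
Proof.
move=> s0; rewrite /charfun /G mulrDr mulr_sumr; congr (_ + _); first by rewrite expr2; ring.
apply: eq_bigr => j _; rewrite mulrCA; congr (_ * _).
by rewrite -[X in X * _](powRr1 (ltW s0)) -powRD ?(gt_eqF s0) ?implybT//; congr (_ `^ _); ring.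
Qed.

(** sqrt g is the geometric mean of s and of g / s = c s + \sum_j cs j * s ^ (al j - 1),
    whose exponents lie in [0, 1]: this is where 1 <= al j enters. *)
Lemma is_pick_symbol_sqrt : is_pick lam.
Proof.
have pG : is_pick G.
  apply: is_pickD; first by apply: is_pickZ is_pick_id; exact: ltW.
  apply: is_pick_sum => j; apply: is_pickZ; first exact/ltW/hcs.
  by apply: is_pick_powR; have := hal j; lra.
have G0 s : 0 < s -> 0 < G s.
  by move=> s0; have := charfun_gt0 s0; rewrite charfunE// pmulr_rgt0.
apply: is_pick_ext (is_pick_geomean _ G0 is_pick_id pG) => // s s0.
by rewrite /lam charfunE.
Qed.

(** The dual function s / sqrt g is the geometric mean of 1 and of the parallel
    sum s / G of the functions 1 / c and s ^ (2 - al j) / cs j. *)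
Lemma is_pick_dual : is_pick (fun s => s / lam s).
Proof.
pose k s := - c + \sum_j cs j * (- (s `^ (2 - al j))^-1).
have pk : is_pick k.
  apply: is_pickD; first exact: is_pick_cst.
  apply: is_pick_sum => j; apply: is_pickZ; first exact/ltW/hcs.
  apply: is_pickNV; first by move=> s s0; rewrite gt_eqF// powR_gt0.
  by apply: is_pick_powR; have := hal j; lra.
have kE s : 0 < s -> k s = - (g s / s ^+ 2).
  move=> s0; rewrite /k /charfun mulrDl mulfK ?expf_neq0 ?gt_eqF// opprD; congr (_ + _).
  rewrite mulr_suml -sumrN; apply: eq_bigr => j _; rewrite -mulrA -mulrN; congr (_ * _).
  rewrite -powR_mulrn ?(ltW s0)// -!powRN -powRD ?(gt_eqF s0) ?implybT//.
  by congr (- (_ `^ _)); ring.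
have ks s : 0 < s -> - (k s)^-1 = s ^+ 2 / g s.
  by move=> s0; rewrite kE// invrN opprK invf_div.
have kn s : 0 < s -> k s != 0.
  by move=> s0; rewrite kE// oppr_eq0 gt_eqF// divr_gt0 ?charfun_gt0// exprn_gt0.
have kp s : 0 < s -> 0 < - (k s)^-1.
  by move=> s0; rewrite ks// divr_gt0 ?charfun_gt0// exprn_gt0.
apply: is_pick_ext (is_pick_geomean _ kp (is_pick_cst 1) (is_pickNV kn pk)) => // s s0.
have l0 := symbol_sqrt_gt0 s0.
rewrite mul1r ks// -symbol_sqrtK// -expr_div_n sqrtr_sqr ger0_norm//.
by rewrite divr_ge0 ?ltW.
Qed.

Lemma symbol_sqrt_bernstein : exists2 dl, forall s, 0 < s -> is_derive s 1 lam (dl s) & cm dl.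
Proof.
have [dl ldl] := smooth_derivative smooth_symbol_sqrt; exists dl => //.
apply: (@pick_bernstein _ lam dl (Num.sqrt (c + \sum_j cs j))) => //.
- exact: is_pick_derive is_pick_symbol_sqrt.
- exact: smooth_symbol_sqrt.
- exact: symbol_sqrt_le.
Qed.

(** sqrt g / s is the inverse of the Bernstein function s / sqrt g. *)
Lemma cm_symbol_sqrt_div : cm (fun s => lam s / s).
Proof.
have sp : smooth (fun s => s / lam s).
  apply: smoothM smooth_id _; apply: smoothV smooth_symbol_sqrt => s s0.
  exact/lt0r_neq0/symbol_sqrt_gt0.
have [dp pdp] := smooth_derivative sp.
have cdp : cm dp.
  apply: (@pick_bernstein _ (fun s => s / lam s) dp (Num.sqrt c)^-1) => //.
    exact: is_pick_derive is_pick_dual.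
  move=> s s1; have s0 : 0 < s by lra.
  have sc : 0 < Num.sqrt c by rewrite sqrtr_gt0.
  rewrite [leLHS]mulrC ler_wpM2r ?(ltW s0)// lef_pV2 ?posrE ?symbol_sqrt_gt0//.
  by apply: le_trans (symbol_sqrt_ge s0); rewrite ler_peMr// ltW.
apply: cm_ext (cmV _ pdp cdp) => s s0; first by rewrite invf_div.
by rewrite divr_gt0 ?symbol_sqrt_gt0.
Qed.

Lemma cm_symbol_exp x : 0 <= x -> cm (fun s => expR (- (x * lam s))).
Proof. by move=> x0; have [dl ldl cdl] := symbol_sqrt_bernstein; exact: cm_exp ldl cdl. Qed.

End Symbol.

(** * Laplace transforms and alternating differences *)

Section RealIntegrals.
Context d {T : measurableType d} {R : realType} (mu : {measure set T -> \bar R}).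
Implicit Types (D : set T) (f g b : T -> R) (M : R).

Lemma dominated_integrable D f g : measurable D -> measurable_fun D f ->
  (forall x, D x -> `|f x| <= g x) -> mu.-integrable D (EFin \o g) -> mu.-integrable D (EFin \o f).
Proof.
move=> mD mf fg; apply: le_integrable => //; first exact/measurable_EFinP.
by move=> x Dx /=; rewrite lee_fin (le_trans (fg x Dx))// ler_norm.
Qed.

Lemma integrable_measurable D f : mu.-integrable D (EFin \o f) -> measurable_fun D f.
Proof. by move=> /(measurable_int mu)/measurable_EFinP. Qed.

Lemma integrable_mul_bounded D b f M : measurable D -> measurable_fun D b ->
  (forall x, D x -> `|b x| <= M) -> mu.-integrable D (EFin \o f) ->
  mu.-integrable D (EFin \o (fun x => b x * f x)).
Proof.
move=> mD mb bM If.
apply: (@dominated_integrable _ _ (fun x => M * `|f x|)) => //.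
- by apply: measurable_funM => //; exact: integrable_measurable.
- by move=> x Dx; rewrite normrM ler_wpM2r// bM.
- by have := integrableZl mD M (integrable_norm If).
Qed.

Lemma Rintegral_dominated_cvg D (f_ : nat -> T -> R) f g : measurable D ->
  (forall n, measurable_fun D (f_ n)) -> (forall x, D x -> f_ n x @[n --> \oo] --> f x) ->
  mu.-integrable D (EFin \o g) -> (forall n x, D x -> `|f_ n x| <= g x) ->
  mu.-integrable D (EFin \o f) /\
  \int[mu]_(x in D) f_ n x @[n --> \oo] --> \int[mu]_(x in D) f x.
Proof.
move=> mD mf cf Ig fg.
have mlf : measurable_fun D f by exact: (measurable_fun_cvg mf).
have [] := @dominated_convergence _ _ _ mu D mD (fun n => EFin \o f_ n) (EFin \o f) (EFin \o g).
- by move=> n; exact/measurable_EFinP.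
- exact/measurable_EFinP.
- apply: aeW => x Dx /=; apply: cvg_EFin; first exact: nearW.
  exact: cf.
- exact: Ig.
- by apply: aeW => x n Dx /=; rewrite lee_fin fg.
move=> If _ Hc; split => //; apply: fine_cvg; rewrite /Rintegral fineK//.
exact: integrable_fin_num.
Qed.

Lemma integrable_scale D (a : R) f : measurable D -> mu.-integrable D (EFin \o f) ->
  mu.-integrable D (EFin \o (fun x => a * f x)).
Proof. by move=> mD If; have := integrableZl mD a If. Qed.

Lemma integrable_sumr D (I : Type) (r : seq I) (f : I -> T -> R) : measurable D ->
  (forall i, mu.-integrable D (EFin \o f i)) ->
  mu.-integrable D (EFin \o (fun x => \sum_(i <- r) f i x)).
Proof.
move=> mD If; have := integrable_sum (P := xpredT) mD r (fun i _ => If i).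
by apply: eq_integrable => // x _ /=; rewrite sumEFin.
Qed.

Lemma Rintegral_sum D (I : Type) (r : seq I) (f : I -> T -> R) : measurable D ->
  (forall i, mu.-integrable D (EFin \o f i)) ->
  \int[mu]_(x in D) (\sum_(i <- r) f i x) = \sum_(i <- r) \int[mu]_(x in D) f i x.
Proof.
move=> mD If; elim: r => [|a r IH].
  by under eq_Rintegral do rewrite big_nil; rewrite big_nil Rintegral_cst// mul0r.
under eq_Rintegral do rewrite big_cons.
by rewrite big_cons -IH RintegralD//; exact: integrable_sumr.
Qed.

End RealIntegrals.

Section Laplace.
Context {R : realType}.
Notation mu := (@lebesgue_measure R).
Implicit Types (u v f F : R -> R) (s t h x y z M a b : R).

Definition lap_integrable u s := mu.-integrable `[0, +oo[ (EFin \o (fun t => expR (- s * t) * u t)).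
Definition lap u s := \int[mu]_(t in `[0, +oo[) (expR (- s * t) * u t).

Lemma measurable_expM s {D : set R} : measurable_fun D (fun t => expR (- s * t)).
Proof.
apply: measurable_funTS; apply: continuous_measurable_fun => t.
apply: continuous_comp; last exact: continuous_expR.
by apply: mulrl_continuous.
Qed.

Lemma lap_integrable_measurable u s : lap_integrable u s -> measurable_fun (`[0, +oo[ : set R) u.
Proof.
move=> /integrable_measurable m.
have : measurable_fun (`[0, +oo[ : set R) (fun t => expR (- (- s) * t) * (expR (- s * t) * u t)).
  by apply: measurable_funM => //; exact: measurable_expM.
by apply: eq_measurable_fun => t _; rewrite mulrA -expRD -mulrDl opprK subrr mul0r expR0 mul1r.
Qed.

Lemma lap_integrable_mul u (b : R -> R) s M : measurable_fun (`[0, +oo[ : set R) b -> (forall t, 0 <= t -> `|b t| <= M) ->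
  lap_integrable u s -> lap_integrable (fun t => b t * u t) s.
Proof.
move=> mb bM Iu.
have := @integrable_mul_bounded _ _ _ mu `[0, +oo[ b _ M _ mb _ Iu.
rewrite /lap_integrable.
under [X in _ \o X]eq_fun do rewrite mulrCA.
by apply=> // t; rewrite /= in_itv/= andbT => /bM.
Qed.

Lemma lap_integrable_ge u s s' : s <= s' -> lap_integrable u s -> lap_integrable u s'.
Proof.
move=> ss Iu; apply: dominated_integrable (integrable_norm Iu) => //.
  apply: measurable_funM; first exact: measurable_expM.
  exact: lap_integrable_measurable Iu.
move=> t; rewrite /= in_itv/= andbT => t0; rewrite !normrM ler_wpM2r// !ger0_norm ?expR_ge0//.
by rewrite ler_expR ler_wpM2r// lerN2.
Qed.

Lemma Rintegral_lower_bound f p q (k : R) : 0 <= p -> p <= q -> 0 <= k ->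
  mu.-integrable `[0, +oo[ (EFin \o f) -> (forall t, 0 <= t -> 0 <= f t) ->
  (forall t, p <= t <= q -> k <= f t) -> k * (q - p) <= \int[mu]_(t in `[0, +oo[) f t.
Proof.
move=> p0 pq k0 If f0 kf.
rewrite -lee_fin /Rintegral fineK; last exact: integrable_fin_num.
apply: (@le_trans _ _ (\int[mu]_(z in `[p, q]) (f z)%:E)%E); last first.
  apply: ge0_subset_integral => //.
  - exact: (measurable_int mu).
  - by move=> z; rewrite /= in_itv/= andbT lee_fin; exact: f0.
  - by move=> z; rewrite /= !in_itv/= andbT => /andP[pz _]; apply: le_trans pz.
apply: (@le_trans _ _ (\int[mu]_(z in `[p, q]) k%:E)%E).
  rewrite integral_cst//= lebesgue_measure_itv/= lte_fin.
  by move: pq; rewrite le_eqVlt => /predU1P[->|->]; rewrite ?ltxx ?subrr ?mulr0 ?mule0// -EFinB -EFinM.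
apply: ge0_le_integral => //.
- apply: measurable_funS (measurable_int mu If) => // z; rewrite /= !in_itv/= andbT => /andP[pz _]; exact: le_trans pz.
Qed.

(** A substitute for complete monotonicity that passes to transforms and products
    without differentiation: for u with transform F, the n-th difference is the
    transform of (1 - e^(-t))^n u. *)
Fixpoint alt_upto n F : Prop := (forall s, 0 < s -> 0 <= F s) /\
  if n is m.+1 then alt_upto m (fun s => F s - F (s + 1)) else True.
Definition alt F := forall n, alt_upto n F.

Lemma alt_upto_ge0 n F s : alt_upto n F -> 0 < s -> 0 <= F s.
Proof. by case: n => [|n] [F0 _]; exact: F0. Qed.

Lemma alt_upto_pred n F : alt_upto n.+1 F -> alt_upto n F.
Proof. by elim: n F => [|n IH] F [F0 HF]; split => //; exact: IH. Qed.

Lemma alt_upto_ext n F F' : (forall s, 0 < s -> F s = F' s) -> alt_upto n F -> alt_upto n F'.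
Proof.
elim: n F F' => [|n IH] F F' FF [F0 HF]; split => //; try by move=> s s0; rewrite -FF ?F0.
apply: IH HF => s s0; rewrite !FF//; lra.
Qed.

Lemma alt_upto_shift n F : alt_upto n F -> alt_upto n (fun s => F (s + 1)).
Proof.
elim: n F => [|n IH] F [F0 HF]; split => //; try by move=> s s0; apply: F0; lra.
exact: (IH _ HF).
Qed.

Lemma alt_uptoD n F F' : alt_upto n F -> alt_upto n F' -> alt_upto n (fun s => F s + F' s).
Proof.
elim: n F F' => [|n IH] F F' [F0 HF] [F'0 HF']; split => //; try by move=> s s0; rewrite addr_ge0 ?F0 ?F'0.
by apply: alt_upto_ext (IH _ _ HF HF') => s _; ring.
Qed.

Lemma alt_uptoM n F F' : alt_upto n F -> alt_upto n F' -> alt_upto n (fun s => F s * F' s).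
Proof.
elim: n F F' => [|n IH] F F' aF aF'; (have [F0 HF] := aF); (have [F'0 HF'] := aF');
  split => //; try by move=> s s0; rewrite mulr_ge0 ?F0 ?F'0.
have H1 := IH _ _ (alt_upto_pred aF) HF'.
have H2 := IH _ _ HF (alt_upto_shift (alt_upto_pred aF')).
by apply: alt_upto_ext (alt_uptoD H1 H2) => s _; ring.
Qed.

Lemma altM F F' : alt F -> alt F' -> alt (fun s => F s * F' s).
Proof. by move=> aF aF' n; exact: alt_uptoM. Qed.

Lemma alt_ext F F' : (forall s, 0 < s -> F s = F' s) -> alt F -> alt F'.
Proof. by move=> FF aF n; exact: alt_upto_ext FF _. Qed.

Lemma cm_upto_diff n F : cm_upto n.+1 F -> cm_upto n (fun s => F s - F (s + 1)).
Proof.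
have D F' dF' s : (forall s, 0 < s -> is_derive s 1 F' (- dF' s)) ->
    (forall s, 0 < s -> 0 <= dF' s) -> 0 < s -> 0 <= F' s - F' (s + 1).
  move=> FdF dF0 s0; have cF : {within `[s, s + 1], continuous F'}.
    apply: continuous_in_subspaceT => z; rewrite inE/= in_itv/= => /andP[sz _].
    have [H _] := FdF z (lt_le_trans s0 sz).
    exact/differentiable_continuous/derivable1_diffP.
  have [||z] := @MVT_segment _ F' (fun z => - dF' z) s (s + 1) _ _ cF; first lra.
    by move=> z; rewrite in_itv/= => /andP[sz _]; apply: FdF; lra.
  rewrite in_itv/= => /andP[sz _] E.
  have := dF0 _ (lt_le_trans s0 sz); lra.
elim: n F => [|n IH] F [F0 [dF FdF cdF]]; split => //; try by move=> s s0; case: cdF => dF0 _; exact: D FdF dF0 s0.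
exists (fun s => dF s - dF (s + 1)); last exact: IH.
move=> s s0.
have H1 : is_derive s 1 (fun z : R => z + 1) 1.
  by rewrite -[X in is_derive _ _ _ X]addr0; apply: is_deriveD.
have s1 : 0 < s + 1 by lra.
have := @is_derive1_comp _ F (fun z => z + 1) s _ _ (FdF (s + 1) s1) H1.
rewrite mulr1 => H2; have := is_deriveB (FdF s s0) H2.
by congr is_derive; ring.
Qed.

Lemma cm_alt F : cm F -> alt F.
Proof.
move=> cF n; have := cF n; elim: n F {cF} => [|n IH] F cF; have [F0 _] := cF; split => //.
exact/IH/cm_upto_diff.
Qed.

Lemma lap_diff u s : lap_integrable u s ->
  lap u s - lap u (s + 1) = lap (fun t => (1 - expR (- t)) * u t) s.
Proof.
move=> Iu; rewrite -RintegralB//; last by apply: (lap_integrable_ge _ Iu); lra.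
by apply: eq_Rintegral => t _; rewrite opprD mulrDl expRD mulN1r; ring.
Qed.

Lemma lap_integrable_diff u s : lap_integrable u s ->
  lap_integrable (fun t => (1 - expR (- t)) * u t) s.
Proof.
apply: (@lap_integrable_mul _ _ _ 1).
  apply: measurable_funB => //; have := measurable_expM 1 (D := `[0, +oo[).
  by apply: eq_measurable_fun => t _; rewrite mulNr mul1r.
move=> t t0; have e1 : expR (- t) <= 1 by rewrite -[leRHS]expR0 ler_expR; lra.
by have e0 := expR_gt0 (- t); rewrite ger0_norm; lra.
Qed.

Lemma alt_lap u : (forall t, 0 <= t -> 0 <= u t) -> (forall s, 0 < s -> lap_integrable u s) ->
  alt (lap u).
Proof.
move=> + + n; elim: n u => [|n IH] u u0 Iu; split => //; try (move=> s s0; apply: Rintegral_ge0 => t;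
  rewrite /= in_itv/= andbT => t0; by rewrite mulr_ge0 ?expR_ge0 ?u0).
have : alt_upto n (lap (fun t => (1 - expR (- t)) * u t)).
  apply: IH => [t t0|s s0]; last exact/lap_integrable_diff/Iu.
  apply: mulr_ge0; last exact: u0.
  by rewrite subr_ge0 -[leRHS]expR0 ler_expR; lra.
by apply: alt_upto_ext => s s0; rewrite lap_diff//; exact: Iu.
Qed.

End Laplace.

(** * Positivity read off the Laplace transform *)

Section Bernstein.
Context {R : realType}.
Implicit Types (phi psi : nat -> R) (x y c M e : R).

(** Expectation of phi(k) for k binomial with parameters n and x. *)
Fixpoint bern n phi x : R := if n is m.+1 then
  x * bern m (fun k => phi k.+1) x + (1 - x) * bern m phi x else phi 0%N.

Lemma bern_ext n phi psi x : phi =1 psi -> bern n phi x = bern n psi x.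
Proof.
elim: n phi psi => [|n IH] phi psi pp /=; first exact: pp.
by congr (_ * _ + _ * _); apply: IH => // k; exact: pp.
Qed.

Lemma bern_lin n phi psi (a b : R) x :
  bern n (fun k => a * phi k + b * psi k) x = a * bern n phi x + b * bern n psi x.
Proof. by elim: n phi psi => [//|n IH] phi psi /=; rewrite !IH; ring. Qed.

Lemma bern_cst n (a : R) x : bern n (fun=> a) x = a.
Proof. by elim: n => [//|n IH] /=; rewrite IH; ring. Qed.

Lemma le_bern n phi psi x : 0 <= x <= 1 -> (forall k, phi k <= psi k) -> bern n phi x <= bern n psi x.
Proof.
move=> /andP[x0 x1]; elim: n phi psi => [|n IH] phi psi pp /=; first exact: pp.
by apply: lerD; apply: ler_wpM2l; rewrite ?subr_ge0// IH.
Qed.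

(** The mean n x and variance n x (1 - x) of the binomial distribution, at once. *)
Lemma bern_variance n c x :
  bern n (fun k => (k%:R - c) ^+ 2) x = n%:R * (x * (1 - x)) + (n%:R * x - c) ^+ 2.
Proof.
elim: n c => [|n IH] c /=; first by rewrite !mulr0n; ring.
rewrite (@bern_ext _ _ (fun k => (k%:R - (c - 1)) ^+ 2)); last first.
  by move=> k; rewrite -natr1; congr (_ ^+ 2); ring.
by rewrite !IH -natr1; ring.
Qed.

(** Chebyshev's argument: by the arithmetic-geometric mean inequality |y - x| is at
    most e / 2 plus a multiple of (y - x)^2, whose expectation is x (1 - x) / n. *)
Lemma bern_lipschitz_cvg (psi : R -> R) x : 0 <= x <= 1 ->
  (forall y z, `|psi y - psi z| <= `|y - z|) ->
  bern n (fun k => psi (k%:R / n%:R)) x @[n --> \oo] --> psi x.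
Proof.
move=> x01 lip; apply/cvgrPdist_le => e e0.
have nb : \forall n \near \oo, 2 / e ^+ 2 + 1 <= n%:R by exact: nbhs_infty_ger.
near=> n.
have ne : 2 / e ^+ 2 + 1 <= n%:R by near: n.
have e2 : 0 < e ^+ 2 by rewrite exprn_gt0.
have n0 : 0 < n%:R :> R by apply: lt_le_trans ne; rewrite ltr_wpDl// divr_ge0// ltW.
have -> : psi x - bern n (fun k => psi (k%:R / n%:R)) x =
    - bern n (fun k => psi (k%:R / n%:R) - psi x) x.
  rewrite [bern n (fun k => _ - _) x](@bern_ext _ _ (fun k => 1 * psi (k%:R / n%:R) + (-1) * psi x)); last by move=> k; ring.
  by rewrite bern_lin bern_cst; ring.
rewrite normrN.
pose h k : R := e / 2 + (2 / e / n%:R ^+ 2) * (k%:R - n%:R * x) ^+ 2.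
have hE k : `|psi (k%:R / n%:R) - psi x| <= h k.
  apply: le_trans (lip _ _) _; rewrite /h.
  have -> : k%:R / n%:R - x = (k%:R - n%:R * x) / n%:R by field; rewrite gt_eqF.
  have -> : 2 / e / n%:R ^+ 2 * (k%:R - n%:R * x) ^+ 2 = 2 / e * `|(k%:R - n%:R * x) / n%:R| ^+ 2.
    by rewrite real_normK ?num_real// expr_div_n; field; rewrite !gt_eqF.
  move: `|_| (normr_ge0 ((k%:R - n%:R * x) / n%:R)) => w w0.
  rewrite -subr_ge0; have -> : e / 2 + 2 / e * w ^+ 2 - w = 2 / e * ((w - e / 4) ^+ 2 + 3 * e ^+ 2 / 16).
    by field; rewrite gt_eqF.
  by rewrite mulr_ge0 ?divr_ge0 ?ltW// ltr_wpDl ?sqr_ge0//; lra.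
have hB : bern n h x <= e.
  rewrite (@bern_ext _ _ (fun k => 1 * (e / 2) + (2 / e / n%:R ^+ 2) * (k%:R - n%:R * x) ^+ 2)); last by move=> k; rewrite mul1r.
  rewrite bern_lin bern_cst bern_variance subrr expr0n addr0 mul1r.
  have -> : 2 / e / n%:R ^+ 2 * (n%:R * (x * (1 - x))) = 2 / e * (x * (1 - x)) / n%:R by field; rewrite !gt_eqF.
  have xx : x * (1 - x) <= 1 / 4.
    have E : 1 / 4 - x * (1 - x) = (x - 1 / 2) ^+ 2 by field.
    by rewrite -subr_ge0 E sqr_ge0.
  suff : 2 / e * (x * (1 - x)) / n%:R <= e / 2 by lra.
  rewrite ler_pdivrMr//.
  apply: (@le_trans _ _ (2 / e * (1 / 4))); first by rewrite ler_wpM2l// divr_ge0// ltW.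
  apply: (@le_trans _ _ (e / 2 * (2 / e ^+ 2 + 1))).
    have -> : e / 2 * (2 / e ^+ 2 + 1) = 1 / e + e / 2 by field; rewrite gt_eqF.
    have -> : 2 / e * (1 / 4) = 1 / 2 * (1 / e) by field; rewrite gt_eqF.
    have : 0 < 1 / e by rewrite divr_gt0.
    lra.
  by rewrite ler_wpM2l// divr_ge0// ltW.
rewrite ler_norml; apply/andP; split.
  rewrite lerNl; apply: le_trans hB.
  suff : -1 * bern n (fun k => psi (k%:R / n%:R) - psi x) x + 0 * bern n (fun=> 0) x <= bern n h x.
    by rewrite mulN1r mul0r addr0.
  rewrite -bern_lin; apply: le_bern => // k; rewrite mulN1r mul0r addr0.
  by apply: le_trans (hE k); rewrite -normrN; exact: ler_norm.
by apply: le_trans hB; apply: le_bern => // k; apply: le_trans (hE k); exact: ler_norm.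
Unshelve. all: end_near. Qed.

Lemma continuous_bern n phi : continuous (bern n phi).
Proof.
elim: n phi => [|n IH] phi x /=; first exact: cvg_cst.
apply: cvgD; apply: cvgM; try exact: IH; first exact: cvg_id.
by apply: cvgB; [exact: cvg_cst|exact: cvg_id].
Qed.

Lemma bern_bounded n phi x M : 0 <= x <= 1 -> (forall k, 0 <= phi k <= M) -> 0 <= bern n phi x <= M.
Proof.
move=> x01 pM.
have H1 := @le_bern n (fun=> 0) phi x x01; have H2 := @le_bern n phi (fun=> M) x x01.
by rewrite !bern_cst in H1 H2; rewrite H1 ?H2// => k; have /andP[] := pM k.
Qed.

End Bernstein.

Section LaplacePositivity.
Context {R : realType}.
Notation mu := (@lebesgue_measure R).
Implicit Types (u F b : R -> R) (s t x M : R).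

Lemma lapZ u s (a : R) : lap_integrable u s -> lap (fun t => a * u t) s = a * lap u s.
Proof. by move=> Iu; rewrite /lap -RintegralZl//; apply: eq_Rintegral => t _; rewrite mulrCA. Qed.

Lemma lapD u v s : lap_integrable u s -> lap_integrable v s ->
  lap (fun t => u t + v t) s = lap u s + lap v s.
Proof. by move=> Iu Iv; rewrite /lap -RintegralD//; apply: eq_Rintegral => t _; rewrite mulrDr. Qed.

Lemma lap_integrableD u v s : lap_integrable u s -> lap_integrable v s ->
  lap_integrable (fun t => u t + v t) s.
Proof.
move=> Iu Iv; have := integrableD _ Iu Iv; rewrite /lap_integrable => /(_ (measurable_itv _)).
by apply: eq_integrable => // t _ /=; rewrite mulrDr.
Qed.

Lemma lap_integrableZ u s (a : R) : lap_integrable u s -> lap_integrable (fun t => a * u t) s.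
Proof.
move=> Iu; have := integrableZl _ a Iu; rewrite /lap_integrable => /(_ (measurable_itv _)).
by apply: eq_integrable => // t _ /=; rewrite -EFinM mulrCA.
Qed.

Lemma eq_lap_integrable u v s : (forall t, 0 <= t -> u t = v t) -> lap_integrable u s -> lap_integrable v s.
Proof.
move=> uv; apply: eq_integrable => // t; rewrite inE/= in_itv/= andbT => t0.
by rewrite uv.
Qed.

Lemma eq_lap u v s : (forall t, 0 <= t -> u t = v t) -> lap u s = lap v s.
Proof.
move=> uv; apply: eq_Rintegral => t; rewrite inE/= in_itv/= andbT => t0.
by rewrite uv.
Qed.

Section Functional.
Variables (u F : R -> R) (s0 : R).
Hypotheses (Iu : lap_integrable u s0) (aF : alt F) (s00 : 0 < s0)
  (uF : forall s, s0 <= s -> lap u s = F s).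

Let e01 t : 0 <= t -> 0 <= expR (- t) <= 1.
Proof. by move=> t0; rewrite expR_ge0 -[leRHS]expR0 ler_expR; lra. Qed.

Lemma lap_integrable_poly b (M : R) : continuous b -> (forall x, 0 <= x <= 1 -> `|b x| <= M) ->
  lap_integrable (fun t => b (expR (- t)) * u t) s0.
Proof.
move=> cb bM; apply: (lap_integrable_mul (M := M)) => //.
  apply: measurable_funTS; apply: continuous_measurable_fun => t.
  apply: continuous_comp; last exact: cb.
  by apply: continuous_comp; [exact: opp_continuous|exact: continuous_expR].
by move=> t t0; apply: bM; exact: e01.
Qed.

Let monomial_pos k j : 0 <= lap (fun t => (expR (- t) ^+ k * (1 - expR (- t)) ^+ j) * u t) s0.
Proof.
have H : forall j (v G : R -> R) s, s0 <= s -> lap_integrable v s0 -> alt G -> (forall s, s0 <= s -> lap v s = G s) ->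
    0 <= lap (fun t => (1 - expR (- t)) ^+ j * v t) s.
  elim=> [|i IH] v G s ss Iv aG vG.
    under eq_lap do rewrite expr0 mul1r.
    by rewrite vG//; apply: (alt_upto_ge0 (aG 0%N)); exact: lt_le_trans ss.
  have := IH (fun t => (1 - expR (- t)) * v t) (fun s => G s - G (s + 1)) s ss.
  under eq_lap do rewrite mulrA -exprSr.
  apply => [||z zs].
  - exact: lap_integrable_diff.
  - by move=> n; have [_] := aG n.+1.
  - rewrite -lap_diff ?vG//; first by lra.
    exact: lap_integrable_ge zs Iv.
have k0 : s0 <= s0 + k%:R by rewrite lerDl.
have := H j u F (s0 + k%:R) k0 Iu aF uF.
move=> /le_trans; apply; rewrite le_eqVlt; apply/orP; left; apply/eqP.
apply: eq_Rintegral => t _; rewrite -!mulrA mulrA; congr (_ * _).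
by rewrite -expRM_natl -expRD; congr expR; ring.
Qed.

(** The recursion that defines the Bernstein polynomial splits it into the monomials
    x^k (1 - x)^j at x = e^(-t), whose integrals against u are shifted alternating
    differences of F. *)
Lemma lap_bern_pos n (phi : nat -> R) (M : R) : (forall k, 0 <= phi k <= M) ->
  0 <= lap (fun t => bern n phi (expR (- t)) * u t) s0.
Proof.
move=> pM.
have cE k j : continuous (fun x : R => x ^+ k * (1 - x) ^+ j).
  move=> x; apply: cvgM; first exact: exprn_continuous.
  apply: (@continuous_comp _ _ _ (fun x => 1 - x) (fun x => x ^+ j)); last exact: exprn_continuous.
  by apply: cvgB; [exact: cvg_cst|exact: cvg_id].
have bE k j x : 0 <= x <= 1 -> 0 <= x ^+ k * (1 - x) ^+ j <= 1.
  move=> /andP[x0 x1]; rewrite mulr_ge0 ?exprn_ge0 ?subr_ge0//=.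
  by rewrite mulr_ile1 ?exprn_ge0 ?exprn_ile1 ?subr_ge0//; lra.
have I psi n' k j : (forall k, 0 <= psi k <= M) ->
    lap_integrable (fun t => (expR (- t) ^+ k * (1 - expR (- t)) ^+ j * bern n' psi (expR (- t))) * u t) s0.
  move=> pM'; apply: (@lap_integrable_poly (fun x => x ^+ k * (1 - x) ^+ j * bern n' psi x) M).
    by move=> x; apply: cvgM; [exact: cE|exact: continuous_bern].
  move=> x x01; have /andP[a1 a2] := bE k j x x01; have /andP[b1 b2] := bern_bounded n' x01 pM'.
  by rewrite normrM !ger0_norm// -[leRHS]mul1r ler_pM.
suff : forall k j, 0 <= lap (fun t => (expR (- t) ^+ k * (1 - expR (- t)) ^+ j * bern n phi (expR (- t))) * u t) s0.
  by move=> /(_ 0 0)%N; under eq_lap do rewrite !expr0 !mul1r.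
elim: n phi pM => [|n IH] phi pM k j /=.
  have -> : lap (fun t => expR (- t) ^+ k * (1 - expR (- t)) ^+ j * phi 0%N * u t) s0 =
     phi 0%N * lap (fun t => expR (- t) ^+ k * (1 - expR (- t)) ^+ j * u t) s0.
    rewrite -lapZ; last first.
      apply: (@lap_integrable_poly (fun x => x ^+ k * (1 - x) ^+ j) 1) => // x x01.
      by have /andP[? ?] := bE k j x x01; rewrite ger0_norm.
    by apply: eq_lap => t _; ring.
  by apply: mulr_ge0; [have /andP[] := pM 0%N|exact: monomial_pos].
have pS i : 0 <= phi i.+1 <= M by exact: pM.
rewrite (@eq_lap _ (fun t =>
  (expR (- t) ^+ k.+1 * (1 - expR (- t)) ^+ j * bern n (fun i => phi i.+1) (expR (- t))) * u t +
  (expR (- t) ^+ k * (1 - expR (- t)) ^+ j.+1 * bern n phi (expR (- t))) * u t)); last first.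
  by move=> t _; rewrite !exprS; ring.
rewrite lapD; [|exact: I|exact: I].
by rewrite addr_ge0 ?IH.
Qed.

Lemma lap_lipschitz_pos (psi : R -> R) (M : R) : (forall x, 0 <= psi x <= M) ->
  (forall y z, `|psi y - psi z| <= `|y - z|) ->
  0 <= lap (fun t => psi (expR (- t)) * u t) s0.
Proof.
move=> pM lip.
have := @Rintegral_dominated_cvg _ _ _ mu (`[0, +oo[) 
  (fun n t => expR (- s0 * t) * (bern n (fun k => psi (k%:R / n%:R)) (expR (- t)) * u t))
  (fun t => expR (- s0 * t) * (psi (expR (- t)) * u t))
  (fun t => M * `|expR (- s0 * t) * u t|).
case=> //.
- move=> n; apply: integrable_measurable.
  apply: (@lap_integrable_poly (bern n (fun k => psi (k%:R / n%:R))) M); first exact: continuous_bern.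
  by move=> x x01; have /andP[a b] := bern_bounded n x01 (fun k => pM (k%:R / n%:R)); rewrite ger0_norm.
- move=> t; rewrite /= in_itv/= andbT => t0.
  apply: cvgM; first exact: cvg_cst.
  apply: cvgM; last exact: cvg_cst.
  apply: bern_lipschitz_cvg => //; exact: e01.
- by apply: integrable_scale => //; exact: integrable_norm Iu.
- move=> n t; rewrite /= in_itv/= andbT => t0.
  have /andP[a b] := bern_bounded n (e01 t0) (fun k => pM (k%:R / n%:R)).
  rewrite mulrCA normrM ler_wpM2r// ger0_norm//.
move=> _; apply: cvg_ge0; apply: nearW => n.
exact: (@lap_bern_pos n (fun k => psi (k%:R / n%:R)) M).
Qed.

(** Integrals of u against Lipschitz functions of e^(-t) are nonnegative, as limits
    over Bernstein polynomials. If u t were negative, right continuity would make u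
    negative on [t, t + e[, and a tent supported there would give a contradiction. *)
Lemma alt_lap_ge0 t : 0 < t -> u x @[x --> t^'+] --> u t -> 0 <= u t.
Proof.
move=> t0 rc; rewrite leNgt; apply/negP => ut.
have [e e0 He] : exists2 e : R, 0 < e & forall z, t <= z < t + e -> u z <= u t / 2.
  have /(cvgr_lt (u t)) : u x @[x --> t^'+] --> u t by [].
  move=> /(_ (u t / 2)); have -> : (u t < u t / 2) by lra.
  move=> /(_ isT) [e /= e0 He]; exists e => // z /andP[tz ze].
  have [->|tz'] := eqVneq z t; first by lra.
  apply/ltW/He; last by rewrite lt_neqAle eq_sym tz'.
  by rewrite /= ltr0_norm; lra.
pose a := expR (- (t + e)); pose b := expR (- t).
have ab : a < b by rewrite ltr_expR; lra.
have a0 : 0 < a by exact: expR_gt0.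
pose c := (a + b) / 2; pose r := (b - a) / 2.
have r0 : 0 < r by rewrite /r; lra.
pose psi x := Num.max 0 (r - `|x - c|).
have psiM x : 0 <= psi x <= r.
  by rewrite le_max lexx/= ge_max ltW//= gerBl.
have psiL y z : `|psi y - psi z| <= `|y - z|.
  have H1 : `|y - c| <= `|y - z| + `|z - c| by apply: le_trans (ler_normD _ _); rewrite addrA subrK.
  have H2 : `|z - c| <= `|y - z| + `|y - c| by rewrite (distrC y z); apply: le_trans (ler_normD _ _); rewrite addrA subrK.
  rewrite /psi ler_norml; apply/andP; split; rewrite /Num.max; do 2 case: ifPn; rewrite -?leNgt; lra.
have Hp := lap_lipschitz_pos psiM psiL.
pose h z := - (expR (- s0 * z) * (psi (expR (- z)) * u z)).
have psi0 z : 0 <= z -> ~~ (t <= z < t + e) -> psi (expR (- z)) = 0.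
  move=> z0 nz; rewrite /psi; apply/max_idPl; rewrite subr_le0.
  have [zt|tz] := ltP z t.
    have : b <= expR (- z) by rewrite ler_expR; lra.
    move=> bz; rewrite ger0_norm /r /c; lra.
  rewrite tz/= -leNgt in nz.
  have : expR (- z) <= a by rewrite ler_expR; lra.
  move=> az; rewrite ler0_norm /r /c; lra.
have h0 z : 0 <= z -> 0 <= h z.
  move=> z0; rewrite /h oppr_ge0 mulr_ge0_le0 ?expR_ge0//.
  have [/He uz|/psi0 ->] := boolP (t <= z < t + e) => //; last by rewrite mul0r.
  by rewrite mulr_ge0_le0//; [have /andP[] := psiM (expR (- z))|lra].
have Ih : lap_integrable (fun z => psi (expR (- z)) * u z) s0.
  apply: (@lap_integrable_poly psi r); last by move=> x _; have /andP[p1 p2] := psiM x; rewrite ger0_norm.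
  move=> x; apply/cvgrPdist_le => eps eps0.
  have /cvgrPdist_le/(_ _ eps0) : y @[y --> x] --> x by exact: cvg_id.
  by apply: filterS => y; exact: le_trans (psiL _ _).
pose p := - ln (c + r / 2); pose q := - ln (c - r / 2).
have cp : 0 < c - r / 2 by rewrite /c /r; lra.
have pq : p < q by rewrite ltrN2 ltr_ln ?posrE; lra.
have tp : t < p.
  by rewrite /p -[t]opprK ltrN2 -[ltRHS](expRK (- t)) ltr_ln ?posrE ?expR_gt0// -/b /c /r; lra.
pose k := expR (- s0 * q) * (r / 2 * - (u t / 2)).
have k0 : 0 < k by rewrite mulr_gt0 ?expR_gt0// mulr_gt0; lra.
have hk z : p <= z <= q -> k <= h z.
  move=> /andP[pz zq].
  have z1 : expR (- z) <= c + r / 2.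
    by rewrite -[leRHS]lnK ?posrE ?ler_expR; [rewrite /p in pz; lra|lra].
  have z2 : c - r / 2 <= expR (- z).
    by rewrite -[leLHS]lnK ?posrE ?ler_expR; [rewrite /q in zq; lra|lra].
  have pz2 : r / 2 <= psi (expR (- z)).
    rewrite le_max; apply/orP; right.
    suff : `|expR (- z) - c| <= r / 2 by lra.
    by rewrite ler_norml; apply/andP; split; lra.
  have /He uz : t <= z < t + e.
    by apply/negPn/negP => /psi0 H; rewrite H in pz2; lra.
  rewrite /h -mulrN -mulrN; apply: ler_pM; rewrite ?expR_ge0//.
  - by apply: mulr_ge0; lra.
  - by rewrite ler_expR !mulNr lerN2 ler_wpM2l// ltW.
  - by apply: ler_pM; lra.
have Ih' : mu.-integrable `[0, +oo[ (EFin \o h).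
  have := lap_integrableZ (-1) Ih.
  by apply: eq_integrable => // z _ /=; congr EFin; rewrite /h; ring.
have H : k * (q - p) <= \int[mu]_(z in `[0, +oo[) h z.
  by apply: Rintegral_lower_bound; rewrite ?(ltW k0) ?(ltW pq)//; lra.
have E : \int[mu]_(z in `[0, +oo[) h z = - lap (fun z => psi (expR (- z)) * u z) s0.
  by rewrite /lap -mulN1r -RintegralZl//; apply: eq_Rintegral => z _; rewrite mulN1r.
have : 0 < k * (q - p) by rewrite mulr_gt0// subr_gt0.
by move: H Hp; rewrite E; lra.
Qed.

End Functional.
End LaplacePositivity.

(** * Convolutions *)

Section MeasurePreserving.
Context {R : realType}.
Notation mu := (@lebesgue_measure R).
Notation T := (measurableTypeR R).
Variable phi : T -> T.
Hypotheses (mphi : measurable_fun setT phi)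
  (phimu : forall A : set T, measurable A -> pushforward mu phi A = mu A).

Lemma ge0_integral_preserving (f : R -> \bar R) : measurable_fun setT f -> (forall t, (0 <= f t)%E) ->
  (\int[mu]_t f (phi t) = \int[mu]_t f t)%E.
Proof.
move=> mf f0.
transitivity (\int[pushforward mu phi]_t f t)%E; first by rewrite ge0_integral_pushforward.
by apply: eq_measure_integral => A mA _; exact: phimu.
Qed.

Lemma integral_preserving (f : R -> R) : mu.-integrable setT (EFin \o f) ->
  (\int[mu]_t (f (phi t))%:E = \int[mu]_t (f t)%:E)%E.
Proof.
move=> If; have mf := measurable_int mu If.
rewrite integralE [RHS]integralE; congr (_ - _)%E.
  have E := ge0_integral_preserving (measurable_funepos mf) (fun t => funepos_ge0 _ t).
  by rewrite -[RHS]E; apply: eq_integral => t _; rewrite !(funeposE, funenegE).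
have E := ge0_integral_preserving (measurable_funeneg mf) (fun t => funeneg_ge0 _ t).
by rewrite -[RHS]E; apply: eq_integral => t _; rewrite !(funeposE, funenegE).
Qed.

Lemma integrable_preserving (f : R -> R) : mu.-integrable setT (EFin \o f) ->
  mu.-integrable setT (EFin \o (fun t => f (phi t))).
Proof.
move=> If; have mf := integrable_measurable If; apply/integrableP; split.
  by apply/measurable_EFinP; apply: measurableT_comp mf mphi.
have /integrableP[_] := If.
rewrite -ge0_integral_preserving//.
by apply: measurableT_comp => //; apply/measurable_EFinP.
Qed.

End MeasurePreserving.

Section Translation.
Context {R : realType}.
Notation mu := (@lebesgue_measure R).
Implicit Types (f : R -> R) (a : R).

Let shift a : measurableTypeR R -> measurableTypeR R := fun t => t + a.

Lemma measurable_shift a : measurable_fun setT (fun t : R => t + a).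
Proof.
apply: continuous_measurable_fun => t.
by apply: cvgD; [exact: cvg_id|exact: cvg_cst].
Qed.

Lemma lebesgue_measure_shift a (A : set R) : measurable A ->
  pushforward mu (shift a) A = mu A.
Proof.
move=> mA; apply/esym/lebesgue_measure_unique => //=; first exact: measurable_shift.
move=> _ _ [[x y]] _ <-.
rewrite /pushforward.
have -> : shift a @^-1` `]x, y]%classic = `](x - a), (y - a)]%classic.
  by apply/seteqP; split => t /=; rewrite !in_itv/= /shift ltrBlDr lerBrDr.
rewrite !lebesgue_measure_itv/= !lte_fin ltrD2r; case: ifP => // _.
by rewrite -!EFinB; congr EFin; ring.
Qed.

Lemma ge0_integral_shift (f : R -> \bar R) a : measurable_fun setT f -> (forall t, (0 <= f t)%E) ->
  (\int[mu]_t f (t + a)%R = \int[mu]_t f t)%E.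
Proof. exact: (ge0_integral_preserving (measurable_shift a) (@lebesgue_measure_shift a)). Qed.

Lemma integral_shift f a : mu.-integrable setT (EFin \o f) ->
  (\int[mu]_t (f (t + a))%:E = \int[mu]_t (f t)%:E)%E.
Proof. exact: (integral_preserving (measurable_shift a) (@lebesgue_measure_shift a)). Qed.

Lemma integrable_shift f a : mu.-integrable setT (EFin \o f) ->
  mu.-integrable setT (EFin \o (fun t => f (t + a))).
Proof. exact: (integrable_preserving (measurable_shift a) (@lebesgue_measure_shift a)). Qed.

End Translation.

Section Convolution.
Context {R : realType}.
Notation mu := (@lebesgue_measure R).
Implicit Types (p q u : R -> R) (s t : R).

Definition conv p q t := \int[mu]_(tau in `[0, t]) (p (t - tau) * q tau).

Lemma measurable_fun_parameter d (Y : measurableType d) (f : Y * measurableTypeR R -> \bar R) :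
  measurable_fun setT f -> measurable_fun setT (fun y => \int[mu]_tau f (y, tau))%E.
Proof.
move=> mf.
have -> : (fun y => \int[mu]_tau f (y, tau))%E =
    (fun y => (\int[mu]_tau (f^\+ (y, tau))) - (\int[mu]_tau (f^\- (y, tau))))%E.
  apply/funext => y; rewrite integralE; congr (_ - _)%E; apply: eq_integral => tau _;
  by rewrite !(funeposE, funenegE).
apply: emeasurable_funB.
  by apply: (measurable_fun_fubini_tonelli_F (m2 := mu)) => //; exact: measurable_funepos.
by apply: (measurable_fun_fubini_tonelli_F (m2 := mu)) => //; exact: measurable_funeneg.
Qed.

Lemma measurable_conv p q : measurable_fun (`[0, +oo[ : set R) p ->
  measurable_fun (`[0, +oo[ : set R) q -> measurable_fun (`[0, +oo[ : set R) (conv p q).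
Proof.
move=> mp mq.
pose h (z : measurableTypeR R * measurableTypeR R) : \bar R :=
  ((p \_ `[0, +oo[) (z.1 - z.2) * (q \_ `[0, +oo[) z.2)%:E.
have mh : measurable_fun setT h.
  apply/measurable_EFinP; apply: measurable_funM.
    apply: measurableT_comp => //; last exact: measurable_funB.
    exact: (measurable_restrictT p _).1.
  by apply: measurableT_comp => //; exact: (measurable_restrictT q _).1.
apply: (@eq_measurable_fun _ _ _ _ _ (fun t => fine (\int[mu]_tau h (t, tau))%E)).
  move=> t; rewrite inE/= in_itv/= andbT => t0; rewrite /conv /Rintegral; congr fine.
  rewrite [RHS]integral_mkcond; apply: eq_integral => tau _.
  rewrite /h/= /patch !mem_setE !in_itv/= !andbT subr_ge0.
  by case: ifP => h1; case: ifP => h2 //=; rewrite ?mulr0 ?mul0r.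
apply: measurable_funTS; apply: measurableT_comp => //.
exact: measurable_fun_parameter.
Qed.

Let ext p s t : R := if 0 <= t then expR (- s * t) * p t else 0.

Let extE p s : ext p s = (fun t => expR (- s * t) * p t) \_ `[0, +oo[.
Proof.
apply/funext => t; rewrite /patch /ext mem_setE in_itv/= andbT; by case: ifP.
Qed.

Let ext_integrable p s : lap_integrable p s -> mu.-integrable setT (EFin \o ext p s).
Proof.
move=> Ip; by rewrite extE -restrict_EFin; apply: (iffLR (integrable_mkcond _ _)).
Qed.

Let integral_ext p s : (\int[mu]_t (ext p s t)%:E = \int[mu]_(t in `[0%R, +oo[) (expR (- s * t) * p t)%:E)%E.
Proof.
rewrite [RHS]integral_mkcond; apply: eq_integral => t _.
by rewrite extE /patch; case: ifP.
Qed.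

Section Conv.
Variables (p q : R -> R) (s : R).
Hypotheses (Ip : lap_integrable p s) (Iq : lap_integrable q s).

Notation T := (measurableTypeR R).
Let f (z : T * T) : \bar R := (ext p s (z.1 - z.2) * ext q s z.2)%:E.

Let mp := integrable_measurable (ext_integrable Ip).
Let mq := integrable_measurable (ext_integrable Iq).

Let mf : measurable_fun setT f.
Proof.
apply/measurable_EFinP; apply: measurable_funM.
  apply: measurableT_comp => //; exact: measurable_funB.
exact: measurableT_comp.
Qed.

Let If : (mu \x mu)%E.-integrable setT f.
Proof.
apply/(@integrable21ltyP _ _ T T R mu mu f mf).
have E y : (\int[mu]_x `|f (x, y)| = `|ext q s y|%:E * \int[mu]_x `|ext p s x|%:E)%E.
  rewrite -ge0_integralZl//; last by apply/measurable_EFinP; exact: measurableT_comp.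
  rewrite -[RHS](ge0_integral_shift (- y)) => //.
  - by apply: eq_integral => x _; rewrite /f/= normrM mulrC EFinM.
  - by apply/measurable_EFinP; apply: measurable_funM => //; exact: measurableT_comp.
under eq_integral do rewrite E.
have Jp : (\int[mu]_x `|ext p s x|%:E < +oo)%E.
  by have /integrableP[_] := ext_integrable Ip.
have Jq : (\int[mu]_x `|ext q s x|%:E < +oo)%E.
  by have /integrableP[_] := ext_integrable Iq.
rewrite ge0_integralZr//; last 2 first.
- by apply/measurable_EFinP; exact: measurableT_comp.
- exact: integral_ge0.
rewrite lte_mul_pinfty//; first exact: integral_ge0.
by rewrite ge0_fin_numE//; exact: integral_ge0.
Qed.

Let inner (t : R) : (\int[mu]_tau f (t : T, tau : T) =
  (if (0 <= t)%R then \int[mu]_(tau in `[0%R, t]) (expR (- s * t) * (p (t - tau) * q tau))%:E else 0))%E.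
Proof.
case: ifPn => t0; last first.
  rewrite integral0_eq// => tau _; rewrite /f /ext/= subr_ge0.
  case: ifP; rewrite ?mul0r// => tt; case: ifP; rewrite ?mulr0// => tau0.
  by rewrite (le_trans tau0 tt) in t0.
rewrite [RHS]integral_mkcond; apply: eq_integral => tau _.
rewrite /f /ext/= /patch mem_setE in_itv/= subr_ge0.
case: ifP => h1; case: ifP => h2 //=; rewrite ?mulr0 ?mul0r//.
by rewrite mulrACA -expRD; congr (expR _ * _)%:E; ring.
Qed.

Let extS y : mu.-integrable setT (EFin \o (fun x => ext p s (x - y))).
Proof. exact: integrable_shift (ext_integrable Ip). Qed.

(** Fubini's theorem on the plane, after extension by zero to the negative half-line. *)
Lemma lap_conv : lap_integrable (conv p q) s /\ lap (conv p q) s = lap p s * lap q s.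
Proof.
have E1 := Fubini If.
have E2 y : (\int[mu]_x f (x, y) = (ext q s y)%:E * (lap p s)%:E)%E.
  rewrite /f/=; under eq_integral do rewrite mulrC EFinM.
  rewrite (integralZl _ (extS y))//; congr (_ * _)%E.
  rewrite (integral_shift (- y) (ext_integrable Ip)) integral_ext /lap /Rintegral fineK//.
  exact: integrable_fin_num.
have E3 : (\int[mu]_y \int[mu]_x f (x, y) = (lap p s * lap q s)%:E)%E.
  under eq_integral do rewrite E2.
  rewrite (integralZr measurableT (ext_integrable Iq)).
  rewrite integral_ext /lap [in RHS]mulrC EFinM; congr (_ * _)%E; rewrite /Rintegral fineK//.
  exact: integrable_fin_num.
have IF := integrable_fubini_F If.
have E4 : ae_eq mu setT (fubini_F mu f) (fun t => (ext (conv p q) s t)%:E).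
  have := ae_integrable1 If; apply: filterS => t It _.
  rewrite /fubini_F inner /ext; case: ifPn => // t0.
  have Itt : mu.-integrable `[0, t] (EFin \o (fun tau => expR (- s * t) * (p (t - tau) * q tau))).
    have Itt : mu.-integrable (`[0, t]%classic : set T) (fun y : T => f (t, y)) by apply: integrableS It.
    apply: eq_integrable Itt => // tau; rewrite inE/= in_itv/= => /andP[h1 h2].
    by rewrite /f /ext/= subr_ge0 h2 h1 mulrACA -expRD; congr (expR _ * _)%:E; ring.
  have Itt' : mu.-integrable `[0, t] (EFin \o (fun tau => p (t - tau) * q tau)).
    have [//|] := (@integrable_scale _ _ _ mu `[0, t] (expR (s * t)) _ _ Itt, I).
    move=> J _; apply: eq_integrable J => // tau _ /=.
    by rewrite mulrA -expRD mulNr addrN expR0 mul1r.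
  by rewrite /conv -[in RHS]RintegralZl// /Rintegral fineK//; exact: integrable_fin_num.
have mconv : measurable_fun setT (fun t => (ext (conv p q) s t)%:E).
  rewrite extE; apply/measurable_EFinP/(measurable_restrictT _ _).1 => //.
  apply: measurable_funM; first exact: measurable_expM.
  exact: measurable_conv (lap_integrable_measurable Ip) (lap_integrable_measurable Iq).
have Iext : mu.-integrable setT (fun t => (ext (conv p q) s t)%:E).
  apply/integrableP; split => //.
  have /integrableP[_] := IF.
  have -> // : (\int[mu]_t `|(ext (conv p q) s t)%:E| = \int[mu]_t `|fubini_F mu f t|)%E.
  apply: ae_eq_integral; first exact: measurableT.
  - exact: measurableT_comp.
  - by apply: measurableT_comp => //; exact: measurable_int IF.
  - by apply: filterS E4 => t + _ => ->.
have I1 : lap_integrable (conv p q) s.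
  rewrite /lap_integrable; apply: (iffRL (integrable_mkcond _ _)) => //.
  by rewrite restrict_EFin -extE.
split => //.
apply: EFin_inj; rewrite -E3 -E1 /lap /Rintegral fineK; last exact: integrable_fin_num.
rewrite -integral_ext; apply/esym/ae_eq_integral => //.
  exact: measurable_int IF.
Qed.

End Conv.
End Convolution.

(** * Powers and fractional integrals *)

Section Gamma.
Context {R : realType}.
Notation mu := (@lebesgue_measure R).
Implicit Types (f g u : R -> R) (s t a b M : R).

Let scale a : measurableTypeR R -> measurableTypeR R := fun t => a * t.

Lemma ge0_integral_scale (f : R -> \bar R) a : 0 < a -> measurable_fun setT f -> (forall t, (0 <= f t)%E) ->
  (a%:E * \int[mu]_t f (a * t)%R = \int[mu]_t f t)%E.
Proof.
move=> a0 mf f0.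
have ms : measurable_fun setT (scale a) by exact: mulrl_measurable.
pose an := NngNum (ltW a0).
transitivity (a%:E * \int[pushforward mu (scale a)]_t f t)%E.
  by rewrite ge0_integral_pushforward.
pose pm := measure_function_pushforward__canonical__measure_function_Measure mu ms.
transitivity (\int[mscale an pm]_t f t)%E.
  by rewrite ge0_integral_mscale.
apply: eq_measure_integral => A mA _; apply/esym/lebesgue_measure_unique => //.
move=> _ [[x y]] _ <-.
have E : scale a @^-1` `]x, y]%classic = `](a^-1 * x), (a^-1 * y)]%classic.
  by apply/seteqP; split => t /=; rewrite !in_itv/= /scale ltr_pdivrMl// ler_pdivlMl.
rewrite [RHS](_ : _ = a%:E * mu (scale a @^-1` `]x, y]%classic))%E; last by [].
rewrite E !lebesgue_measure_itv/= !lte_fin ltr_pM2l ?invr_gt0//; case: ifP => // _; last by rewrite mule0.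
by rewrite -!EFinB -EFinM; congr EFin; rewrite -mulrBr mulrA divff ?mul1r// gt_eqF.
Qed.

Lemma exponential_pdf_patch s : EFin \o exponential_pdf s =
  (EFin \o (fun t : R => s * expR (- s * t))) \_ `[0, +oo[.
Proof. by rewrite restrict_EFin. Qed.

Lemma lap_integrable_cst a s : 0 < s -> lap_integrable (fun=> a) s.
Proof.
move=> s0; have := integrable_exponential_pdf s0.
rewrite exponential_pdf_patch => H0.
have H : mu.-integrable `[0, +oo[ (EFin \o (fun t : R => s * expR (- s * t))).
  by apply: (iffRL (integrable_mkcond _ _)) => //.
have := integrable_scale (a / s) _ H => /(_ (measurable_itv _)); apply: eq_integrable => //.
by move=> t _ /=; congr EFin; field; rewrite gt_eqF.
Qed.

Lemma lap_cst a s : 0 < s -> lap (fun=> a) s = a / s.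
Proof.
move=> s0; have := integral_exponential_pdf s0.
have := exponential_pdf_patch s; rewrite funeqE => E.
under eq_integral do rewrite [(_)%:E]E; rewrite -integral_mkcond => H.
have -> : lap (fun=> a) s = (a / s) * \int[mu]_(t in `[0, +oo[) (s * expR (- s * t)).
  rewrite -RintegralZl//.
    by apply: eq_Rintegral => t _; field; rewrite gt_eqF.
  by have := lap_integrable_cst s s0; apply: eq_integrable => // t _ /=; rewrite mulrC.
by rewrite /Rintegral H mulr1.
Qed.

Lemma measurable_powR_shift (b : R) (D : set R) : measurable_fun D (fun t => t `^ b).
Proof. by apply: measurable_funTS; exact: measurable_powR. Qed.

Lemma powR_le_quadratic b t : 1 <= b <= 3 -> 0 <= t -> t `^ (b - 1) <= 1 + t ^+ 2.
Proof.
move=> /andP[b1 b3] t0; have [t1|t1] := leP t 1.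
  apply: (@le_trans _ _ 1); last by rewrite lerDl exprn_ge0.
  rewrite [leRHS](_ : 1 = 1 `^ (b - 1)); last by rewrite powR1.
  apply: ge0_ler_powR; rewrite ?nnegrE//; lra.
apply: (@le_trans _ _ (t ^+ 2)); last by rewrite lerDr.
by rewrite -powR_mulrn// ler_powR//; lra.
Qed.

Lemma lap_integrable_quadratic s : 0 < s -> lap_integrable (fun t => 1 + t ^+ 2) s.
Proof.
move=> s0; have s20 : 0 < s / 2 by rewrite divr_gt0.
have Hc : mu.-integrable `[0, +oo[ (EFin \o (fun t => (1 + 8 / s ^+ 2) * (expR (- (s / 2) * t) * 1))).
  by apply: integrable_scale => //; exact: lap_integrable_cst.
apply: dominated_integrable Hc => //.
  apply: measurable_funM; first exact: measurable_expM.
  by apply: measurable_funD => //; exact: measurable_funX.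
move=> t; rewrite /= in_itv/= andbT => t0.
rewrite ger0_norm ?mulr_ge0 ?expR_ge0 ?addr_ge0 ?exprn_ge0//.
have -> : expR (- s * t) = expR (- (s / 2) * t) * expR (- (s / 2) * t).
  by rewrite -expRD; congr expR; field.
rewrite mulr1 -mulrA [_ * expR _ in leRHS]mulrC; apply: ler_wpM2l; first exact: expR_ge0.
have e1 : expR (- (s / 2) * t) <= 1.
  by rewrite -[leRHS]expR0 ler_expR mulNr oppr_le0 mulr_ge0// ltW.
have e2 : expR (- (s / 2) * t) * t ^+ 2 <= 8 / s ^+ 2.
  rewrite mulNr expRN mulrC ler_pdivrMr ?expR_gt0//.
  have st : 0 <= s / 2 * t by rewrite mulr_ge0// ltW.
  have := expR_ge1Dxn 1 st; rewrite (_ : 2%N`! = 2%N)// => He.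
  rewrite -ler_pdivrMl; last by rewrite divr_gt0// exprn_gt0.
  apply: le_trans He; have -> : (8 / s ^+ 2)^-1 * t ^+ 2 = (s / 2 * t) ^+ 2 / 2 by field; rewrite gt_eqF.
  by rewrite lerDr.
by rewrite mulrDr mulr1; apply: lerD.
Qed.

Lemma lap_integrable_powR b s : 1 <= b <= 3 -> 0 < s -> lap_integrable (fun t => t `^ (b - 1)) s.
Proof.
move=> b13 s0; apply: dominated_integrable (lap_integrable_quadratic s0) => //.
  by apply: measurable_funM; [exact: measurable_expM|exact: measurable_powR_shift].
move=> t; rewrite /= in_itv/= andbT => t0.
rewrite ger0_norm ?mulr_ge0 ?expR_ge0 ?powR_ge0// ler_wpM2l ?expR_ge0//.
exact: powR_le_quadratic.
Qed.

Lemma Gamma_lap b : 1 <= b <= 3 -> Gamma b = lap (fun t => t `^ (b - 1)) 1.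
Proof.
move=> b13; have I := lap_integrable_powR b13 ltr01.
rewrite /Gamma Rintegral_itv_obnd_cbnd; last first.
  have J : mu.-integrable `[0, +oo[ (EFin \o (fun x : R => x `^ (b - 1) * expR (- x))).
    by apply: eq_integrable I => // t _ /=; rewrite mulN1r mulrC.
  by apply: integrableS J => // t; rewrite /= !in_itv/= !andbT => /ltW.
by apply: eq_Rintegral => t _; rewrite mulN1r mulrC.
Qed.

Lemma Gamma_gt0 b : 1 <= b <= 3 -> 0 < Gamma b.
Proof.
move=> b13; rewrite Gamma_lap//.
apply: (@lt_le_trans _ _ (expR (- 2) * (2 - 1))); first by rewrite mulr_gt0 ?expR_gt0//; lra.
apply: Rintegral_lower_bound; rewrite ?expR_ge0//; try lra.
- exact: lap_integrable_powR.
- by move=> t _; rewrite mulr_ge0 ?expR_ge0 ?powR_ge0.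
move=> t /andP[t1 t2]; rewrite -[leLHS]mulr1; apply: ler_pM; rewrite ?expR_ge0//.
  by rewrite ler_expR; lra.
by rewrite -[leLHS](powRr0 t); apply: ler_powR => //; lra.
Qed.

(** The substitution of s t for t reduces the transform to the Gamma integral. *)
Lemma lap_powR b s : 1 <= b <= 3 -> 0 < s -> lap (fun t => t `^ (b - 1)) s = Gamma b * s `^ (- b).
Proof.
move=> b13 s0; rewrite Gamma_lap// /lap.
pose h (t : R) := ((fun t => expR (- 1 * t) * t `^ (b - 1)) \_ `[0, +oo[) t.
have mh : measurable_fun setT (EFin \o h).
  apply/measurable_EFinP/(measurable_restrictT _ _).1 => //.
  by apply: measurable_funM; [exact: measurable_expM|exact: measurable_powR_shift].
have h0 t : 0 <= h t.
  by rewrite /h /patch; case: ifP => // _; rewrite mulr_ge0 ?expR_ge0 ?powR_ge0.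
have := ge0_integral_scale s0 mh (fun t => h0 t).
have -> : (\int[mu]_t (EFin \o h) (s * t)%R = (s `^ (b - 1))%:E * (lap (fun t => t `^ (b - 1)) s)%:E)%E.
  rewrite /lap /Rintegral fineK; last by apply: integrable_fin_num => //; exact: lap_integrable_powR.
  rewrite -integralZl//; last exact: lap_integrable_powR.
  rewrite [RHS]integral_mkcond; apply: eq_integral => t _.
  rewrite /h/= /patch !mem_setE !in_itv/= !andbT pmulr_rge0//; case: ifP => // t0.
  by rewrite mulN1r mulNr powRM ?(ltW s0)// -EFinM mulrCA.
have -> : (\int[mu]_t (EFin \o h) t = (lap (fun t => t `^ (b - 1)) 1)%:E)%E.
  rewrite /lap /Rintegral fineK; last by apply: integrable_fin_num => //; exact: lap_integrable_powR.
  rewrite [RHS]integral_mkcond; apply: eq_integral => t _.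
  by rewrite /h/= /patch; case: ifP.
rewrite -!EFinM => -[]; rewrite -!/(lap _ _) => <-.
have sb : s * s `^ (b - 1) = s `^ b.
  by rewrite -{1}(powRr1 (ltW s0)) -powRD ?(gt_eqF s0) ?implybT//; congr (_ `^ _); ring.
by rewrite mulrA sb mulrAC powRN divff ?mul1r// gt_eqF// powR_gt0.
Qed.

Lemma lap_frac_integral b f s : 1 <= b <= 3 -> 0 < s -> lap_integrable f s ->
  lap_integrable (frac_integral b f) s /\ lap (frac_integral b f) s = s `^ (- b) * lap f s.
Proof.
move=> b13 s0 If; have [Ic Lc] := lap_conv (lap_integrable_powR b13 s0) If.
split; first exact: (lap_integrableZ (Gamma b)^-1 Ic).
rewrite (lapZ (Gamma b)^-1 Ic) Lc lap_powR// !mulrA mulVf ?mul1r//.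
exact/lt0r_neq0/Gamma_gt0.
Qed.

(** Uniformity in f lets the fractional integrals of all the functions w x share one
    dominating function. *)
Lemma frac_integral_bound b f M a t : 1 <= b <= 3 -> 0 <= a -> 0 <= t ->
  measurable_fun (`[0, +oo[ : set R) f -> (forall x, 0 <= x -> `|f x| <= M * expR (a * x)) ->
  `|frac_integral b f t| <= (Gamma b)^-1 * M * ((t + t ^+ 3) * expR (a * t)).
Proof.
move=> b13 a0 t0 mf fM.
have M0 : 0 <= M by have := fM 0 (lexx _); rewrite mulr0 expR0 mulr1; apply: le_trans.
have G0 := Gamma_gt0 b13.
rewrite /frac_integral normrM (gtr0_norm (_ : 0 < (Gamma b)^-1)) ?invr_gt0// -mulrA ler_pM2l ?invr_gt0//.
pose B := (1 + t ^+ 2) * (M * expR (a * t)).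
have pB x : 0 <= x <= t -> `|(t - x) `^ (b - 1) * f x| <= B.
  move=> /andP[x0 xt]; rewrite normrM ger0_norm ?powR_ge0//; apply: ler_pM; rewrite ?powR_ge0//.
    apply: (le_trans (powR_le_quadratic b13 _)); first lra.
    by rewrite lerD2l lerXn2r ?nnegrE; lra.
  by apply: (le_trans (fM x x0)); rewrite ler_wpM2l// ler_expR ler_wpM2l.
have IB : mu.-integrable `[0, t] (EFin \o (fun=> B)).
  apply: measurable_bounded_integrable => //.
    by rewrite /= lebesgue_measure_itv/=; case: ifP => // _; rewrite ltry.
  by exists `|B|; split; [rewrite realE normr_ge0|move=> y /ltW By x _ /=].
have If : mu.-integrable `[0, t] (EFin \o (fun x => (t - x) `^ (b - 1) * f x)).
  apply: dominated_integrable IB => //.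
  apply: measurable_funM; last by apply: measurable_funS mf => // x; rewrite /= !in_itv/= andbT => /andP[].
  apply: (@measurableT_comp _ _ _ _ _ _ (fun x => x `^ (b - 1))); first exact: measurable_powR.
  exact: measurable_funB.
apply: (le_trans (le_normr_Rintegral _ If)) => //.
apply: (le_trans (le_Rintegral _ (integrable_norm If) IB _)) => //.
rewrite Rintegral_cst//= lebesgue_measure_itv/= lte_fin.
have -> : fine (if (0 < t)%R then (t%:E - 0%:E)%E else 0%E) = t.
  by case: ifPn => [|/=]; [rewrite sube0|lra].
by rewrite le_eqVlt; apply/orP; left; apply/eqP; rewrite /B; ring.
Qed.

End Gamma.

(** * Equations and transforms on the half-line *)

Section HalfLine.
Context {R : realType}.
Implicit Types (f df : R -> R) (x y M : R).

Lemma MVT_pos f df x y : 0 < x -> x < y -> (forall z : R, 0 < z -> is_derive z 1 f (df z)) ->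
  exists2 z, x < z < y & f y - f x = df z * (y - x).
Proof.
move=> x0 xy fdf; have [z||z zxy E] := @MVT _ f df x y xy.
- by rewrite in_itv/= => /andP[xz _]; apply: fdf; exact: lt_trans xz.
- apply: continuous_in_subspaceT => z; rewrite inE/= in_itv/= => /andP[xz _].
  apply/differentiable_continuous/derivable1_diffP.
  by have [] := fdf z (lt_le_trans x0 xz).
- by exists z => //; move: zxy; rewrite in_itv.
Qed.

Lemma derive0_pos_cst f x y : (forall z : R, 0 < z -> is_derive z 1 f 0) -> 0 < x -> 0 < y -> f x = f y.
Proof.
move=> f0; wlog xy : x y / x <= y.
  by move=> H x0 y0; have [/H->|/ltW/H->] := leP x y.
move=> x0 y0; move: xy; rewrite le_eqVlt => /predU1P[->//|xy].
have [z _] := MVT_pos x0 xy f0; rewrite mul0r; lra.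
Qed.

Lemma is_derive_quotient_cvg f x (d : R) : is_derive x 1 f d ->
  (n.+1%:R * (f (x + n.+1%:R^-1) - f x)) @[n --> \oo] --> d.
Proof.
move=> [fx <-].
have H : h^-1 *: (f (h *: 1 + x) - f x) @[h --> 0^'] --> 'D_1 f x by exact: fx.
have /cvgr_dnbhsP/(_ (fun n => n.+1%:R^-1)) := H.
move=> /(_ _); have C : (forall n : nat, n.+1%:R^-1 != 0 :> R) /\ (n.+1%:R^-1 : R) @[n --> \oo] --> 0.
  split; first by move=> n; rewrite invr_eq0 pnatr_eq0.
  exact: cvg_harmonic.
move=> /(_ C); apply: cvg_trans; apply: near_eq_cvg; apply: nearW => n.
by rewrite invrK /GRing.scale/= mulr1 [_ + x]addrC.
Qed.

(** The slope of the chord over a unit interval is at most 2 A, and differs from the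
    derivative by at most B. *)
Lemma derivative_bound f df ddf A B x : 0 < x ->
  (forall z : R, 0 < z -> is_derive z 1 f (df z)) ->
  (forall z : R, 0 < z -> is_derive z 1 df (ddf z)) ->
  (forall z : R, 0 < z -> `|f z| <= A) -> (forall z : R, 0 < z -> `|ddf z| <= B) ->
  `|df x| <= 2 * A + B.
Proof.
move=> x0 fdf dfddf fA fB.
have x1 : x < x + 1 by rewrite ltrDl.
have [z /andP[xz zx] E1] := MVT_pos x0 x1 fdf.
have [y /andP[xy yz] E2] := MVT_pos x0 xz dfddf.
have z0 : 0 < z := lt_trans x0 xz.
have H1 := fA x x0; have H2 := fA (x + 1) (lt_trans x0 x1).
have H3 := fB y (lt_trans x0 xy).
have E1' : df z = f (x + 1) - f x by rewrite E1; ring.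
have -> : df x = f (x + 1) - f x - ddf y * (z - x) by rewrite -E1' -E2; ring.
apply: (le_trans (ler_normB _ _)); apply: lerD.
  by apply: (le_trans (ler_normB _ _)); lra.
rewrite normrM -[leRHS]mulr1; apply: ler_pM => //.
by rewrite ger0_norm; lra.
Qed.

Lemma is_derive_expRM (a z : R) : is_derive z 1 (fun z : R => expR (z * a)) (a * expR (z * a)).
Proof.
have H : is_derive z 1 (fun z : R => z * a) a.
  by have := @is_deriveM _ _ id (fun=> a) z 1 1 0 (is_derive_id _ _) (is_derive_cst _ _ _); rewrite /GRing.scale/= mulr0 mulr1 add0r.
have := @is_derive1_comp _ expR (fun z => z * a) z _ _ (is_derive_expR _) H.
by rewrite mulrC.
Qed.

(** u'' = l^2 u on the half line: the growing exponential is excluded by boundedness. *)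
Lemma bounded_ode2 f df (l K : R) : 0 < l ->
  (forall z : R, 0 < z -> is_derive z 1 f (df z)) ->
  (forall z : R, 0 < z -> is_derive z 1 df (l ^+ 2 * f z)) ->
  (forall z : R, 0 < z -> `|f z| <= K) -> (forall z : R, 0 < z -> `|df z| <= K) ->
  exists C, forall x, 0 < x -> f x = C * expR (- (x * l)).
Proof.
move=> l0 fdf dfddf fK dK.
pose u z := df z + l * f z.
have du (z : R) : 0 < z -> is_derive z 1 u (l * u z).
  move=> z0; have := is_deriveD (dfddf z z0) (is_deriveZ l (fdf z z0)).
  by congr is_derive; rewrite /GRing.scale/= /u; ring.
have d1 (z : R) : 0 < z -> is_derive z 1 (fun z => expR (z * - l) * u z) 0.
  move=> z0; have := is_deriveM (is_derive_expRM (- l) z) (du z z0).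
  by congr is_derive; rewrite /GRing.scale/=; ring.
have u0 (z : R) : 0 < z -> u z = 0.
  move=> z0; apply/eqP/negPn/negP => nz.
  have K0 : 0 <= K by apply: le_trans (fK z z0).
  have uK (y : R) : 0 < y -> `|u y| <= K + l * K.
    move=> y0; apply: (le_trans (ler_normD _ _)); rewrite lerD ?dK//.
    by rewrite normrM gtr0_norm// ler_pM2l// fK.
  pose y := z + (K + l * K) / (l * `|u z|).
  have uz0 : 0 < `|u z| by rewrite normr_gt0.
  have y0 : 0 < y by rewrite /y ltr_wpDr// mulr_ge0 ?addr_ge0 ?invr_ge0 ?mulr_ge0// ltW.
  have E : u y = expR ((y - z) * l) * u z.
    have := derive0_pos_cst d1 y0 z0 => E.
    have -> : u y = expR (y * l) * (expR (y * - l) * u y).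
      by rewrite mulrA -expRD mulrN addrN expR0 mul1r.
    by rewrite E mulrA -expRD; congr (expR _ * _); ring.
  have := uK y y0; rewrite E normrM ger0_norm ?expR_ge0// => H.
  have : 1 + (y - z) * l <= expR ((y - z) * l) by exact: expR_ge1Dx.
  have -> : (y - z) * l = (K + l * K) / `|u z|.
    by rewrite /y; field; rewrite !gt_eqF.
  rewrite -(ler_pM2r uz0) mulrDl mul1r divfK ?gt_eqF// => H2.
  move: H; have -> : (y - z) * l = (K + l * K) / `|u z|.
    by rewrite /y; field; rewrite !gt_eqF.
  by move: H2 uz0; lra.
have d2 (z : R) : 0 < z -> is_derive z 1 (fun z => expR (z * l) * f z) 0.
  move=> z0; have := is_deriveM (is_derive_expRM l z) (fdf z z0).
  congr is_derive; rewrite /GRing.scale/=.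
  have -> : df z = - (l * f z) by have := u0 z z0; rewrite /u; lra.
  by ring.
exists (expR (1 * l) * f 1) => x x0.
rewrite (derive0_pos_cst d2 ltr01 x0) mulrAC -expRD.
by rewrite (_ : _ + _ = 0) ?expR0 ?mul1r//; ring.
Qed.

End HalfLine.

Section LaplaceParameter.
Context {R : realType}.
Notation mu := (@lebesgue_measure R).
Implicit Types (u v G : R -> R) (s t x y : R).

Lemma lap_dominated u G s : measurable_fun (`[0, +oo[ : set R) u ->
  (forall t, 0 <= t -> `|u t| <= G t) -> lap_integrable G s -> lap_integrable u s.
Proof.
move=> mu_ uG IG; apply: dominated_integrable IG => //.
  by apply: measurable_funM => //; exact: measurable_expM.
move=> t; rewrite /= in_itv/= andbT => t0.
by rewrite normrM ger0_norm ?expR_ge0// ler_wpM2l ?expR_ge0// uG.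
Qed.

Lemma bounded_lap_integrable u (B : R) s : 0 < s -> measurable_fun (`[0, +oo[ : set R) u ->
  (forall t, 0 <= t -> `|u t| <= B) -> lap_integrable u s.
Proof. by move=> s0 mu_ uB; apply: lap_dominated (lap_integrable_cst B s0). Qed.

Lemma lap_truncation u (n : R) s : 0 <= n ->
  \int[mu]_(t in `[0, n]) (expR (- s * t) * u t) = lap (fun t => if t <= n then u t else 0) s.
Proof.
move=> n0; rewrite /lap /Rintegral integral_mkcond [in RHS]integral_mkcond; congr fine.
apply: eq_integral => t _; rewrite /patch !mem_setE !in_itv/= andbT.
by case: (0 <= t) => //=; case: ifP => //; rewrite mulr0.
Qed.

Lemma lap_singleton (a c : R) s : 0 <= a -> 0 < s ->
  lap_integrable (fun t => if t == a then c else 0) s /\ lap (fun t => if t == a then c else 0) s = 0.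
Proof.
move=> a0 s0; pose u t : R := if t == a then c else 0.
have uE : u = (fun=> c) \_ [set a].
  apply/funext => t; rewrite /u /patch; case: eqP => [->|ta]; first by rewrite mem_set.
  by rewrite memNset.
split.
  apply: (bounded_lap_integrable (B := `|c|) s0) => //; last by move=> t _; case: ifP; rewrite ?normr0.
  by rewrite -/u uE; apply: measurable_funTS; exact: (measurable_restrictT _ _).1.
rewrite /lap -[RHS](@Rintegral_set1 _ (fun t => expR (- s * t) * c) a) /Rintegral.
have -> : [set a] = `[0, +oo[ `&` [set a].
  by apply/seteqP; split => [t /= ->|t []//]; rewrite in_itv/= a0.
rewrite integral_mkcondr; congr fine; apply: eq_integral => t _.
rewrite -/(u t) uE /patch; by case: ifP => // _; rewrite mulr0.
Qed.

Lemma lap_ext_off (a : R) s u v : 0 <= a -> 0 < s -> lap_integrable u s ->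
  (forall t : R, 0 <= t -> t != a -> u t = v t) -> lap_integrable v s /\ lap u s = lap v s.
Proof.
move=> a0 s0 Iu uv; have [I1 L1] := lap_singleton (v a - u a) a0 s0.
have E t : 0 <= t -> u t + (if t == a then v a - u a else 0) = v t.
  by move=> t0; case: eqP => [->|/eqP ta]; [rewrite addrC subrK|rewrite addr0 uv].
split; first exact: eq_lap_integrable E (lap_integrableD Iu I1).
by rewrite -(eq_lap _ E) (lapD Iu I1) L1 addr0.
Qed.

Lemma lap_norm_le u G s : lap_integrable u s ->
  (forall t, 0 <= t -> `|u t| <= G t) -> lap_integrable G s -> `|lap u s| <= lap G s.
Proof.
move=> Iu uG IG; apply: (le_trans (le_normr_Rintegral _ Iu)) => //.
have H : forall t, `[0, +oo[%classic t -> `|expR (- s * t) * u t| <= expR (- s * t) * G t; last first.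
  exact: (le_Rintegral _ (integrable_norm Iu) IG H).
move=> t; rewrite /= in_itv/= andbT => t0.
by rewrite normrM ger0_norm ?expR_ge0// ler_wpM2l ?expR_ge0// uG.
Qed.

Lemma lap_dominated_cvg (u_ : nat -> R -> R) u G s :
  (forall n, measurable_fun (`[0, +oo[ : set R) (u_ n)) ->
  (forall t, 0 <= t -> u_ n t @[n --> \oo] --> u t) ->
  lap_integrable G s -> (forall n t, 0 <= t -> `|u_ n t| <= G t) ->
  lap_integrable u s /\ lap (u_ n) s @[n --> \oo] --> lap u s.
Proof.
move=> mu_ cu IG uG; apply: (@Rintegral_dominated_cvg _ _ _ mu _ _ _ (fun t => expR (- s * t) * G t)) => //.
- by move=> n; exact: measurable_funM (measurable_expM _) (mu_ n).
- move=> t; rewrite /= in_itv/= andbT => t0; apply: cvgM; [exact: cvg_cst|exact: cu].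
- move=> n t; rewrite /= in_itv/= andbT => t0.
  by rewrite normrM ger0_norm ?expR_ge0// ler_wpM2l ?expR_ge0// uG.
Qed.

Lemma lap_derive (f df : R -> R -> R) G s :
  (forall y t, 0 < y -> 0 <= t -> is_derive y 1 (f^~ t) (df y t)) ->
  (forall y, 0 < y -> lap_integrable (f y) s) ->
  lap_integrable G s -> (forall y t, 0 < y -> 0 <= t -> `|df y t| <= G t) ->
  forall x, 0 < x -> lap_integrable (df x) s /\ is_derive x 1 (fun y => lap (f y) s) (lap (df x) s).
Proof.
move=> fdf If IG dG x x0.
have mdf : measurable_fun (`[0, +oo[ : set R) (df x).
  apply: (@measurable_fun_cvg _ _ _ _ (fun n t => n.+1%:R * (f (x + n.+1%:R^-1) t - f x t))).
    move=> n; apply: measurable_funM => //; apply: measurable_funB.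
      by apply: lap_integrable_measurable (If _ _); rewrite addr_gt0.
    exact: lap_integrable_measurable (If _ _).
  move=> t; rewrite /= in_itv/= andbT => t0.
  exact: is_derive_quotient_cvg (fdf x t x0 t0).
have Idf : lap_integrable (df x) s by apply: lap_dominated IG => // t t0; exact: dG.
split => //.
pose h y t := expR (- s * t) * f y t.
have dh y t : 0 < y -> 0 <= t -> is_derive y 1 (h^~ t) (expR (- s * t) * df y t).
  move=> y0 t0; exact: is_deriveZ (fdf y t y0 t0).
have p1 y t : 0 < y -> 0 <= t -> partial1of2 h y t = expR (- s * t) * df y t.
  by move=> y0 t0; rewrite partial1of2E; have /@derive_val := dh y t y0 t0.
have Ix : `]0, (x + 1)[%classic x by rewrite /= in_itv/= x0 ltrDl/=.
have H1 : forall y : R, `]0, (x + 1)[%classic y -> mu.-integrable `[0, +oo[ (EFin \o h y).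
  by move=> y; rewrite /= in_itv/= => /andP[y0 _]; exact: If.
have H2 : forall y t : R, `]0, (x + 1)[%classic y -> `[0, +oo[%classic t -> derivable (h^~ t) y 1.
  move=> y t; rewrite /= !in_itv/= andbT => /andP[y0 _] t0.
  by have [] := dh y t y0 t0.
have H3 : forall t, 0 <= `|expR (- s * t) * G t| by [].
have H4 : forall y t : R, `]0, (x + 1)[%classic y -> `[0, +oo[%classic t ->
    `|partial1of2 h y t| <= `|expR (- s * t) * G t|.
  move=> y t; rewrite /= !in_itv/= andbT => /andP[y0 _] t0.
  rewrite p1// !normrM ler_wpM2l//; exact: le_trans (dG _ _ y0 t0) (ler_norm _).
have mI : measurable (`[0, +oo[%classic : set R) by [].
have D1 : derivable (fun y => \int[mu]_(t in `[0, +oo[) h y t) x 1.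
  by apply: (@derivable_under_integral _ _ _ mu h `[0, +oo[ mI x 0 (x + 1) Ix _ _ _ H3 (integrable_norm IG) _).
apply: DeriveDef; first exact: D1.
rewrite -derive1E (@differentiation_under_integral _ _ _ mu h `[0, +oo[ mI x 0 (x + 1) Ix _ _ _ H3 (integrable_norm IG))//.
by apply: eq_Rintegral => t; rewrite inE/= in_itv/= andbT => t0; rewrite p1.
Qed.

Lemma lap_integrable_expR (a s : R) : a < s -> lap_integrable (fun t => expR (a * t)) s.
Proof.
move=> as0; have : lap_integrable (fun=> 1) (s - a) by apply: lap_integrable_cst; rewrite subr_gt0.
by apply: eq_integrable => // t _ /=; rewrite mulr1 -expRD; congr (expR _)%:E; ring.
Qed.

Lemma lap_integrable_cubic (a s : R) : a < s ->
  lap_integrable (fun t => (t + t ^+ 3) * expR (a * t)) s.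
Proof.
move=> as0; pose d := (s - a) / 6.
have d0 : 0 < d by rewrite divr_gt0// subr_gt0.
have I : lap_integrable (fun t => (d^-1 + d ^- 3) * expR (((a + s) / 2) * t)) s.
  by apply: lap_integrableZ; apply: lap_integrable_expR; lra.
apply: lap_dominated I.
  apply: measurable_funM; last first.
    by apply: measurable_funTS; apply: continuous_measurable_fun => t;
      apply: continuous_comp; [exact: mulrl_continuous|exact: continuous_expR].
  by apply: measurable_funD => //; exact: measurable_funX.
move=> t t0; have e3 : expR (((a + s) / 2) * t) = expR (d * t) ^+ 3 * expR (a * t).
  by rewrite -expRM_natl -expRD; congr expR; rewrite /d; field.
have tE : t <= d^-1 * expR (d * t).
  rewrite -ler_pdivrMl ?invr_gt0// invrK; apply: le_trans (expR_ge1Dx _); lra.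
have E1 : 1 <= expR (d * t) by rewrite -[leLHS]expR0 ler_expR mulr_ge0// ltW.
rewrite ger0_norm; last by rewrite mulr_ge0 ?expR_ge0// addr_ge0// exprn_ge0.
rewrite e3 mulrA ler_wpM2r ?expR_ge0// mulrDl; apply: lerD.
  apply: (le_trans tE); rewrite ler_wpM2l ?invr_ge0 ?(ltW d0)//.
  by rewrite -[leLHS]expr1; apply: ler_weXn2l.
rewrite -exprVn -exprMn; apply: lerXn2r => //; rewrite nnegrE//.
by apply: mulr_ge0; [rewrite invr_ge0 ltW|exact: expR_ge0].
Qed.

End LaplaceParameter.

(** * The transform of the propagation function *)

Section PropagationTransform.
Context {R : realType} (m : nat) (c : R) (cs al : 'I_m -> R).
Hypothesis hal : forall j : 'I_m, 1 <= al j < 2.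
Hypothesis hc : 0 < c.
Hypothesis hcs : forall j : 'I_m, 0 < cs j.
Variable w : R -> R -> R.
Hypothesis hw : propagation_function c cs al w.
Notation mu := (@lebesgue_measure R).
Implicit Types (x t s : R).
Local Notation g := (charfun c cs al).
Local Notation lam := (symbol_sqrt c cs al).

Definition propagation_bound (M a : R) := [/\ 0 <= M, 0 <= a &
  forall x t, 0 < x -> 0 <= t -> `|w x t| <= M * expR (a * t)].

Lemma propagation_bounded : exists M a, propagation_bound M a.
Proof.
have [[_ [M [a Mw]] _] _ w0 _ _] := hw.
exists `|M|, `|a|; split => // x t x0.
rewrite le_eqVlt => /predU1P[<-|t0].
  by have [-> _] := w0 x x0; rewrite normr0 mulr_ge0 ?expR_ge0.
apply: (le_trans (Mw x t x0 t0)); apply: (@le_trans _ _ (`|M| * expR (a * t))).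
  by rewrite ler_wpM2r ?expR_ge0 ?ler_norm.
apply: ler_wpM2l => //.
by rewrite ler_expR ler_wpM2r ?(ltW t0)// ler_norm.
Qed.

Lemma propagation_measurable x : 0 < x -> measurable_fun (`[0, +oo[ : set R) (w x).
Proof.
move=> x0; have [[mw _ _] _ _ _ _] := hw.
by apply/measurable_fun_itv_obnd_cbndP; exact: mw.
Qed.

Variables (M a : R).
Hypothesis Ma : propagation_bound M a.

Lemma propagation_lap_integrable x s : 0 < x -> a < s -> lap_integrable (w x) s.
Proof.
move=> x0 as0; have [M0 a0 H] := Ma.
apply: (lap_dominated (propagation_measurable x0) (fun t => H x t x0)).
exact/lap_integrableZ/lap_integrable_expR.
Qed.

Let P t := (t + t ^+ 3) * expR (a * t).

Let P0 t : 0 <= t -> 0 <= P t.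
Proof. by move=> t0; rewrite mulr_ge0 ?expR_ge0// addr_ge0// exprn_ge0. Qed.

Lemma frac_integral0 b (f : R -> R) : frac_integral b f 0 = 0.
Proof. by rewrite /frac_integral set_itv1 Rintegral_set1 mulr0. Qed.

Let fracP b x t : 1 <= b <= 3 -> 0 < x -> 0 <= t -> `|frac_integral b (w x) t| <= (Gamma b)^-1 * M * P t.
Proof.
move=> b13 x0 t0; have [M0 a0 H] := Ma.
exact: (frac_integral_bound b13 a0 t0 (propagation_measurable x0) (fun y => H x y x0)).
Qed.

Let v x t := frac_integral 3 (w x) t.
Let vx x t := derive1 (fun y => v y t) x.
Let vxx x t := c * frac_integral 1 (w x) t + \sum_(j < m) cs j * frac_integral (3 - al j) (w x) t.

Let dv x t : 0 < x -> 0 <= t -> is_derive x 1 (v^~ t) (vx x t).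
Proof.
move=> x0; rewrite le_eqVlt => /predU1P[<-|t0].
  have E : v^~ 0 = (fun=> 0) by apply/funext => y; exact: frac_integral0.
  by rewrite /vx E derive1_cst; exact: is_derive_cst.
have [_ hd _ _ _] := hw; have [D _] := hd x t x0 t0.
by apply: DeriveDef; [exact: D|rewrite /vx derive1E].
Qed.

Let dvx x t : 0 < x -> 0 <= t -> is_derive x 1 (vx^~ t) (vxx x t).
Proof.
move=> x0; rewrite le_eqVlt => /predU1P[<-|t0].
  have E : vx^~ 0 = (fun=> 0).
    apply/funext => y; rewrite /vx.
    have -> : v^~ 0 = (fun=> 0) by apply/funext => z; exact: frac_integral0.
    exact: derive1_cst.
  have -> : vxx x 0 = 0.
    by rewrite /vxx frac_integral0 mulr0 add0r big1// => j _; rewrite frac_integral0 mulr0.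
  by rewrite E; exact: is_derive_cst.
by have [_ hd _ _ _] := hw; have [_] := hd x t x0 t0.
Qed.

Let b13 j : 1 <= 3 - al j <= 3. Proof. by have := hal j; lra. Qed.

Let K2 := c * ((Gamma 1)^-1 * M) + \sum_(j < m) cs j * ((Gamma (3 - al j))^-1 * M).

Let vxxP x t : 0 < x -> 0 <= t -> `|vxx x t| <= K2 * P t.
Proof.
move=> x0 t0; rewrite /vxx /K2 mulrDl; apply: (le_trans (ler_normD _ _)); apply: lerD.
  rewrite normrM (gtr0_norm hc) -mulrA ler_pM2l// fracP//; lra.
rewrite mulr_suml; apply: (le_trans (ler_norm_sum _ _ _)); apply: ler_sum => j _.
by rewrite normrM (gtr0_norm (hcs j)) -mulrA ler_pM2l ?hcs// fracP.
Qed.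

Let K0 := (Gamma 3)^-1 * M.
Let vP x t : 0 < x -> 0 <= t -> `|v x t| <= K0 * P t.
Proof. by move=> x0 t0; apply: fracP => //; lra. Qed.

Let vxP x t : 0 < x -> 0 <= t -> `|vx x t| <= (2 * K0 + K2) * P t.
Proof.
move=> x0 t0; rewrite mulrDl -mulrA.
exact: (derivative_bound x0 (fun z z0 => dv z0 t0) (fun z z0 => dvx z0 t0)
  (fun z z0 => vP z0 t0) (fun z z0 => vxxP z0 t0)).
Qed.

Section AtPoint.
Variable s : R.
Hypotheses (as0 : a < s).
Let s0 : 0 < s. Proof. by have [_ a0 _] := Ma; exact: le_lt_trans as0. Qed.

Let IP : lap_integrable P s. Proof. exact: lap_integrable_cubic. Qed.

Let Iv x : 0 < x -> lap_integrable (v x) s.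
Proof.
move=> x0; by have [|I _] := lap_frac_integral (b := 3) _ s0 (propagation_lap_integrable x0 as0); first lra.
Qed.

Let lapv x : 0 < x -> lap (v x) s = s `^ (- 3) * lap (w x) s.
Proof.
move=> x0; by have [|_] := lap_frac_integral (b := 3) _ s0 (propagation_lap_integrable x0 as0); first lra.
Qed.

Let Dv x : 0 < x -> lap_integrable (vx x) s /\ is_derive x 1 (fun y => lap (v y) s) (lap (vx x) s).
Proof.
apply: (lap_derive _ Iv (lap_integrableZ (2 * K0 + K2) IP)) => y t y0 t0; [exact: dv|exact: vxP].
Qed.

Let Dvx x : 0 < x -> lap_integrable (vxx x) s /\ is_derive x 1 (fun y => lap (vx y) s) (lap (vxx x) s).
Proof.
apply: (lap_derive _ _ (lap_integrableZ K2 IP)) => [y t y0 t0|y y0|y t y0 t0]; [exact: dvx|by have [] := Dv y0|exact: vxxP].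
Qed.

Let lapvxx x : 0 < x -> lap (vxx x) s = g s * lap (v x) s.
Proof.
move=> x0; have Iw := propagation_lap_integrable x0 as0.
have [|I1 L1] := lap_frac_integral (b := 1) _ s0 Iw; first lra.
have [I2 L2] : lap_integrable (fun t => \sum_(j < m) cs j * frac_integral (3 - al j) (w x) t) s /\
    lap (fun t => \sum_(j < m) cs j * frac_integral (3 - al j) (w x) t) s =
    \sum_(j < m) cs j * (s `^ (- (3 - al j)) * lap (w x) s).
  elim: (index_enum _) => [|i r [I L]].
    split; first by apply: eq_lap_integrable (lap_integrable_cst 0 s0) => t _; rewrite big_nil.
    rewrite big_nil (@eq_lap _ _ (fun=> 0)); last by move=> t _; rewrite big_nil.
    by rewrite lap_cst// mul0r.
  have [I3 L3] := lap_frac_integral (b13 i) s0 Iw.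
  split; first by apply: eq_lap_integrable (lap_integrableD (lap_integrableZ (cs i) I3) I) => t _; rewrite big_cons.
  rewrite big_cons -L -L3 -(lapZ (cs i) I3) -lapD//; last exact: lap_integrableZ.
  by apply: eq_lap => t _; rewrite big_cons.
rewrite /vxx lapD//; last exact: lap_integrableZ.
rewrite (lapZ _ I1) L1 L2 lapv// /charfun mulrDl; congr (_ + _).
  rewrite mulrA -[c * _ * _]mulrA [in RHS]mulrA -[in RHS](mulrA c) -powR_mulrn ?(ltW s0)//.
  by rewrite -powRD ?(gt_eqF s0) ?implybT// -mulrA; congr (_ * (_ `^ _ * _)); ring.
rewrite mulr_suml; apply: eq_bigr => j _.
rewrite mulrA [in RHS]mulrA -[in RHS](mulrA (cs j)) -powRD ?(gt_eqF s0) ?implybT// -mulrA mulrA.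
by congr (_ * _ `^ _ * _); ring.
Qed.

Let vbounded : exists K, forall x, 0 < x -> `|lap (v x) s| <= K /\ `|lap (vx x) s| <= K.
Proof.
exists (Num.max (lap (fun t => K0 * P t) s) (lap (fun t => (2 * K0 + K2) * P t) s)) => x x0.
split; rewrite le_max; apply/orP; [left|right].
- by apply: lap_norm_le; [exact: Iv|by move=> t t0; exact: vP|exact: lap_integrableZ].
- by apply: lap_norm_le; [by have [] := Dv x0|by move=> t t0; exact: vxP|exact: lap_integrableZ].
Qed.

Let lap_w_exp : exists C, forall x, 0 < x -> lap (w x) s = C * expR (- (x * lam s)).
Proof.
have [K HK] := vbounded.
have [||||C HC] := bounded_ode2 (K := K) (symbol_sqrt_gt0 al hc hcs s0) (f := fun x => lap (v x) s) (df := fun x => lap (vx x) s).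
- by move=> z /Dv[].
- by move=> z z0; have [_] := Dvx z0; rewrite lapvxx// symbol_sqrtK.
- by move=> z /HK[].
- by move=> z /HK[].
exists (s ^+ 3 * C) => x x0; rewrite -mulrA -HC// lapv// mulrA powRN -powR_mulrn ?(ltW s0)//.
by rewrite divff ?mul1r// gt_eqF// powR_gt0.
Qed.

(** The triple time integral v of w satisfies v_xx = g v after transformation, and is
    bounded in x; hence it is a multiple of e^(- x sqrt g), and the multiple is read
    off at x = 0. *)
Lemma propagation_transform_pos x : 0 < x -> lap (w x) s = expR (- (x * lam s)) / s.
Proof.
have [C HC] := lap_w_exp; have [M0 a0 H] := Ma.
have [_ _ w0 w1 _] := hw.
suff E : C = s^-1 by move=> x0; rewrite HC// E mulrC.
have xn (n : nat) : 0 < n.+1%:R^-1 :> R by [].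
pose u (t : R) : R := if t == 0 then 0 else 1.
have [Iu L] : lap_integrable u s /\ lap (w n.+1%:R^-1) s @[n --> \oo] --> lap u s.
  apply: (@lap_dominated_cvg _ _ _ (fun t => M * expR (a * t))) => [n|||n t t0].
  - by apply: propagation_measurable; exact: xn.
  - move=> t; rewrite le_eqVlt => /predU1P[<-|t0].
      by under eq_fun do rewrite (w0 _ (xn _)).1; rewrite /u eqxx; exact: cvg_cst.
    have [E H1] := w1 t t0; rewrite /u gt_eqF//; rewrite E in H1.
    have /cvg_at_rightP := H1; apply; split => //; exact: cvg_harmonic.
  - by apply: lap_integrableZ; exact: lap_integrable_expR.
  - exact: (H _ _ (xn n) t0).
have Lu : lap u s = s^-1.
  rewrite -[RHS]mul1r -(lap_cst 1 s0); apply: (lap_ext_off (lexx 0) s0 Iu _).2 => t _ t0.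
  by rewrite /u (negbTE t0).
have L2 : C * expR (- (n.+1%:R^-1 * lam s)) @[n --> \oo] --> C * expR (- (0 * lam s)).
  apply: cvgM; first exact: cvg_cst.
  apply: continuous_cvg; first exact: continuous_expR.
  apply: cvgN; apply: cvgM; [exact: cvg_harmonic|exact: cvg_cst].
rewrite mul0r oppr0 expR0 mulr1 in L2.
rewrite -Lu; apply/esym/(cvg_unique _ L) => //=.
by under eq_fun do rewrite HC ?xn//.
Qed.

End AtPoint.
End PropagationTransform.

(** * Monotonicity and support of the propagation function *)

Section Delay.
Context {R : realType}.
Notation mu := (@lebesgue_measure R).
Implicit Types (u : R -> R) (s t h a b x : R).

Definition delay h u t : R := if h <= t then u (t - h) else 0.

Lemma lap_delay h u s : 0 <= h -> lap_integrable u s ->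
  lap_integrable (delay h u) s /\ lap (delay h u) s = expR (- s * h) * lap u s.
Proof.
move=> h0 Iu.
pose f := (fun t => expR (- s * t) * u t) \_ `[0, +oo[.
have If : mu.-integrable setT (EFin \o f).
  by rewrite /f -restrict_EFin; apply: (iffLR (integrable_mkcond _ _)).
have Ifh : mu.-integrable setT (EFin \o (fun t => f (t + - h))) by exact: integrable_shift.
have E t : expR (- s * h) * f (t + - h) = ((fun t => expR (- s * t) * delay h u t) \_ `[0, +oo[) t.
  rewrite /f /patch !mem_setE !in_itv/= !andbT subr_ge0 /delay.
  case: ifPn => ht; case: ifPn => t0; rewrite ?mulr0//.
    by rewrite mulrA -expRD; congr (expR _ * _); ring.
  by rewrite (le_trans h0 ht) in t0.
have ID : lap_integrable (delay h u) s.
  apply: (iffRL (integrable_mkcond _ _)) => //; rewrite restrict_EFin.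
  by apply: eq_integrable (integrable_scale (expR (- s * h)) measurableT Ifh) => // t _ /=; rewrite E.
split => //; apply: EFin_inj; rewrite /lap /Rintegral fineK; last exact: integrable_fin_num.
rewrite EFinM fineK; last exact: integrable_fin_num.
have -> : (\int[mu]_(t in `[0%R, +oo[) (expR (- s * t) * u t)%:E = \int[mu]_t (f t)%:E)%E.
  by rewrite [LHS]integral_mkcond; apply: eq_integral => t _; rewrite /f /patch; case: ifP.
rewrite -(integral_shift (- h) If) -integralZl//.
rewrite [LHS]integral_mkcond; apply: eq_integral => t _.
rewrite -EFinM E /patch; by case: ifP.
Qed.

Lemma alt_inv : alt (fun s => s^-1).
Proof.
apply: (alt_ext _ (alt_lap (u := fun=> 1) _ _)) => [s s0|//|s s0].
- by rewrite lap_cst// mul1r.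
- exact: lap_integrable_cst.
Qed.

Lemma alt_step h : 0 <= h -> alt (fun s => (1 - expR (- s * h)) / s).
Proof.
move=> h0; pose u t : R := 1 - delay h (fun=> 1) t.
have Lu s : 0 < s -> lap_integrable u s /\ lap u s = (1 - expR (- s * h)) / s.
  move=> s0; have I1 := lap_integrable_cst 1 s0.
  have [I2 L2] := lap_delay h0 I1; have I3 := lap_integrableZ (-1) I2.
  have E t : 0 <= t -> 1 + -1 * delay h (fun=> 1) t = u t by rewrite /u => _; ring.
  split; first exact: eq_lap_integrable E (lap_integrableD I1 I3).
  by rewrite -(eq_lap _ E) (lapD I1 I3) (lapZ _ I2) L2 lap_cst//; ring.
apply: (alt_ext _ (alt_lap (u := u) _ _)) => [s s0|t t0|s s0].
- by have [] := Lu s s0.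
- by rewrite /u /delay; case: ifP => _; rewrite ?subrr ?subr0.
- by have [] := Lu s s0.
Qed.

Lemma le_nonpos_derivative (f df : R -> R) a b : a <= b ->
  (forall z : R, is_derive z 1 f (df z)) -> (forall z : R, a <= z -> df z <= 0) -> f b <= f a.
Proof.
move=> ab fdf d0; have [|z] := @MVT_segment _ f df a b ab (fun z _ => fdf z).
  apply: continuous_in_subspaceT => z _.
  by apply/differentiable_continuous/derivable1_diffP; have [] := fdf z.
by rewrite in_itv/= => /andP[az _] E; have := d0 z az; nra.
Qed.

(** Differences in s commute with the derivative in x, so the mean value inequality
    carries the signs of the differences of - dF/dx over to F a - F b. *)
Lemma alt_upto_primitive n (F G : R -> R -> R) a b : a <= b ->
  (forall x s, 0 < s -> is_derive x 1 (F^~ s) (- G x s)) -> (forall x, a <= x -> alt_upto n (G x)) ->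
  alt_upto n (fun s => F a s - F b s).
Proof.
move=> ab; elim: n F G => [|n IH] F G FG aG; split => //.
- move=> s s0; rewrite subr_ge0; apply: (le_nonpos_derivative ab (fun x => FG x s s0)) => x ax.
  by rewrite oppr_le0; exact: alt_upto_ge0 (aG x ax) s0.
- move=> s s0; rewrite subr_ge0; apply: (le_nonpos_derivative ab (fun x => FG x s s0)) => x ax.
  by rewrite oppr_le0; exact: alt_upto_ge0 (aG x ax) s0.
have H := IH (fun x s => F x s - F x (s + 1)) (fun x s => G x s - G x (s + 1)).
apply: alt_upto_ext (H _ _) => [s s0|x s s0|x ax]; first by ring.
  have := is_deriveB (FG x s s0) (FG x (s + 1) (addr_gt0 s0 ltr01)).
  by congr is_derive; ring.
by have [] := aG x ax.
Qed.

End Delay.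

Section PropagationShape.
Context {R : realType} (m : nat) (c : R) (cs al : 'I_m -> R).
Hypothesis hal : forall j : 'I_m, 1 <= al j < 2.
Hypothesis hc : 0 < c.
Hypothesis hcs : forall j : 'I_m, 0 < cs j.
Variable w : R -> R -> R.
Hypothesis hw : propagation_function c cs al w.
Variables (M a : R).
Hypothesis Ma : propagation_bound w M a.
Notation mu := (@lebesgue_measure R).
Implicit Types (x y t s h : R).
Local Notation lam := (symbol_sqrt c cs al).

(** Beyond the boundary the value is that of the boundary, so that -w_x gives no mass there. *)
Definition propagation_extension x t : R := if x <= 0 then 1 else w x t.
Local Notation W := propagation_extension.

Let a0 : 0 <= a. Proof. by have [] := Ma. Qed.

Lemma extension_transform x s : 0 <= x -> a < s ->
  lap_integrable (W x) s /\ lap (W x) s = expR (- (x * lam s)) / s.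
Proof.
move=> x0 as0; have s0 : 0 < s := le_lt_trans a0 as0.
rewrite /W; have [x0'|x0'] := leP x 0.
  have -> : x = 0 by apply/le_anti; rewrite x0'.
  rewrite mul0r oppr0 expR0; split; [exact: lap_integrable_cst|exact: lap_cst].
split; first exact: (propagation_lap_integrable hw Ma).
exact: (propagation_transform_pos hal hc hcs hw Ma).
Qed.

Lemma extension_right_cvg x t : 0 < t -> W x z @[z --> t^'+] --> W x t.
Proof.
move=> t0; rewrite /W; have [_|x0] := leP x 0; first exact: cvg_cst.
by have [[_ _ r] _ _ _ _] := hw; exact: r.
Qed.

(** The transform e^(- x sqrt g) / s has x-derivative - (sqrt g / s) e^(- x sqrt g), up
    to sign a product of two completely monotone functions. *)
Lemma extension_antitone x y t : 0 <= x -> x <= y -> 0 < t -> W y t <= W x t.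
Proof.
move=> x0 xy t0; rewrite -subr_ge0.
have y0 : 0 <= y := le_trans x0 xy.
pose F x s := expR (- (x * lam s)) / s.
have a1 s : a + 1 <= s -> a < s by lra.
have aF : alt (fun s => F x s - F y s).
  move=> n; apply: (alt_upto_primitive (G := fun x s => (lam s / s) * expR (- (x * lam s))) xy) => [z s s0|z xz].
    have := is_deriveZ (s^-1) (is_derive_expRM (- lam s) z).
    have -> : s^-1 \*: (fun z => expR (z * - lam s)) = F^~ s.
      by apply/funext => v; rewrite /F -mulrN; exact: mulrC.
    by congr is_derive; rewrite /GRing.scale/= mulrN; field; rewrite gt_eqF.
  have := altM (cm_alt (cm_symbol_sqrt_div hal hc hcs)) (cm_alt (cm_symbol_exp hal hc hcs (le_trans x0 xz))).
  exact.
apply: (@alt_lap_ge0 _ (fun t => W x t - W y t) _ (a + 1) _ aF).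
- have [Ix _] := extension_transform x0 (a1 _ (lexx _)).
  have [Iy _] := extension_transform y0 (a1 _ (lexx _)).
  apply: eq_lap_integrable (lap_integrableD Ix (lap_integrableZ (-1) Iy)) => z _; ring.
- by have := a0; lra.
- move=> s as0; have [Ix Lx] := extension_transform x0 (a1 _ as0).
  have [Iy Ly] := extension_transform y0 (a1 _ as0).
  rewrite /F -Lx -Ly (@eq_lap _ _ (fun z => W x z + -1 * W y z)); last by move=> z _; ring.
  by rewrite (lapD Ix (lap_integrableZ (-1) Iy)) (lapZ _ Iy); ring.
- exact: t0.
- by apply: cvgB; exact: extension_right_cvg.
Qed.

Lemma extension_ge0 x t : 0 <= x -> 0 <= t -> 0 <= W x t.
Proof.
move=> x0; rewrite le_eqVlt => /predU1P[<-|t0].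
  rewrite /W; have [//|x0'] := leP x 0; have [_ _ w0 _ _] := hw.
  by rewrite (w0 x x0').1.
have a1 s : a + 1 <= s -> a < s by lra.
apply: (@alt_lap_ge0 _ (W x) _ (a + 1) _ (altM (cm_alt (cm_symbol_exp hal hc hcs x0)) alt_inv)) => //.
- by have [] := extension_transform x0 (a1 _ (lexx _)).
- by have := a0; lra.
- by move=> s /a1 as0; have [] := extension_transform x0 as0.
- exact: extension_right_cvg.
Qed.

(** The increment over a time h has the transform (1 - e^(- s h)) / s * e^(- x sqrt g),
    in which both factors have alternating differences. *)
Lemma extension_monotone x t1 t2 : 0 <= x -> 0 < t1 -> t1 <= t2 -> W x t1 <= W x t2.
Proof.
move=> x0 t10; rewrite le_eqVlt => /predU1P[->//|t12].
pose h := t2 - t1; have h0 : 0 <= h by rewrite /h; lra.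
have a1 s : a + 1 <= s -> a < s by lra.
have -> : W x t1 = delay h (W x) t2.
  by rewrite /delay /h; case: ifPn => [_|]; [congr (W x _)|]; lra.
rewrite -subr_ge0.
have L s : a < s -> lap_integrable (fun t => W x t - delay h (W x) t) s /\
    lap (fun t => W x t - delay h (W x) t) s = (1 - expR (- s * h)) / s * expR (- (x * lam s)).
  move=> as0; have [Ix Lx] := extension_transform x0 as0.
  have [Id Ld] := lap_delay h0 Ix; have I3 := lap_integrableZ (-1) Id.
  have E t : 0 <= t -> W x t + -1 * delay h (W x) t = W x t - delay h (W x) t by move=> _; ring.
  split; first exact: eq_lap_integrable E (lap_integrableD Ix I3).
  by rewrite -(eq_lap _ E) (lapD Ix I3) (lapZ _ Id) Ld Lx; ring.
apply: (@alt_lap_ge0 _ (fun t => W x t - delay h (W x) t) _ (a + 1) _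
  (altM (alt_step h0) (cm_alt (cm_symbol_exp hal hc hcs x0)))).
- by have [] := L _ (a1 _ (lexx _)).
- by have := a0; lra.
- by move=> s /a1 as0; have [] := L s as0.
- by lra.
apply: cvgB; first by apply: extension_right_cvg; lra.
rewrite /delay; have -> : h <= t2 by rewrite /h; lra.
have /cvg_at_rightP H : W x z @[z --> (t2 - h)^'+] --> W x (t2 - h).
  by apply: extension_right_cvg; rewrite /h; lra.
apply/cvg_at_rightP => u [tu ut2].
have E n : (if h <= u n then W x (u n - h) else 0) = W x (u n - h).
  by have := tu n; case: ifPn => //; rewrite /h; lra.
under eq_fun do rewrite E.
apply: H; split; first by move=> n; have := tu n; lra.
by apply: cvgB => //; exact: cvg_cst.
Qed.

(** Finite propagation speed: compare W x t e^(-st) / s, a lower bound for the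
    transform by monotonicity, with e^(-x sqrt(c) s) / s and let s grow. *)
Lemma extension_support x t : 0 <= x -> 0 < t -> t < x * Num.sqrt c -> W x t = 0.
Proof.
move=> x0 t0 tx; apply/eqP; rewrite eq_le extension_ge0 ?(ltW t0)// andbT leNgt; apply/negP => Wp.
pose e := x * Num.sqrt c - t; have e0 : 0 < e by rewrite /e; lra.
have H s : a < s -> W x t <= expR (- (s * e)).
  move=> as0; have s0 : 0 < s := le_lt_trans a0 as0.
  have [Ix Lx] := extension_transform x0 as0.
  have Ic := lap_integrable_cst (W x t) s0.
  have [Id Ld] := lap_delay (ltW t0) Ic.
  have : lap (delay t (fun=> W x t)) s <= lap (W x) s.
    have H : forall z : R, `[0, +oo[%classic z -> expR (- s * z) * delay t (fun=> W x t) z <= expR (- s * z) * W x z; last first.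
      exact: (le_Rintegral _ Id Ix H).
    move=> z; rewrite /= in_itv/= andbT => z0; rewrite ler_wpM2l ?expR_ge0// /delay.
    by case: ifPn => tz; [exact: extension_monotone|exact: extension_ge0].
  rewrite Ld Lx lap_cst// mulrA ler_pM2r ?invr_gt0// => H.
  have -> : W x t = expR (s * t) * (expR (- s * t) * W x t).
    by rewrite mulrA -expRD mulNr addrN expR0 mul1r.
  apply: (@le_trans _ _ (expR (s * t) * expR (- (x * lam s)))); first by rewrite ler_wpM2l ?expR_ge0.
  rewrite -expRD ler_expR; have := symbol_sqrt_ge al hc hcs s0 => hl.
  have := ler_wpM2l x0 hl; rewrite /e; lra.
pose s := a + 1 + (W x t)^-1 / e.
have s0 : 0 < (W x t)^-1 / e by rewrite divr_gt0 ?invr_gt0.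
have := H s; rewrite /s => /(_ _); have -> : a < a + 1 + (W x t)^-1 / e by lra.
move=> /(_ isT); rewrite -/s expRN => H2.
have : W x t * expR (s * e) <= 1.
  by rewrite -ler_pdivlMr ?expR_gt0// mul1r.
have E1 := expR_ge1Dx (s * e).
have : (W x t)^-1 <= s * e.
  rewrite -ler_pdivrMr// /s; have := a0; lra.
move=> E2; have : W x t * (1 + (W x t)^-1) <= W x t * expR (s * e).
  by rewrite ler_pM2l//; lra.
rewrite mulrDr divff ?gt_eqF//; lra.
Qed.

(** A gap on the left at time t would persist on a time interval to the right of
    t, and be seen by the transform, which is continuous in x. *)
Lemma extension_left_cvg x t : 0 < x -> 0 < t -> W y t @[y --> x^'-] --> W x t.
Proof.
move=> x0 t0.
have H e : 0 < e -> exists2 y, 0 <= y < x & W y t < W x t + e.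
  move=> e0; apply: contrapT => nH.
  have ge y : 0 <= y < x -> W x t + e <= W y t.
    by move=> yx; rewrite leNgt; apply/negP => ?; apply: nH; exists y.
  have [d d0 Hd] : exists2 d, 0 < d & forall z, t <= z < t + d -> W x z <= W x t + e / 2.
    have /(cvgr_lt (W x t)) := @extension_right_cvg x t t0.
    move=> /(_ (W x t + e / 2)); have -> : W x t < W x t + e / 2 by lra.
    move=> /(_ isT) [d /= d0 Hd]; exists d => // z /andP[tz zd].
    have [->|tz'] := eqVneq z t; first by lra.
    apply/ltW/Hd; last by rewrite lt_neqAle eq_sym tz'.
    by rewrite /= ltr0_norm; lra.
  pose s := a + 1; have as0 : a < s by rewrite /s; lra.
  have s0 : 0 < s := le_lt_trans a0 as0.
  pose k := expR (- s * (t + d / 2)) * (e / 2).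
  have k0 : 0 < k by rewrite mulr_gt0 ?expR_gt0//; lra.
  have key y : 0 <= y < x -> k * (d / 2) <= (expR (- (y * lam s)) - expR (- (x * lam s))) / s.
    move=> /andP[y0 yx].
    have [Ix Lx] := extension_transform (ltW x0) as0; have [Iy Ly] := extension_transform y0 as0.
    have I3 := lap_integrableZ (-1) Ix.
    have E z : 0 <= z -> W y z + -1 * W x z = W y z - W x z by move=> _; ring.
    have -> : (expR (- (y * lam s)) - expR (- (x * lam s))) / s = lap (fun z => W y z - W x z) s.
      by rewrite -(eq_lap _ E) (lapD Iy I3) (lapZ _ Ix) Lx Ly; ring.
    have pos z : 0 <= z -> 0 <= W y z - W x z.
      rewrite le_eqVlt => /predU1P[<-|z0]; last by rewrite subr_ge0 extension_antitone// ltW.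
      have -> : W x 0 = 0 by rewrite /W leNgt x0/=; have [_ _ w0 _ _] := hw; rewrite (w0 x x0).1.
      by rewrite subr0 extension_ge0.
    have -> : d / 2 = (t + d / 2) - t by ring.
    apply: Rintegral_lower_bound; rewrite ?(ltW k0)//; try lra.
    - exact: eq_lap_integrable E (lap_integrableD Iy I3).
    - by move=> z z0; rewrite mulr_ge0 ?expR_ge0 ?pos.
    move=> z /andP[tz zd]; apply: ler_pM; rewrite ?expR_ge0//; try lra.
      by rewrite ler_expR ler_wnM2l//; lra.
    have z0 : 0 < z by lra.
    have h1 : W x z <= W x t + e / 2 by apply: Hd; lra.
    have h2 : W x t + e <= W y t by apply: ge; rewrite y0.
    have h3 : W y t <= W y z by apply: extension_monotone.
    lra.
  have C : (expR (- (y * lam s)) - expR (- (x * lam s))) / s @[y --> x^'-] --> (expR (- (x * lam s)) - expR (- (x * lam s))) / s.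
    apply: cvgM; last exact: cvg_cst.
    apply: cvgB; last exact: cvg_cst.
    apply: continuous_cvg; first exact: continuous_expR.
    apply: cvgN; apply: cvgM; last exact: cvg_cst.
    exact/cvg_at_left_filter/cvg_id.
  have kd : 0 < k * (d / 2) by rewrite mulr_gt0//; lra.
  rewrite subrr mul0r in C.
  have /(cvgr_lt 0)/(_ _ kd) := C => N1.
  have N2 : \forall y \near x^'-, 0 < y < x.
    near=> y; apply/andP; split => //; near: y; exact: nbhs_left_gt.
  have [y] := @filter_ex _ _ _ _ (filterI N1 N2).
  move=> [h1 /andP[y0 yx]]; have := key y; rewrite (ltW y0) yx => /(_ isT).
  by rewrite leNgt h1.
apply/cvgrPdist_lt => e e0; have [y0 /andP[y00 y0x] Hy] := H e e0.
near=> y; have yx : y < x by [].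
have y0y : y0 < y by near: y; exact: nbhs_left_gt.
have h1 : W y t <= W y0 t by apply: extension_antitone => //; exact: ltW.
have h2 : W x t <= W y t by apply: extension_antitone (ltW yx) t0; exact: le_trans (ltW y0y).
by rewrite ler0_norm; lra.
Unshelve. all: by end_near. Qed.

End PropagationShape.

(** * The propagation measures *)

Section ReflectedStieltjes.
Context {R : realType}.
Notation T := (measurableTypeR R).

(** Lebesgue-Stieltjes measures are built from intervals ]a, b]; reflecting the line
    turns them into the intervals [a, b[ that suit a left-continuous function. *)
Lemma reflected_stieltjes (G : R -> R) :
  (forall x y : R, x <= y -> G y <= G x) ->
  (forall x : R, G y @[y --> x^'-] --> G x) ->
  (forall x : R, x <= 0 -> G x = 1) ->
  G x @[x --> +oo] --> 0 ->
  exists phi : probability T R, forall a b : R, a <= b ->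
    phi `[a, b[%classic = (G a - G b)%:E.
Proof.
move=> Gn Gl G1 Gy.
pose F (x : R) := G (- x).
have Fnd : {homo F : x y / x <= y} by move=> x y xy; apply: Gn; rewrite lerN2.
have Frc : right_continuous F.
  move=> x; rewrite /F; have := Gl (- x).
  rewrite at_leftN => H; exact: cvg_trans H.
have Fy : F @ +oo --> (1 : R).
  apply: cvg_near_cst; near=> x; rewrite /F; apply: G1.
  rewrite oppr_le0; near: x; exact: nbhs_pinfty_ge.
have FNy : F @ -oo --> (0 : R).
  apply/cvgNy_compNP; apply: cvg_trans Gy; apply: near_eq_cvg; apply: nearW => x.
  by rewrite /F /= opprK.
pose f : cumulativeBounded (0 : R) (1 : R) := HB.pack F
  (isCumulative.Build R _ R F Fnd Frc) (isCumulativeBounded.Build R 0 1 F FNy Fy).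
pose P : probability T R := lebesgue_stieltjes_measure f.
have mopp : measurable_fun (setT : set T) ((fun x : R => - x) : T -> T).
  by apply: continuous_measurable_fun; exact: opp_continuous.
pose X : {mfun T >-> T} := HB.pack ((fun x : R => - x) : T -> T) (isMeasurableFun.Build _ _ T T _ mopp).
exists (distribution P X : probability T R) => a b ab.
rewrite /distribution/= /pushforward.
have -> : (fun x : R => - x) @^-1` `[a, b[%classic = `](- b), (- a)]%classic.
  by apply/seteqP; split => x /=; rewrite !in_itv/=; lra.
rewrite /P /lebesgue_stieltjes_measure /measure_extension measurable_mu_extE/=; last exact: is_ocitv.
by rewrite wlength_itv_bnd ?lerN2//= /F !opprK.
Unshelve. all: by end_near. Qed.
End ReflectedStieltjes.

Section PropagationMeasure.
Context {R : realType} (m : nat) (c : R) (cs al : 'I_m -> R).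
Hypothesis hal : forall j : 'I_m, 1 <= al j < 2.
Hypothesis hc : 0 < c.
Hypothesis hcs : forall j : 'I_m, 0 < cs j.
Variable w : R -> R -> R.
Hypothesis hw : propagation_function c cs al w.
Implicit Types (t : R).
Local Notation W := (propagation_extension w).

(** Finite propagation speed turns the total mass of [0, b[, which is 1 - W b t, into 1
    for every b beyond the front t / sqrt c. *)
Lemma propagation_measure_at t : 0 < t -> exists phi : probability (measurableTypeR R) R,
  [/\ forall a b : R, 0 <= a -> a <= b -> phi `[a, b[%classic = (W a t - W b t)%:E,
      phi `[0, +oo[%classic = 1%E
    & phi `](t / Num.sqrt c), +oo[%classic = 0%E].
Proof.
move=> t0; have [M [a Ma]] := propagation_bounded hw.
have W1 (x : R) : x <= 0 -> W x t = 1 by rewrite /propagation_extension => ->.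
have sc : 0 < Num.sqrt c by rewrite sqrtr_gt0.
have [|||| phi phiE] := reflected_stieltjes (G := W^~ t).
- move=> x y xy; have [y0|y0] := leP y 0; first by rewrite !W1// (le_trans xy).
  have [x0|x0] := leP x 0; last exact: (extension_antitone hal hc hcs hw Ma (ltW x0)).
  by rewrite (W1 x)// -(W1 0 (lexx _)); apply: (extension_antitone hal hc hcs hw Ma) => //; exact: ltW.
- move=> x; have [x0|x0] := ltP 0 x; first exact: (extension_left_cvg hal hc hcs hw Ma x0 t0).
  rewrite W1//; apply: cvg_near_cst; near=> y; apply: W1.
  by apply: le_trans x0; apply: ltW; near: y; exact: nbhs_left_lt.
- exact: W1.
- have [_ _ _ _ /(_ t t0)] := hw; apply: cvg_trans; apply: near_eq_cvg; near=> x.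
  by rewrite /propagation_extension leNgt ifF//; apply/negbTE; rewrite negbK; near: x; exact: nbhs_pinfty_gt.
exists phi.
have full b : t / Num.sqrt c < b -> phi `[0, b[%classic = 1%E.
  move=> tb; have b0 : 0 < b by apply: lt_trans tb; rewrite divr_gt0.
  rewrite phiE ?(ltW b0)// W1// (extension_support hal hc hcs hw Ma) ?subr0 ?(ltW b0)//.
  by rewrite -ltr_pdivrMr.
split.
- by move=> x y _ xy; exact: phiE.
- apply/eqP; rewrite eq_le probability_le1//=.
  rewrite -(full (t / Num.sqrt c + 1)); last by rewrite ltrDl.
  by apply: le_measure; rewrite ?inE// => x; rewrite /= !in_itv/= andbT => /andP[].
have : phi.-negligible `](t / Num.sqrt c), +oo[%classic; last first.
  by move=> /negligibleP; exact.
pose B : nat -> set (measurableTypeR R) := fun n => ~` `[0, (t / Num.sqrt c + n.+1%:R^-1)[%classic.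
apply: (@negligibleS _ (measurableTypeR R) R phi (\bigcup_n B n)).
  move=> x; rewrite /= in_itv/= andbT => tx.
  have [n Hn] : exists n : nat, n.+1%:R^-1 < x - t / Num.sqrt c.
    have /cvgr_lt := @cvg_harmonic R; move=> /(_ (x - t / Num.sqrt c)); rewrite subr_gt0 => /(_ tx).
    by move=> [n _ Hn]; exists n; exact: (Hn n (leqnn n)).
  by exists n => //; rewrite /B/= in_itv/= => /andP[_ H]; rewrite ltrBrDl in Hn; have := lt_trans H Hn; rewrite ltxx.
apply: negligible_bigcup => n; apply/negligibleP; rewrite /B; first exact: measurableC.
have := full (t / Num.sqrt c + n.+1%:R^-1).
rewrite ltrDl invr_gt0 ltr0n => /(_ isT) H; transitivity (1 - phi `[0%R, (t / Num.sqrt c + n.+1%:R^-1)%R[%classic)%E; last by rewrite H subee.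
by apply: probability_setC.
Unshelve. all: by end_near. Qed.

Lemma propagation_measure : exists phi : R -> probability (measurableTypeR R) R, forall t, 0 < t ->
  [/\ forall a b : R, 0 <= a -> a <= b -> phi t `[a, b[%classic = (W a t - W b t)%:E,
      phi t `[0, +oo[%classic = 1%E
    & phi t `](t / Num.sqrt c), +oo[%classic = 0%E].
Proof.
have [phi1 _] := propagation_measure_at ltr01.
have H t : exists phi : probability (measurableTypeR R) R, 0 < t ->
  [/\ forall a b : R, 0 <= a -> a <= b -> phi `[a, b[%classic = (W a t - W b t)%:E,
      phi `[0, +oo[%classic = 1%E
    & phi `](t / Num.sqrt c), +oo[%classic = 0%E].
  have [t0|t0] := ltP 0 t; last by exists phi1.
  by have [phi ?] := propagation_measure_at t0; exists phi.
by have [phi ?] := choice H; exists phi.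
Qed.

End PropagationMeasure.

(** * Norming functionals *)

Section HahnBanach.
Context {R : realType} {X : normedModType R}.
Implicit Types (u v x y : X) (a b r : R) (f : X -> R) (G : set (X * R)).

Definition contraction_functional f :=
  (forall a u v, f (a *: u + v) = a * f u + f v) /\ forall u, `|f u| <= `|u|.

(** The graph of a linear functional on a subspace: unlike a function on a varying
    domain, it can be extended by union. *)
Definition dominated_graph G :=
  (forall a p q, G p -> G q -> G (a *: p.1 + q.1, a * p.2 + q.2)) /\ forall p, G p -> p.2 <= `|p.1|.

(** A value c at u is admissible when it lies between all p.2 - |p.1 - u| and all
    |p.1 + u| - p.2, and domination separates these two sets. *)
Lemma extend_dominated_graph G u : dominated_graph G -> G !=set0 ->
  exists c, dominated_graph [set p | exists2 q, G q & exists a, p = (q.1 + a *: u, q.2 + a * c)].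
Proof.
move=> [Gl Gb] [p0 Gp0].
have GD p q : G p -> G q -> G (p.1 + q.1, p.2 + q.2).
  by move=> Gp Gq; have := Gl 1 p q Gp Gq; rewrite scale1r mul1r.
have G0 : G (0, 0).
  by have := Gl (-1) p0 p0 Gp0 Gp0; rewrite scaleN1r mulN1r !addNr.
have GZ a p : G p -> G (a *: p.1, a * p.2).
  by move=> Gp; have := Gl a p (0, 0) Gp G0; rewrite !addr0.
pose L := [set r | exists2 p, G p & r = p.2 - `|p.1 - u|].
have L0 : L !=set0 by exists (p0.2 - `|p0.1 - u|), p0.
have Lub q : G q -> ubound L (`|q.1 + u| - q.2).
  move=> Gq _ [p Gp ->]; rewrite lerBlDr addrAC lerBrDr.
  apply: (le_trans (Gb _ (GD _ _ Gp Gq))) => /=.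
  have -> : p.1 + q.1 = (q.1 + u) + (p.1 - u) by rewrite [p.1 - u]addrC addrA addrK addrC.
  exact: ler_normD.
pose c := sup L.
have c1 p : G p -> p.2 - `|p.1 - u| <= c.
  by move=> Gp; apply: ub_le_sup; [exists (`|p.1 + u| - p.2); exact: Lub|exists p].
have c2 p : G p -> c <= `|p.1 + u| - p.2 by move=> Gp; apply: ge_sup => //; exact: Lub.
exists c; split.
- move=> a _ _ [p Gp [b ->]] [q Gq [d ->]] /=.
  exists (a *: p.1 + q.1, a * p.2 + q.2); first exact: Gl.
  exists (a * b + d); congr pair => /=; last by ring.
  by rewrite scalerDr scalerDl scalerA addrACA.
move=> _ [p Gp [a ->]] /=; have [a0|a0|->] := ltgtP a 0.
- have b0 : 0 < - a by rewrite oppr_gt0.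
  have := c1 _ (GZ (- a)^-1 _ Gp) => /= H.
  have E : (- a) * ((- a)^-1 * p.2 - `|(- a)^-1 *: p.1 - u|) = p.2 - `|p.1 + a *: u|.
    rewrite mulrBr mulrA divff ?gt_eqF// mul1r; congr (_ - _).
    rewrite -{1}(gtr0_norm b0) -normrZ scalerBr scalerA divff ?gt_eqF// scale1r.
    by rewrite scaleNr opprK.
  have := ler_wpM2l (ltW b0) H; rewrite E; lra.
- have := c2 _ (GZ a^-1 _ Gp) => /= H.
  have E : a * (`|a^-1 *: p.1 + u| - a^-1 * p.2) = `|p.1 + a *: u| - p.2.
    rewrite mulrBr mulrA divff ?gt_eqF// mul1r; congr (_ - _).
    by rewrite -{1}(gtr0_norm a0) -normrZ scalerDr scalerA divff ?gt_eqF// scale1r.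
  have := ler_wpM2l (ltW a0) H; rewrite E; lra.
- by rewrite scale0r mul0r !addr0; exact: Gb.
Qed.

(** The Hahn-Banach theorem, by Zorn's lemma on dominated graphs. *)
Lemma norming_functional v : exists2 f, contraction_functional f & f v = `|v|.
Proof.
(* The implication makes the empty graph, the union of the empty chain, acceptable. *)
pose P G := dominated_graph G /\ (G !=set0 -> G (v, `|v|)).
have [F FP Ft|G [[Gd Gv] Gmax]] := @Zorn_bigcup _ P.
  split; first split.
  - move=> a p q [A FA Ap] [B FB Bq]; have [AB|BA] := Ft A B FA FB.
      by exists B => //; have [[L _] _] := FP B FB; apply: L => //; exact: AB.
    by exists A => //; have [[L _] _] := FP A FA; apply: L => //; exact: BA.
  - by move=> p [A FA Ap]; have [[_ L] _] := FP A FA; exact: L.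
  - by move=> [p [A FA Ap]]; exists A => //; have [_] := FP A FA; apply; exists p.
have G0 : G !=set0.
  apply: contrapT => nG.
  pose H := [set p : X * R | exists a, p = (a *: v, a * `|v|)].
  apply: (Gmax H).
    split; first by move=> p Gp; exfalso; apply: nG; exists p.
    by move=> HG; apply: nG; exists (v, `|v|); apply: HG; exists 1; rewrite scale1r mul1r.
  split; last by move=> _; exists 1; rewrite scale1r mul1r.
  split.
    move=> a _ _ [b ->] [d ->] /=; exists (a * b + d).
    by rewrite scalerDl scalerA; congr pair; ring.
  by move=> _ [a ->] /=; rewrite normrZ ler_wpM2r// ler_norm.
have dom u : exists r, G (u, r).
  apply: contrapT => nu; have [c Hc] := extend_dominated_graph u Gd G0.
  apply: (Gmax _ _ (conj Hc _)).
    split; first by move=> p Gp; exists p => //; exists 0; rewrite scale0r mul0r !addr0 -surjective_pairing.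
    have [p Gp] := G0; have [Gl _] := Gd; move=> H; apply: nu; exists c; apply: H.
    exists (0, 0); first by have := Gl (-1) p p Gp Gp; rewrite scaleN1r mulN1r !addNr.
    by exists 1; rewrite scale1r mul1r !add0r.
  move=> _; exists (v, `|v|); first exact: Gv.
  by exists 0; rewrite scale0r mul0r !addr0.
have [Gl Gb] := Gd.
have [f Gf] := choice dom.
have Gu u r : G (u, r) -> r = f u.
  move=> Gr; have H a : a * (r - f u) <= 0.
    have := Gl (- 1) _ _ (Gf u) Gr; rewrite /= scaleN1r addNr mulN1r => H1.
    have := Gl a _ _ H1 (Gl (-1) _ _ Gr Gr); rewrite /= scaleN1r addNr mulN1r addNr => /Gb.
    by rewrite /= scaler0 !addr0 normr0 [- f u + r]addrC.
  by have := H (r - f u); have := H 1; rewrite -expr2 => h1 h2; nra.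
exists f; last by apply/esym/Gu/Gv.
have fl a x y : f (a *: x + y) = a * f x + f y by apply/esym/Gu; exact: (Gl a _ _ (Gf x) (Gf y)).
split => // u; rewrite ler_norml; apply/andP; split; last exact: Gb _ (Gf u).
have f0 : f 0 = 0.
  have := fl 1 0 0; rewrite scale1r addr0 mul1r; lra.
have := fl (-1) u 0; rewrite f0 addr0 scaleN1r addr0 mulN1r => fN.
by rewrite lerNl -fN -[leRHS]normrN; exact: (Gb _ (Gf (- u))).
Qed.

Section Theory.
Variable f : X -> R.
Hypothesis cf : contraction_functional f.

Lemma functional0 : f 0 = 0.
Proof. by have [fl _] := cf; have := fl 1 0 0; rewrite scale1r addr0 mul1r; lra. Qed.

Lemma functionalD u v : f (u + v) = f u + f v.
Proof. by have [fl _] := cf; have := fl 1 u v; rewrite scale1r mul1r. Qed.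

Lemma functionalZ a u : f (a *: u) = a * f u.
Proof. by have [fl _] := cf; have := fl a u 0; rewrite functional0 !addr0. Qed.

Lemma functionalN u : f (- u) = - f u.
Proof. by rewrite -scaleN1r functionalZ mulN1r. Qed.

Lemma functionalB u v : f (u - v) = f u - f v.
Proof. by rewrite functionalD functionalN. Qed.

Lemma functional_sum (I : Type) (r : seq I) (g : I -> X) :
  f (\sum_(i <- r) g i) = \sum_(i <- r) f (g i).
Proof.
by elim: r => [|i r IH]; rewrite ?big_nil ?functional0// !big_cons functionalD IH.
Qed.

Lemma functional_continuous : continuous f.
Proof.
move=> x; apply/cvgrPdist_le => e e0; near=> y.
have [_ fb] := cf; rewrite -functionalB; apply: (le_trans (fb _)).
by near: y; apply: cvgr_dist_le.
Unshelve. all: by end_near. Qed.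

End Theory.

Lemma functional_separation u v : (forall f, contraction_functional f -> f u = f v) -> u = v.
Proof.
move=> H; have [f cf fuv] := norming_functional (u - v).
apply/eqP; rewrite -subr_eq0 -normr_eq0 -fuv functionalB//.
by rewrite (H f cf) subrr.
Qed.

End HahnBanach.

Section UniformContinuity.
Context {R : realType} {X : normedModType R}.

(** Compactness; continuity is two-sided at the end points, so y may leave the segment. *)
Lemma segment_uniformly_continuous (g : R -> X) (a b : R) : (forall x, a <= x <= b -> {for x, continuous g}) ->
  forall e : R, 0 < e -> exists2 d : R, 0 < d & forall x y : R, a <= x <= b -> `|x - y| < d -> `|g x - g y| <= e.
Proof.
move=> cg e e0; have e2 : 0 < e / 2 by rewrite divr_gt0.
have := @segment_compact R a b => /compact_near_coveringP/(_ R (0^'+)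
  (fun d x => forall y : R, `|x - y| < d -> `|g x - g y| <= e)).
case.
  move=> x; rewrite /= in_itv/= => xab.
  have /cvgrPdist_le/(_ _ e2)[r /= r0 Hr] := cg x xab.
  exists (ball x (r / 2), [set d | d < r / 2]) => /=.
    split; first by apply: nbhsx_ballx; rewrite divr_gt0.
    by apply: nbhs_right_lt; rewrite divr_gt0.
  move=> [z d] /= [xz dr] y zy.
  rewrite /ball/= in xz.
  have h1 : `|g x - g z| <= e / 2 by apply: Hr => /=; lra.
  have h2 : `|g x - g y| <= e / 2.
    apply: Hr => /=; apply: (le_lt_trans (ler_distD z x y)); lra.
  apply: (le_trans (ler_distD (g x) (g z) (g y))); rewrite (distrC (g z)); lra.
move=> r /= r0 Hr; exists (r / 2); first by rewrite divr_gt0.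
move=> x y xab xy; apply: (Hr (r / 2)) => //=.
- by rewrite sub0r normrN gtr0_norm; lra.
- by rewrite divr_gt0.
Qed.

End UniformContinuity.

(** * Bochner integrals of continuous functions *)

Section BochnerFunctional.
Context d {T : measurableType d} {R : realType} {X : normedModType R}.
Variables (mu : {measure set T -> \bar R}) (D : set T).
Hypothesis mD : measurable D.
Implicit Types (f : X -> R) (g : T -> X).

Lemma functional_simple_fun f n (E : nat -> set T) (x : nat -> X) : contraction_functional f ->
  (forall i, measurable (E i) /\ (mu (E i) < +oo)%E) ->
  mu.-integrable D (EFin \o (fun a => f (simple_fun n E x a))) /\
  \int[mu]_(a in D) f (simple_fun n E x a) = f (simple_integral mu D n E x).
Proof.
move=> cf mE.
have E1 a : f (simple_fun n E x a) = \sum_(i < n) f (x i) * \1_(E i) a.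
  rewrite /simple_fun functional_sum//; apply: eq_bigr => i _.
  by rewrite functionalZ// mulrC.
have I1 i : mu.-integrable D (EFin \o (fun a => \1_(E i) a : R)).
  have [mEi fEi] := mE i.
  apply/integrableP; split; first by apply/measurable_EFinP; exact: measurable_indic.
  under eq_integral do rewrite /= ger0_norm//.
  rewrite integral_indic//; apply: le_lt_trans fEi; apply: le_measure; rewrite ?inE//; first exact: measurableI.
have I2 i : mu.-integrable D (EFin \o (fun a => f (x i) * \1_(E i) a)) by apply: integrable_scale.
have EE : (fun a => f (simple_fun n E x a)) = (fun a => \sum_(i < n) f (x i) * \1_(E i) a).
  exact/funext.
split; first by rewrite EE; exact: integrable_sumr.
rewrite EE Rintegral_sum//; rewrite /simple_integral functional_sum//; apply: eq_bigr => i _.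
rewrite functionalZ// RintegralZl// mulrC; congr (_ * _).
by rewrite /Rintegral (integral_indic mu mD (proj1 (mE i))) [E i `&` D]setIC.
Qed.

(** f of the p-th simple integral differs from the integral of f g by at most the L^1
    distance between the p-th simple function and g. *)
Lemma bochner_functional f g I : contraction_functional f -> bochner_integral mu D g I ->
  mu.-integrable D (EFin \o (f \o g)) -> \int[mu]_(a in D) f (g a) = f I.
Proof.
move=> cf [n [E [x [mE mh Lh LI]]]] Ig.
pose s p := simple_integral mu D (n p) (E p) (x p).
have Is p := functional_simple_fun (n p) (x p) cf (mE p).
have C1 : f (s p) @[p --> \oo] --> f I.
  by apply: continuous_cvg => //; exact: functional_continuous.
apply/esym; apply: (cvg_unique _ C1) => //.
have sle p : (`|f (s p) - \int[mu]_(a in D) f (g a)|%:E <=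
    \int[mu]_(a in D) (`|simple_fun (n p) (E p) (x p) a - g a|)%:E)%E.
  have [I1 L1] := Is p; rewrite /s -L1 -RintegralB//.
  have I3 : mu.-integrable D (EFin \o (fun a => f (simple_fun (n p) (E p) (x p) a) - f (g a))).
    by have := integrableB mD I1 Ig; apply: eq_integrable.
  apply: (@le_trans _ _ (\int[mu]_(a in D) `|f (simple_fun (n p) (E p) (x p) a) - f (g a)|%:E)%E).
    apply: le_trans (le_abse_integral _ mD (measurable_int mu I3)).
    by rewrite /Rintegral -abse_EFin fineK//; exact: integrable_fin_num.
  apply: ge0_le_integral => //.
  - by apply/measurable_EFinP; apply: measurableT_comp => //; exact: integrable_measurable I3.
  - exact/measurable_EFinP/mh.
  - by move=> a _; rewrite lee_fin -functionalB//; have [_] := cf; apply.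
have C2 : (`|f (s p) - \int[mu]_(a in D) f (g a)|%:E)%E @[p --> \oo] --> 0%E.
  apply: (squeeze_cvge _ (cvg_cst 0%E) Lh); apply: nearW => p.
  by rewrite (sle p) andbT lee_fin.
have C3 : `|f (s p) - \int[mu]_(a in D) f (g a)| @[p --> \oo] --> 0.
  by move/fine_cvgP: C2 => [_].
rewrite /=; apply/subr_cvg0; exact: norm_cvg0.
Qed.

End BochnerFunctional.

Section BochnerExistence.
Context {R : realType} {X : completeNormedModType R}.
Notation T := (measurableTypeR R).
Variables (mu : {measure set T -> \bar R}) (D : set T) (g : R -> X) (b : R -> R).
Hypotheses (mD : measurable D) (D0 : forall x : R, D x -> 0 <= x) (fD : (mu D < +oo)%E).
Hypothesis cg : forall x : R, 0 < x -> {for x, continuous g}.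
Hypotheses (Ib : mu.-integrable D (EFin \o b)) (gb : forall x : R, D x -> `|g x| <= b x).
Implicit Types (N i K : nat) (x y : R).

Lemma measurable_fun_pos (h : R -> R) : measurable_fun (`]0, +oo[ : set T) h -> measurable_fun D h.
Proof.
move=> mh; have -> : D = (D `&` `]0, +oo[) `|` (D `&` [set 0]).
  apply/seteqP; split => x; last by move=> [[]|[]].
  move=> Dx; have := D0 Dx; rewrite le_eqVlt => /predU1P[x0|x0]; [by right; rewrite -x0 in Dx *|left; split => //].
  by rewrite /= in_itv/= x0.
apply/measurable_funU; [exact: measurableI|exact: measurableI|split].
- by apply: measurable_funS mh => // x [].
- have m0 : measurable_fun ([set 0] : set T) h by exact: measurable_fun_set1.
  by apply: measurable_funS m0 => // x [].
Qed.

Let mesh : forall N, exists K, (N.+1 <= K)%N /\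
  forall x y, N.+1%:R^-1 <= x <= N.+1%:R -> `|x - y| <= K%:R^-1 -> `|g x - g y| <= N.+1%:R^-1.
Proof.
move=> N; have [||e e0 He] := @segment_uniformly_continuous _ _ g N.+1%:R^-1 N.+1%:R _ (N.+1%:R^-1).
- by move=> x /andP[x1 _]; apply: cg; apply: lt_le_trans x1; rewrite invr_gt0.
- by rewrite invr_gt0.
pose K := (Num.truncn e^-1 + N).+1.
exists K; split; first by rewrite ltnS leq_addl.
move=> x y xN xy; apply: He => //; apply: (le_lt_trans xy).
rewrite -[ltRHS]invrK ltf_pV2 ?posrE ?invr_gt0//.
have := @truncn_itv R e^-1; rewrite invr_ge0 (ltW e0) => /(_ isT)/andP[_ H].
by apply: (lt_le_trans H); rewrite ler_nat ltnS leq_addr.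
Qed.

Section Mesh.
Variable K : nat -> nat.
Hypothesis K1 : forall N, (N.+1 <= K N)%N.
Hypothesis K2 : forall N x y, N.+1%:R^-1 <= x <= N.+1%:R -> `|x - y| <= (K N)%:R^-1 -> `|g x - g y| <= N.+1%:R^-1.

Let K0 N : 0 < (K N)%:R :> R. Proof. by rewrite ltr0n; exact: leq_trans (K1 N). Qed.

Let n0 N := (K N * N.+1)%N.
Let cell N i : set T := D `&` `[(i%:R / (K N)%:R), (i.+1%:R / (K N)%:R)[%classic.
(* The point 0 is a cell of its own, since g may jump there. *)
Let E N i : set T := if (i < n0 N)%N then cell N i else D `&` [set 0].
Let y N i : X := if (N.+1%:R^-1 : R) <= i%:R / (K N)%:R then g (i%:R / (K N)%:R) else 0.
Let xs N i : X := if (i < n0 N)%N then y N i else g 0.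
Let simple N : R -> X := simple_fun (n0 N).+1 (E N) (xs N).

Let cellE N i x : D x -> \1_(cell N i) x = (Num.truncn (x * (K N)%:R) == i)%:R :> R.
Proof.
move=> Dx; rewrite indicE; congr (_%:R); congr nat_of_bool.
rewrite /cell in_setI mem_set// mem_setE in_itv/= truncn_eq; last by apply: mulr_ge0; [exact: D0|exact: ltW (K0 N)].
by rewrite ler_pdivrMr// ltr_pdivlMr.
Qed.

Let simpleE N x : D x -> simple N x =
  (if (Num.truncn (x * (K N)%:R) < n0 N)%N then y N (Num.truncn (x * (K N)%:R)) else 0)
  + (if x == 0 then g 0 else 0).
Proof.
move=> Dx; rewrite /simple /simple_fun big_ord_recr/= /E /xs ltnn; congr (_ + _); last first.
  rewrite indicE in_setI mem_set//=; case: eqP => [->|x0].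
    by rewrite mem_set// scale1r.
  by rewrite memNset ?scale0r.
under eq_bigr => i _ do rewrite ltn_ord cellE//.
case: ifPn => [h|h].
  rewrite (bigD1 (Ordinal h))//= eqxx scale1r big1 ?addr0// => i ih.
  by case: eqP => [H|_]; [rewrite -val_eqE/= H eqxx in ih|rewrite scale0r].
rewrite big1// => i _; case: eqP => [H|_]; last by rewrite scale0r.
by rewrite H ltn_ord in h.
Qed.

Let h N x : R := `|simple N x - g x|.

Let h_0 N : D 0 -> h N 0 = 0.
Proof.
move=> Dz; rewrite /h simpleE// eqxx mul0r.
have -> : Num.truncn (0 : R) = 0%N by apply: truncn_def; rewrite mulr0n lexx ltr01.
by rewrite /y mul0r leNgt invr_gt0 ltr0Sn/=; case: ifP; rewrite add0r subrr normr0.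
Qed.

Let cell_close N x i : 0 <= x -> Num.truncn (x * (K N)%:R) = i -> `|i%:R / (K N)%:R - x| <= (K N)%:R^-1.
Proof.
move=> x0 <-; have := @truncn_itv R (x * (K N)%:R); rewrite mulr_ge0// => /(_ isT)/andP[h1 h2].
rewrite distrC ger0_norm; last by rewrite subr_ge0 ler_pdivrMr.
rewrite lerBlDr -[X in X + _]mul1r -mulrDl ler_pdivlMr//.
by apply: ltW; move: h2; rewrite -natr1 addrC.
Qed.

Let h_in N x : D x -> 0 < x -> let i := Num.truncn (x * (K N)%:R) in
  (i < n0 N)%N -> (N.+1%:R^-1 : R) <= i%:R / (K N)%:R -> h N x <= N.+1%:R^-1.
Proof.
move=> Dx x0 i iN Ni; rewrite /h simpleE// (gt_eqF x0) addr0 -/i iN /y Ni.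
apply: (K2 (N := N)); last exact: cell_close (ltW x0) erefl.
rewrite Ni/= ler_pdivrMr// -natrM ler_nat mulnC; exact: ltnW.
Qed.

Let h_bound N x : D x -> h N x <= 1 + b x.
Proof.
move=> Dx; have b0 : 0 <= b x by apply: le_trans (gb Dx).
have := D0 Dx; rewrite le_eqVlt => /predU1P[x0|x0].
  have -> : h N x = 0 by rewrite -x0 h_0// x0.
  by apply: addr_ge0.
have [iN|iN] := boolP (Num.truncn (x * (K N)%:R) < n0 N)%N; last first.
  by rewrite /h simpleE// (negbTE iN) (gt_eqF x0) addr0 sub0r normrN; have := gb Dx; lra.
have [Ni|Ni] := boolP (N.+1%:R^-1 <= (Num.truncn (x * (K N)%:R))%:R / (K N)%:R :> R); last first.
  by rewrite /h simpleE// iN /y (negbTE Ni) (gt_eqF x0) addr0 sub0r normrN; have := gb Dx; lra.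
apply: (le_trans (h_in Dx x0 iN Ni)).
have H1 : (N.+1%:R^-1 : R) <= 1 by rewrite invf_le1// ler1n.
by apply: le_trans H1 _; rewrite lerDl.
Qed.

Let h_cvg x : D x -> h N x @[N --> \oo] --> 0.
Proof.
move=> Dx; have := D0 Dx; rewrite le_eqVlt => /predU1P[x0|x0].
  have h0 N : h N x = 0 by rewrite -x0 h_0// x0.
  by under eq_fun do rewrite h0; exact: cvg_cst.
apply: (@squeeze_cvgr _ _ _ _ (fun=> 0) (fun N => N.+1%:R^-1)); [|exact: cvg_cst|exact: cvg_harmonic].
near=> N; rewrite normr_ge0/=; apply: h_in => //.
  rewrite -(ltr_nat R); have := @truncn_itv R (x * (K N)%:R); rewrite mulr_ge0 ?(ltW x0)// => /(_ isT)/andP[h1 _].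
  apply: (le_lt_trans h1); rewrite /n0 natrM mulrC ltr_pM2l//.
  apply: (@lt_trans _ _ N%:R); last by rewrite ltr_nat.
  near: N; exact: nbhs_infty_gtr.
have := cell_close (N := N) (ltW x0) erefl; rewrite ler_norml => /andP[H _].
have H2 : (K N)%:R^-1 <= N.+1%:R^-1 :> R by rewrite lef_pV2 ?posrE// ler_nat.
have H3 : N.+1%:R^-1 < x / 2.
  near: N; have := @cvg_harmonic R => /cvgr_lt; apply; exact: divr_gt0.
have ab (p q r z : R) : - q <= p - z -> q <= r -> r < z / 2 -> r <= p by lra.
exact: ab H H2 H3.
Unshelve. all: by end_near. Qed.

Let mE N i : measurable (E N i) /\ (mu (E N i) < +oo)%E.
Proof.
have H : measurable (E N i).
  by rewrite /E; case: ifP => _; apply: measurableI.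
split => //; apply: le_lt_trans fD; apply: le_measure; rewrite ?inE//.
by rewrite /E; case: ifP => _ x [].
Qed.

Let mh N : measurable_fun D (h N).
Proof.
have mn (z : X) : measurable_fun D (fun x : R => `|z - g x|).
  apply: measurable_fun_pos; apply: open_continuous_measurable_fun => //.
  move=> x; rewrite inE/= in_itv/= andbT => x0.
  by apply: cvg_norm; apply: cvgB; [exact: cvg_cst|exact: cg].
pose H x := \sum_(i < n0 N) \1_(cell N i) x * `|y N i - g x| + (1 - \sum_(i < n0 N) \1_(cell N i) x) * `|0 - g x|.
pose H' x := if x == 0 then 0 else H x.
have mi i : measurable_fun D (\1_(cell N i) : R -> R).
  apply: measurable_indic; exact: measurableI.
have mH : measurable_fun D H.
  apply: measurable_funD; last first.
    by apply: measurable_funM => //; apply: measurable_funB => //; exact: measurable_sum.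
  by apply: measurable_sum => i; exact: measurable_funM.
apply: (@eq_measurable_fun _ _ _ _ _ (fun x => H x * (x != 0)%:R)); last first.
  apply: measurable_funM => //.
  have -> : (fun x : R => (x != 0)%:R) = (\1_(~` [set 0]) : R -> R).
    apply/funext => x; rewrite indicE; congr (nat_of_bool _)%:R.
    have [->|x0] := eqVneq x 0; first by apply/esym/memNset => /(_ erefl).
    by apply/esym/mem_set => e; rewrite e eqxx in x0.
  by apply: measurable_indic; exact: measurableC.
move=> x; rewrite inE => Dx; have [x0|x0] := eqVneq x 0.
  by rewrite mulr0 x0 h_0// -x0.
rewrite mulr1 /h simpleE// (negbTE x0) addr0 /H.
under eq_bigr => i _ do rewrite cellE//.
under [X in 1 - X]eq_bigr => i _ do rewrite cellE//.
case: ifPn => hi.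
  rewrite (bigD1 (Ordinal hi))//= eqxx mul1r big1 ?addr0; last first.
    by move=> i ih; case: eqP => [e|_]; [rewrite -val_eqE/= e eqxx in ih|rewrite mul0r].
  rewrite (bigD1 (Ordinal hi))//= eqxx big1 ?addr0 ?subrr ?mul0r ?addr0//.
  by move=> i ih; case: eqP => [e|_] //; rewrite -val_eqE/= e eqxx in ih.
rewrite big1; last by move=> i _; case: eqP => [e|_]; [rewrite e ltn_ord in hi|rewrite mul0r].
rewrite big1; last by move=> i _; case: eqP => [e|_] //; rewrite e ltn_ord in hi.
by rewrite subr0 mul1r add0r.
Qed.

Let I1b : mu.-integrable D (EFin \o (fun x => 1 + b x)).
Proof.
have I1 : mu.-integrable D (EFin \o (fun=> 1 : R)).
  apply: measurable_bounded_integrable => //.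
  by exists 1; split => // z /ltW z1 x _ /=; rewrite normr1.
by have := integrableD mD I1 Ib; apply: eq_integrable.
Qed.

Let r N := \int[mu]_(x in D) h N x.

Let h_integral : (\int[mu]_(x in D) (h N x)%:E)%E @[N --> \oo] --> 0%E.
Proof.
have [] := @dominated_convergence _ _ _ mu D mD (fun N => EFin \o h N) (fun=> 0%E) (EFin \o (fun x => 1 + b x)).
- by move=> N; exact/measurable_EFinP.
- exact: measurable_cst.
- apply: aeW => x Dx; apply: cvg_EFin; first exact: nearW.
  exact: h_cvg.
- exact: I1b.
- by apply: aeW => x N Dx /=; rewrite lee_fin ger0_norm; [exact: h_bound|exact: normr_ge0].
by move=> _ _; rewrite integral0.
Qed.

Let Ih N : mu.-integrable D (EFin \o h N).
Proof. by apply: dominated_integrable I1b => // x Dx; rewrite ger0_norm; [exact: h_bound|exact: normr_ge0]. Qed.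

Let r_cvg : r N @[N --> \oo] --> 0.
Proof. exact: fine_cvg h_integral. Qed.

Let s N := simple_integral mu D (n0 N).+1 (E N) (xs N).

Let s_close N M : `|s N - s M| <= r N + r M.
Proof.
have [f cf <-] := norming_functional (s N - s M); rewrite functionalB//.
have [IN <-] := functional_simple_fun mD (n0 N).+1 (xs N) cf (mE N).
have [IM <-] := functional_simple_fun mD (n0 M).+1 (xs M) cf (mE M).
rewrite -RintegralB// -RintegralD//; apply: le_Rintegral => //.
- by have := integrableB mD IN IM; apply: eq_integrable.
- by have := integrableD mD (Ih N) (Ih M); apply: eq_integrable.
move=> x Dx; rewrite -functionalB//; apply: (le_trans (ler_norm _)).
have [_ fb] := cf; apply: (le_trans (fb _)).
by rewrite /h [`|simple M x - g x|]distrC; exact: ler_distD.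
Qed.

Lemma bochner_exists_mesh : exists I, bochner_integral mu D g I.
Proof.
have : cauchy (s N @[N --> \oo]).
  apply: cauchy_exP => e e0; have e2 : 0 < e / 2 by rewrite divr_gt0.
  have /(cvgr_lt 0)/(_ _ e2) H := r_cvg.
  have [M HM] := filter_ex H.
  exists (s M); apply: filterS H => N HN; rewrite -ball_normE /=.
  apply: (le_lt_trans (s_close M N)); lra.
move=> /cauchy_cvgP/cvg_ex[I sI].
exists I, (fun N => (n0 N).+1), E, xs; split; [exact: mE|exact: mh|exact: h_integral|exact: sI].
Qed.
End Mesh.

(** Step functions over finer and finer uniform grids of growing intervals [1/N, N]:
    a uniform estimate inside, domination by |g| outside; norming functionals
    reduce the Cauchy property of their integrals to the scalar integral. *)
Lemma bochner_exists : exists I, bochner_integral mu D g I.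
Proof.
have [K HK] := choice mesh.
by apply: (@bochner_exists_mesh K) => N; have [] := HK N.
Qed.
End BochnerExistence.

(** * Reflection and vector Laplace integrals *)

Section Reflection.
Context {R : realType}.
Notation mu := (@lebesgue_measure R).
Notation T := (measurableTypeR R).
Implicit Types (a t s x : R) (f u : R -> R).

Let refl a : T -> T := fun t : R => a - t.

Let measurable_refl a : measurable_fun setT (refl a).
Proof.
apply: continuous_measurable_fun => t.
by apply: cvgB; [exact: cvg_cst|exact: cvg_id].
Qed.

Let refl_preserving a (A : set T) : measurable A -> pushforward mu (refl a) A = mu A.
Proof.
move=> mA; have mr := measurable_refl a; apply/esym/lebesgue_measure_unique => //.
move=> _ [[x y]] _ <-.
have E : refl a @^-1` `]x, y]%classic = `[(a - y), (a - x)[%classic.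
  by apply/seteqP; split => t /=; rewrite !in_itv/= /refl; lra.
rewrite [RHS](_ : _ = mu (refl a @^-1` `]x, y]%classic)); last by [].
rewrite E !lebesgue_measure_itv/= !lte_fin ltrD2l ltrN2; case: ifP => // _.
by rewrite -!EFinB; congr EFin; ring.
Qed.

Let patch_refl a f x : (f \_ `[0, a]) (a - x) = ((fun t => f (a - t)) \_ `[0, a]) x.
Proof.
rewrite /patch !mem_setE !in_itv/=; have -> // : (0 <= a - x <= a) = (0 <= x <= a).
by apply/idP/idP => /andP[? ?]; apply/andP; split; lra.
Qed.

Let patch_integrable a f : mu.-integrable `[0, a] (EFin \o f) ->
  mu.-integrable setT (EFin \o (f \_ `[0, a])).
Proof. by move=> If; rewrite -restrict_EFin; apply: (iffLR (integrable_mkcond _ _)). Qed.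

Lemma integrable_reflect a f : mu.-integrable `[0, a] (EFin \o f) ->
  mu.-integrable `[0, a] (EFin \o (fun t => f (a - t))).
Proof.
move=> If; apply: (iffRL (integrable_mkcond _ _)) => //; rewrite restrict_EFin.
have := integrable_preserving (@measurable_refl a) (@refl_preserving a) (patch_integrable If).
by apply: eq_integrable => // x _ /=; rewrite -patch_refl.
Qed.

Lemma Rintegral_reflect a f : mu.-integrable `[0, a] (EFin \o f) ->
  \int[mu]_(t in `[0, a]) f (a - t) = \int[mu]_(t in `[0, a]) f t.
Proof.
move=> If; rewrite /Rintegral; congr fine.
rewrite integral_mkcond [RHS]integral_mkcond !restrict_EFin.
rewrite -(integral_preserving (@measurable_refl a) (@refl_preserving a) (patch_integrable If)).
by apply: eq_integral => x _ /=; rewrite -patch_refl.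
Qed.

End Reflection.

Section VectorLaplace.
Context {R : realType} {X : completeNormedModType R}.
Notation mu := (@lebesgue_measure R).
Implicit Types (s t : R) (f : X -> R).

Lemma measurable_functional_pos (g : R -> X) f : contraction_functional f ->
  (forall x, 0 < x -> {for x, continuous g}) -> measurable_fun (`[0, +oo[ : set R) (f \o g).
Proof.
move=> cf cg; apply/measurable_fun_itv_obnd_cbndP.
apply: open_continuous_measurable_fun => // x; rewrite inE/= in_itv/= andbT => x0.
apply: continuous_comp; first exact: cg.
exact: functional_continuous.
Qed.

(** The Laplace integral of a bounded vector function, obtained from its
    truncations, whose distance to the limit is controlled uniformly over functionals. *)
Lemma vector_lap (g : R -> X) (B s : R) : 0 < s -> (forall x : R, 0 < x -> {for x, continuous g}) ->
  (forall x : R, 0 <= x -> `|g x| <= B) ->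
  exists q, forall f, contraction_functional f -> f q = lap (f \o g) s.
Proof.
move=> s0 cg gB.
have B0 : 0 <= B by apply: le_trans (gB 0 (lexx 0)).
have fgB f t : contraction_functional f -> 0 <= t -> `|f (g t)| <= B.
  by move=> [_ fb] t0; apply: (le_trans (fb _)); exact: gB.
have e1 t : 0 <= t -> expR (- s * t) <= 1.
  by move=> t0; rewrite -[leRHS]expR0 ler_expR mulNr oppr_le0 mulr_ge0// ltW.
have Q (n : nat) : exists q, forall f, contraction_functional f ->
    f q = \int[mu]_(t in `[0, n%:R]) (expR (- s * t) * f (g t)).
  have fin : (mu `[0%R, n%:R] < +oo)%E.
    by rewrite /= lebesgue_measure_itv/=; case: ifP => // _; rewrite ltry.
  have IB (u : R -> R) : measurable_fun (`[0, n%:R] : set R) u -> (forall t, 0 <= t -> `|u t| <= B) ->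
      mu.-integrable `[0, n%:R] (EFin \o u).
    move=> mu_ uB; apply: measurable_bounded_integrable => //.
    exists B; split; first by rewrite realE B0.
    move=> y /ltW By x; rewrite /= in_itv/= => /andP[x0 _].
    by apply: le_trans By; exact: uB.
  have [|||||q Hq] := @bochner_exists R X mu `[0, n%:R] (fun t => expR (- s * t) *: g t) (fun=> B) _ _ fin.
  - by [].
  - by move=> x; rewrite /= in_itv/= => /andP[].
  - move=> x x0; apply: cvgZ; last exact: cg.
    apply: continuous_comp; last exact: continuous_expR.
    exact: mulrl_continuous.
  - by apply: IB => // t _; rewrite ger0_norm.
  - move=> x; rewrite /= in_itv/= => /andP[x0 _]; rewrite normrZ ger0_norm ?expR_ge0//.
    by rewrite -[leRHS]mul1r; apply: ler_pM; rewrite ?expR_ge0 ?e1 ?gB.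
  exists q => f cf; rewrite -(bochner_functional _ cf Hq) //.
    by apply: eq_Rintegral => t _; rewrite functionalZ.
  have -> : f \o (fun t : R => expR (- s * t) *: g t) = (fun t => expR (- s * t) * f (g t)).
    by apply/funext => t; rewrite /= functionalZ.
  apply: IB.
    apply: measurable_funM; first exact: measurable_expM.
    apply: measurable_funS (measurable_functional_pos cf cg) => // t.
    by rewrite /= !in_itv/= andbT => /andP[].
  move=> t t0; rewrite normrM ger0_norm ?expR_ge0//.
  by rewrite -[leRHS]mul1r; apply: ler_pM; rewrite ?expR_ge0 ?e1 ?fgB.
pose q n := projT1 (cid (Q n)).
have qE n f (cf : contraction_functional f) := projT2 (cid (Q n)) f cf.
have Iu f : contraction_functional f -> lap_integrable (f \o g) s.
  by move=> cf; apply: (bounded_lap_integrable s0 (measurable_functional_pos cf cg)) => t t0; exact: fgB.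
pose e (n : nat) := expR (- s * n%:R) * (B / s).
have close n f : contraction_functional f -> `|f (q n) - lap (f \o g) s| <= e n.
  move=> cf; rewrite qE// lap_truncation// distrC.
  have [ID LD] := lap_delay (ler0n R n) (lap_integrable_cst B s0).
  rewrite /e -(lap_cst B s0) -LD.
  pose u1 (t : R) := if t <= n%:R then f (g t) else 0.
  have Iu1 : lap_integrable u1 s.
    have := lap_integrable_mul (b := \1_`[0, n%:R]) (M := 1) _ _ (Iu f cf) => H.
    apply: eq_lap_integrable (H _ _) => [t t0|//|t _].
      rewrite indicE /u1 /=; case: (boolP (t <= n%:R)) => tn.
        by rewrite mem_set ?mul1r//= in_itv/= t0.
      by rewrite memNset ?mul0r//= in_itv/= (negbTE tn) andbF.
    by rewrite indicE ger0_norm// lern1 leq_b1.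
  have E t : 0 <= t -> f (g t) + -1 * u1 t = f (g t) - u1 t by move=> _; ring.
  have I2 := lap_integrableD (Iu f cf) (lap_integrableZ (-1) Iu1).
  have -> : lap (f \o g) s - lap u1 s = lap (fun t => f (g t) - u1 t) s.
    rewrite -(eq_lap _ E) (lapD (Iu f cf) (lap_integrableZ (-1) Iu1)) (lapZ _ Iu1); ring.
  apply: lap_norm_le => //; first exact: eq_lap_integrable E I2.
  move=> t t0; rewrite /u1 /delay; case: (leP t n%:R) => tn.
    by rewrite subrr normr0; case: ifP.
  by rewrite subr0 (ltW tn) fgB.
have e0 : e n @[n --> \oo] --> 0.
  rewrite -[X in _ --> X](mul0r (B / s)); apply: cvgM; last exact: cvg_cst.
  under eq_fun do rewrite expRM_natr.
  by apply: cvg_expr; rewrite ger0_norm ?expR_ge0// -[ltRHS]expR0 ltr_expR oppr_lt0.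
have qclose n k : `|q n - q k| <= e n + e k.
  have [f cf <-] := norming_functional (q n - q k); rewrite functionalB//.
  have -> : f (q n) - f (q k) = (f (q n) - lap (f \o g) s) - (f (q k) - lap (f \o g) s) by ring.
  apply: (le_trans (ler_norm _)); apply: (le_trans (ler_normB _ _)).
  by apply: lerD; exact: close.
have : cauchy (q n @[n --> \oo]).
  apply: cauchy_exP => eps eps0; have eps2 : 0 < eps / 2 by rewrite divr_gt0.
  have /(cvgr_lt 0)/(_ _ eps2) H := e0.
  have [k Hk] := filter_ex H.
  exists (q k); apply: filterS H => n Hn; rewrite -ball_normE /=.
  apply: (le_lt_trans (qclose k n)); lra.
move=> /cauchy_cvgP/cvg_ex[q0 qq0].
exists q0 => f cf.
have C1 : f (q n) @[n --> \oo] --> f q0.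
  by apply: continuous_cvg => //; exact: functional_continuous.
have C2 : `|f (q n) - lap (f \o g) s| @[n --> \oo] --> 0.
  apply: (@squeeze_cvgr _ _ _ _ (fun=> 0) e) => //; last exact: cvg_cst.
  by apply: nearW => n; rewrite normr_ge0 close.
by apply: (cvg_unique _ C1) => //; rewrite /=; apply/subr_cvg0; exact: norm_cvg0 C2.
Qed.
End VectorLaplace.

(** * The resolvent of a cosine family *)

Section StrongContinuity.
Context {R : realType} {X : completeNormedModType R}.
Variable S : R -> X -> X.
Hypothesis hS : strongly_continuous_family S.

Lemma family_continuous_pos v (t : R) : 0 < t -> {for t, continuous (S^~ v)}.
Proof.
move=> t0; have [_ _ /(_ v) H] := hS.
by have [H1 _] := (continuous_within_itvcyP _ _).1 H; apply: H1; rewrite in_itv/= andbT.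
Qed.

Lemma family_continuous0 v : S t v @[t --> 0^'+] --> S 0 v.
Proof.
by have [_ _ /(_ v) H] := hS; have [_] := (continuous_within_itvcyP _ _).1 H.
Qed.

End StrongContinuity.

Section CosineFamily.
Context {R : realType} {X : completeNormedModType R}.
Variable C : R -> X -> X.
Hypothesis hC : cosine_family C.
Implicit Types (s t h : R) (u v : X).

Let Clin t : 0 <= t -> forall (a : R) u v, C t (a *: u + v) = a *: C t u + C t v.
Proof. by have [[H _ _] _ _] := hC; exact: H. Qed.

Let cC : strongly_continuous_family C. Proof. by have [] := hC. Qed.

Let strong_continuity_pos v t : 0 < t -> {for t, continuous (C^~ v)}.
Proof. exact: family_continuous_pos. Qed.

Lemma cosine_recursion (d : R) (n : nat) v : 0 <= d ->
  C (n.+2%:R * d) v = 2 *: C (n.+1%:R * d) (C d v) - C (n%:R * d) v.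
Proof.
move=> d0; have [_ _ Ceq] := hC.
have -> : n.+2%:R * d = n.+1%:R * d + d by rewrite -[n.+2]addn1 natrD; ring.
have -> : n%:R * d = n.+1%:R * d - d by rewrite -[n.+1]addn1 natrD; ring.
rewrite -Ceq ?addrK//.
by rewrite -[leLHS]mul1r ler_wpM2r// ler1n.
Qed.

(** Commensurable times commute: C (n d) is a Chebyshev polynomial in C d. *)
Lemma cosine_commute_multiple (B : X -> X) (d : R) (n : nat) v : 0 <= d ->
  (forall (a : R) u v, B (a *: u + v) = a *: B u + B v) -> (forall v, B (C d v) = C d (B v)) ->
  B (C (n%:R * d) v) = C (n%:R * d) (B v).
Proof.
move=> d0 Bl BC; have [_ C0 _] := hC.
suff : (forall v, B (C (n%:R * d) v) = C (n%:R * d) (B v)) /\ (forall v, B (C (n.+1%:R * d) v) = C (n.+1%:R * d) (B v)).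
  by case.
elim: n => [|n [IH1 IH2]].
  by split=> z; rewrite ?mul0r ?mul1r ?C0.
split => // z; rewrite !cosine_recursion// -scaleN1r addrC Bl.
have B0 : B 0 = 0 by have := Bl (-1) 0 0; rewrite scaleN1r addNr => ->; rewrite scaleN1r addNr.
have BZ (a : R) u : B (a *: u) = a *: B u by have := Bl a u 0; rewrite B0 !addr0.
by rewrite BZ IH2 BC IH1 scaleN1r [RHS]addrC.
Qed.

(** s is a limit of multiples of t / (k + 1), and orbits are continuous. *)
Lemma cosine_commute s t v : 0 <= s -> 0 <= t -> C s (C t v) = C t (C s v).
Proof.
move=> s0 t0; have [[_ Cc _] C0 _] := hC.
move: s0; rewrite le_eqVlt => /predU1P[<-|s0]; first by rewrite !C0.
move: t0; rewrite le_eqVlt => /predU1P[<-|t0]; first by rewrite !C0.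
pose d (k : nat) := t / k.+1%:R; pose n k := Num.truncn (s / d k); pose sk k := (n k)%:R * d k.
have d0 k : 0 < d k by rewrite divr_gt0.
have snk k : sk k <= s < sk k + d k.
  have := @truncn_itv R (s / d k); have -> : 0 <= s / d k by rewrite divr_ge0 ?(ltW s0) ?(ltW (d0 k)).
  move=> /(_ isT)/andP[h1 h2]; rewrite /sk -ler_pdivlMr// h1/= -[X in _ + X]mul1r -mulrDl -ltr_pdivrMr//.
  by rewrite natr1.
have dk : d k @[k --> \oo] --> 0.
  by rewrite -[X in _ --> X](mulr0 t); apply: cvgM; [exact: cvg_cst|exact: cvg_harmonic].
have sks : sk k @[k --> \oo] --> s.
  apply/cvgrPdist_lt => e e0.
  have /(cvgr_lt 0)/(_ _ e0) := dk; apply: filterS => k.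
  have /andP[h1 h2] := snk k => de; rewrite ger0_norm; lra.
have com k : C (sk k) (C t v) = C t (C (sk k) v).
  have -> : t = k.+1%:R * d k by rewrite /d mulrC divfK// pnatr_eq0.
  rewrite -(cosine_commute_multiple (d := d k) (B := C (sk k)))//; first exact: ltW.
    by move=> a x y; apply: Clin; rewrite mulr_ge0// ltW.
  move=> x; rewrite /sk (cosine_commute_multiple (d := d k) (B := C (d k)))//; first exact: ltW.
  by apply: Clin; exact: ltW.
have L1 : C (sk k) (C t v) @[k --> \oo] --> C s (C t v).
  exact: (cvg_comp _ _ sks (@strong_continuity_pos (C t v) s s0)).
have L2 : C t (C (sk k) v) @[k --> \oo] --> C t (C s v).
  apply: continuous_cvg; first exact: Cc (ltW t0) _.
  exact: (cvg_comp _ _ sks (@strong_continuity_pos v s s0)).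
have L3 : C (sk k) (C t v) @[k --> \oo] --> C t (C s v) by under eq_fun do rewrite com.
by apply: (cvg_unique _ L1).
Qed.

End CosineFamily.

Section SecondDifference.
Context {R : realType}.
Notation mu := (@lebesgue_measure R).
Implicit Types (s t h e : R).

(** To the left of h the even extension of G is used, as for cosine families. *)
Definition second_difference h (G : R -> R) t := G (t + h) + G `|t - h| - 2 * G t.

(** 2 (cosh (s h) - 1) *)
Definition exp_difference s h := expR (s * h) + expR (- s * h) - 2.
Local Notation kappa := exp_difference.

Section Identity.
Variables (G : R -> R) (B s h : R).
Hypotheses (mG : measurable_fun (`[0, +oo[ : set R) G) (GB : forall t, 0 <= t -> `|G t| <= B).
Hypotheses (s0 : 0 < s) (h0 : 0 <= h).

Let B0 : 0 <= B. Proof. by apply: le_trans (GB (lexx 0)). Qed.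

Let IG : lap_integrable G s.
Proof. exact: bounded_lap_integrable s0 mG GB. Qed.

Let mhalf (p : pred R) (f : R -> R) : measurable_fun (`[0, +oo[ : set R) (fun t : R => p t) -> measurable_fun (`[0, +oo[ : set R) f ->
  measurable_fun (`[0, +oo[ : set R) (fun t => if p t then f t else 0).
Proof. by move=> mp mf; apply: measurable_fun_if => //; apply: measurable_funS mf => // x []. Qed.

Let G1 t := if t <= h then G t else 0.

Let mG1 : measurable_fun (`[0, +oo[ : set R) G1.
Proof. by apply: mhalf => //; exact: measurable_fun_ler. Qed.

Let I1 : lap_integrable G1 s.
Proof.
apply: (bounded_lap_integrable s0 mG1 (B := B)) => t t0; rewrite /G1; case: ifP => // _; first exact: GB.
by rewrite normr0.
Qed.

Let P t := G (t + h).

Let IP : lap_integrable P s.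
Proof.
apply: (@bounded_lap_integrable _ _ B) => //; last by move=> t t0; apply: GB; rewrite addr_ge0.
apply: (measurable_comp _ _ mG) => //; first by move=> _ [t + <-]; rewrite /= !in_itv/= !andbT => t0; rewrite addr_ge0.
by apply: measurable_funTS; exact: measurable_shift.
Qed.

Let lapP : lap P s = expR (s * h) * (lap G s - lap G1 s).
Proof.
have [ID LD] := lap_delay h0 IP.
have I2 := lap_integrableZ (-1) I1.
have -> : lap G s - lap G1 s = lap (delay h P) s.
  have -> : lap G s - lap G1 s = lap (fun t => G t + -1 * G1 t) s.
    by rewrite (lapD IG I2) (lapZ _ I1); ring.
  apply: (lap_ext_off h0 s0 (lap_integrableD IG I2) _).2 => t t0 th.
  rewrite /G1 /delay /P subrK; case: ltgtP th => // ht _; ring.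
by rewrite LD mulrA -expRD mulNr addrN expR0 mul1r.
Qed.

Let r t := if t <= h then G (h - t) else 0.

Let I_exp (a : R) : mu.-integrable `[0, h] (EFin \o (fun t => expR (a * (h - t)) * G t)).
Proof.
have mG' : measurable_fun (`[0, h] : set R) G.
  by apply: measurable_funS mG => // t; rewrite /= !in_itv/= andbT => /andP[].
apply: measurable_bounded_integrable => //.
- by rewrite /= lebesgue_measure_itv/=; case: ifP => // _; rewrite ltry.
- apply: measurable_funM => //; apply: measurable_funTS; apply: continuous_measurable_fun => t.
  apply: continuous_comp; last exact: continuous_expR.
  by apply: cvgM; [exact: cvg_cst|apply: cvgB; [exact: cvg_cst|exact: cvg_id]].
- exists (expR (`|a| * h) * B); split; first by rewrite realE mulr_ge0 ?expR_ge0 ?B0.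
  move=> y /ltW By t; rewrite /= in_itv/= => /andP[t0 th]; apply: le_trans By.
  rewrite normrM ger0_norm ?expR_ge0//; apply: ler_pM; rewrite ?expR_ge0 ?GB//.
  rewrite ler_expR; apply: (@le_trans _ _ (`|a| * (h - t))).
    by rewrite ler_wpM2r ?subr_ge0// ler_norm.
  by rewrite ler_wpM2l// lerBlDr lerDl.
Qed.

Let mr : measurable_fun (`[0, +oo[ : set R) r.
Proof.
have m : measurable_fun (`[0, h] : set R) (fun t => G (h - t)).
  apply: (measurable_comp _ _ mG) => //.
    by move=> _ [t + <-]; rewrite /= !in_itv/= andbT => /andP[t0 th]; rewrite subr_ge0.
  by apply: measurable_funB.
apply: (@eq_measurable_fun _ _ _ _ _ ((fun t => G (h - t)) \_ `[0, h])).
  move=> t; rewrite inE/= in_itv/= andbT => t0; rewrite /patch mem_setE in_itv/= t0/= /r.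
  by case: ifP.
by apply: measurable_funTS; exact: (measurable_restrictT _ _).1.
Qed.

Let Ir : lap_integrable r s.
Proof.
apply: (bounded_lap_integrable s0 mr (B := B)) => t t0; rewrite /r; case: ifPn => [th|_].
  by apply: GB; rewrite subr_ge0.
by rewrite normr0.
Qed.

Let lapr : lap r s = \int[mu]_(t in `[0, h]) (expR (- s * (h - t)) * G t).
Proof.
rewrite -(Rintegral_reflect (I_exp (- s))) /r -lap_truncation//.
by apply: eq_Rintegral => t _; congr (expR _ * _); ring.
Qed.

Let lapG1 : expR (s * h) * lap G1 s = \int[mu]_(t in `[0, h]) (expR (s * (h - t)) * G t).
Proof.
rewrite /G1 -lap_truncation// -RintegralZl//.
  by apply: eq_Rintegral => t _; rewrite mulrA -expRD; congr (expR _ * _); ring.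
have := integrable_scale (expR (- s * h)) _ (I_exp s) => /(_ (measurable_itv _)).
by apply: eq_integrable => // t _ /=; rewrite mulrA -expRD; congr (expR _ * _)%:E; ring.
Qed.

(** G (t + h) is a translate of G, and G |t - h| is the delay of G by h plus, on [0, h],
    a reflection. This reflection and the part of G lost by translation make up the
    integral over [0, h]. *)
Lemma lap_second_difference : lap_integrable (second_difference h G) s /\
  lap (second_difference h G) s = kappa s h * lap G s
    - \int[mu]_(t in `[0, h]) ((expR (s * (h - t)) - expR (- s * (h - t))) * G t).
Proof.
have [ID LD] := lap_delay h0 IG.
have I0 := lap_integrableD (lap_integrableD IP (lap_integrableD ID Ir)) (lap_integrableZ (-2) IG).
have E t : 0 <= t -> t != h -> P t + (delay h G t + r t) + -2 * G t = second_difference h G t.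
  move=> t0 th; rewrite /P /delay /r /second_difference.
  case: ltgtP th => // ht _.
    by rewrite gtr0_norm ?subr_gt0//; ring.
  by rewrite ltr0_norm ?subr_lt0// opprB; ring.
have [I2 <-] := lap_ext_off h0 s0 I0 E; split => //.
rewrite (lapD (lap_integrableD IP (lap_integrableD ID Ir)) (lap_integrableZ (-2) IG)) (lapZ _ IG).
rewrite (lapD IP (lap_integrableD ID Ir)) (lapD ID Ir) LD lapP lapr.
have -> : \int[mu]_(t in `[0, h]) ((expR (s * (h - t)) - expR (- s * (h - t))) * G t) =
    expR (s * h) * lap G1 s - \int[mu]_(t in `[0, h]) (expR (- s * (h - t)) * G t).
  rewrite lapG1 -RintegralB//.
  by apply: eq_Rintegral => t _; rewrite mulrBl.
by rewrite /exp_difference; ring.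
Qed.

End Identity.

(** The identity above for the constant function 1. *)
Lemma integral_kernel s h : 0 < s -> 0 <= h ->
  \int[mu]_(t in `[0, h]) (expR (s * (h - t)) - expR (- s * (h - t))) = kappa s h / s.
Proof.
move=> s0 h0.
have [||_] := @lap_second_difference (fun=> 1) 1 s h _ _ s0 h0 => //.
  by move=> t _; rewrite normr1.
rewrite (@eq_lap _ _ (fun=> 0)); last by move=> t _; rewrite /second_difference; ring.
rewrite !lap_cst// mul0r mul1r => /eqP; rewrite eq_sym subr_eq0 => /eqP ->.
by apply: eq_Rintegral => t _; rewrite mulr1.
Qed.

Lemma lap_second_difference_bound (G : R -> R) (B s h e : R) : measurable_fun (`[0, +oo[ : set R) G ->
  (forall t, 0 <= t -> `|G t| <= B) -> 0 < s -> 0 <= h -> (forall t, 0 <= t <= h -> `|G t| <= e) ->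
  `|lap (second_difference h G) s - kappa s h * lap G s| <= e * (kappa s h / s).
Proof.
move=> mG GB s0 h0 Ge.
have [_ ->] := lap_second_difference mG GB s0 h0.
rewrite addrAC subrr add0r normrN -integral_kernel//.
pose K t := expR (s * (h - t)) - expR (- s * (h - t)).
have cK : continuous K.
  have c1 (a : R) : continuous (fun t => expR (a * (h - t))).
    move=> t; apply: continuous_comp; last exact: continuous_expR.
    by apply: cvgM; [exact: cvg_cst|apply: cvgB; [exact: cvg_cst|exact: cvg_id]].
  by move=> t; apply: cvgB; exact: c1.
have K0 t : 0 <= t <= h -> 0 <= K t.
  move=> /andP[t0 th]; rewrite /K subr_ge0 ler_expR mulNr ge0_cp//.
  by rewrite mulr_ge0 ?subr_ge0// ltW.
have IK : mu.-integrable `[0, h] (EFin \o K).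
  by apply: continuous_compact_integrable; [exact: segment_compact|exact: continuous_subspaceT].
have mG' : measurable_fun (`[0, h] : set R) G.
  by apply: measurable_funS mG => // t; rewrite /= !in_itv/= andbT => /andP[].
have KG t : `[0, h]%classic t -> `|K t * G t| <= e * K t.
  rewrite /= in_itv/= => th; rewrite normrM (ger0_norm (K0 t th)) mulrC ler_wpM2r ?K0 ?Ge//.
have IKG : mu.-integrable `[0, h] (EFin \o (fun t => K t * G t)).
  apply: (@dominated_integrable _ _ _ mu _ _ (fun t => e * K t)) => //; last exact: integrable_scale.
  by apply: measurable_funM => //; exact: integrable_measurable IK.
apply: (le_trans (le_normr_Rintegral _ IKG)) => //.
rewrite -RintegralZl//; apply: (le_Rintegral _ (integrable_norm IKG) (integrable_scale e _ IK) KG) => //.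
Qed.

(** kappa s h is the square of e^(s h / 2) - e^(- s h / 2). *)
Lemma kernel_curvature s : kappa s h / h ^+ 2 @[h --> 0^'+] --> s ^+ 2.
Proof.
pose phi x := expR (x * (s / 2)) - expR (x * - (s / 2)).
have D : is_derive (0 : R) 1 phi s.
  have := is_deriveB (is_derive_expRM (s / 2) 0) (is_derive_expRM (- (s / 2)) 0).
  by congr is_derive; rewrite !mul0r expR0; field.
have cphi : h^-1 * phi h @[h --> 0^'+] --> s.
  have [D1 D2] := D.
  have H : h^-1 *: (phi (h *: 1 + 0) - phi 0) @[h --> 0^'] --> 'D_1 phi 0 by exact: D1.
  rewrite D2 in H; have := cvg_dnbhs_at_right H.
  apply: cvg_trans; apply: near_eq_cvg; apply: nearW => h.
  by rewrite /GRing.scale/= mulr1 addr0 /phi !mul0r subrr subr0.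
have E h : kappa s h / h ^+ 2 = (h^-1 * phi h) * (h^-1 * phi h).
  have -> : kappa s h = phi h ^+ 2.
    rewrite /kappa /phi sqrrB -!expRM_natr -expRD mulrN addrN expR0.
    have -> : h * (s / 2) * 2 = s * h by field.
    have -> : - (h * (s / 2)) * 2 = - s * h by field.
    by rewrite /exp_difference; ring.
  by rewrite expr2 invfM; ring.
under eq_fun do rewrite E; rewrite expr2; by apply: cvgM.
Qed.

End SecondDifference.

Section Resolvent.
Context {R : realType} {X : completeNormedModType R}.
Variables (D : set X) (A : X -> X) (C : R -> X -> X).
Hypotheses (hC : generates_cosine D A C) (hb : bounded_family C).
Implicit Types (s t h : R) (u v : X) (f : X -> R).

Let cos : cosine_family C. Proof. by have [] := hC. Qed.

Lemma bounded_family_ge1 (S : R -> X -> X) : bounded_family S ->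
  exists2 M : R, 1 <= M & forall t v, 0 <= t -> `|S t v| <= M * `|v|.
Proof.
move=> [M HM]; exists (Num.max 1 M); first by rewrite le_max lexx.
by move=> t v t0; apply: (le_trans (HM t v t0)); rewrite ler_wpM2r// le_max lexx orbT.
Qed.

(** The value q below is known through functionals only; testing it against this one
    gives access to C h q. *)
Lemma functional_comp_cosine (f : X -> R) (M h : R) : contraction_functional f -> 1 <= M -> 0 <= h ->
  (forall v, `|C h v| <= M * `|v|) -> contraction_functional (fun v => M^-1 * f (C h v)).
Proof.
move=> cf M1 h0 CM; have M0 : 0 < M by apply: lt_le_trans M1.
have [[Cl _ _] _ _] := cos; split.
  by move=> a u v; rewrite Cl// (functionalD cf) (functionalZ cf); ring.
move=> v; rewrite normrM ger0_norm ?invr_ge0 ?(ltW M0)// ler_pdivrMl//.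
by have [_ fb] := cf; apply: (le_trans (fb _)).
Qed.

(** q is the resolvent value s (s^2 - A)^-1 v = int_0^oo e^(-s tau) C(tau) v dtau.
    The cosine equation turns 2 (C(h) - 1) q into the second difference of the
    orbit, whose transform is 2 (cosh (s h) - 1) (q - v / s) up to o(h^2). *)
Lemma cosine_resolvent v s : 0 < s -> exists q,
  [/\ forall f, contraction_functional f -> f q = lap (fun t => f (C t v)) s,
      D q & A q = s ^+ 2 *: q - s *: v].
Proof.
move=> s0; have [M M1 CM] := bounded_family_ge1 hb.
have M0 : 0 < M by apply: lt_le_trans M1.
have [[Cl Cc _] C0 Ceq] := cos.
have cg (t : R) : 0 < t -> {for t, continuous (C^~ v)} by apply: family_continuous_pos; have [] := cos.
have gB (t : R) : 0 <= t -> `|C t v| <= M * `|v| by exact: CM.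
have [q qE] := vector_lap s0 cg gB.
exists q; suff [Dq Aq] : D q /\ A q = s ^+ 2 *: q - s *: v by split.
have [_ /(_ q (s ^+ 2 *: q - s *: v)) gen] := hC; apply/gen => {gen}.
pose N := q - s^-1 *: v.
pose kappa h := exp_difference s h.
pose z h := 2 *: (C h q - q) - kappa h *: N.
have zb h e : 0 < h -> (forall t, 0 <= t <= h -> `|C t v - v| <= e) -> `|z h| <= e * (kappa h / s).
  move=> h0 Ce; have [f cf <-] := norming_functional (z h).
  pose F t := f (C t v); pose G t := F t - f v.
  have mF : measurable_fun (`[0, +oo[ : set R) F by exact: (measurable_functional_pos cf cg).
  have fb u : `|f u| <= `|u| by have [_] := cf; apply.
  have FB t : 0 <= t -> `|F t| <= M * `|v| by move=> t0; apply: (le_trans (fb _)); exact: CM.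
  have mG : measurable_fun (`[0, +oo[ : set R) G by exact: measurable_funB.
  have GB t : 0 <= t -> `|G t| <= M * `|v| + `|v|.
    by move=> t0; apply: (le_trans (ler_normB _ _)); rewrite lerD ?FB ?fb.
  have Ge t : 0 <= t <= h -> `|G t| <= e.
    by move=> th; rewrite /G /F -functionalB//; apply: (le_trans (fb _)); exact: Ce.
  have IF := bounded_lap_integrable s0 mF FB.
  have LF : lap F s = f q by rewrite qE.
  have LG : lap G s = f N.
    have E t : 0 <= t -> F t + - f v = G t by [].
    rewrite -(eq_lap _ E) (lapD IF (lap_integrable_cst _ s0)) lap_cst// LF.
    by rewrite /N (functionalB cf) (functionalZ cf); ring.
  have [IS _] := lap_second_difference mF FB s0 (ltW h0).
  have E1 : 2 * f (C h q) - 2 * f q = lap (second_difference h F) s.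
    have cfh := functional_comp_cosine cf M1 (ltW h0) (fun u => CM h u (ltW h0)).
    have := qE _ cfh => /(congr1 (fun x => 2 * M * x)).
    have -> : 2 * M * (M^-1 * f (C h q)) = 2 * f (C h q) by field; rewrite gt_eqF.
    move=> ->.
    have E t : 0 <= t -> (2 * M)^-1 * (second_difference h F t + 2 * F t) = M^-1 * f (C h (C t v)).
      move=> t0; have E2 : F (t + h) + F `|t - h| = 2 * f (C h (C t v)).
        rewrite /F -(functionalD cf) -(functionalZ cf); congr f.
        have [ht|th] := leP h t.
          by rewrite ger0_norm ?subr_ge0// Ceq ?(ltW h0)// (cosine_commute cos) ?(ltW h0).
        rewrite ltr0_norm ?subr_lt0// opprB addrC.
        by rewrite [t + h]addrC addrC Ceq// ltW.
      rewrite /second_difference subrK E2; field; rewrite gt_eqF//.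
    rewrite -(eq_lap _ E) lapZ; last exact: lap_integrableD IS (lap_integrableZ 2 IF).
    rewrite (lapD IS (lap_integrableZ 2 IF)) (lapZ _ IF) LF mulrA divff ?mulf_neq0 ?gt_eqF//.
    by ring.
  have E2 : f (z h) = lap (second_difference h G) s - kappa h * lap G s.
    rewrite LG /z (functionalB cf) !(functionalZ cf) (functionalB cf) mulrBr E1; congr (_ - _).
    by apply: eq_lap => t _; rewrite /second_difference /G; ring.
  rewrite E2; apply: (le_trans (ler_norm _)).
  exact: (lap_second_difference_bound mG GB s0 (ltW h0) Ge).
have K := @kernel_curvature R s.
apply/cvgrPdist_le => eta eta0.
pose e := eta * s / (2 * (s ^+ 2 + 1)).
have s20 : 0 < s ^+ 2 by rewrite exprn_gt0.
have e0 : 0 < e by rewrite divr_gt0 ?mulr_gt0// addr_gt0.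
have sC : strongly_continuous_family C by have [] := cos.
have := @family_continuous0 _ _ _ sC v; rewrite C0 => /cvgrPdist_le/(_ _ e0)[d /= d0 Hd].
near=> h.
have h0 : 0 < h by [].
have h20 : 0 < h ^+ 2 by rewrite exprn_gt0.
have zh : `|z h| <= e * (kappa h / s).
  apply: zb => // t /andP[]; rewrite le_eqVlt => /predU1P[<-|t0] th.
    by rewrite C0 subrr normr0 ltW.
  rewrite distrC; apply: Hd => //=; rewrite sub0r normrN gtr0_norm//.
  by apply: (le_lt_trans th); near: h; exact: nbhs_right_lt.
have k1 : kappa h / h ^+ 2 <= s ^+ 2 + 1.
  near: h; apply: (cvgr_le (s ^+ 2)) => //; first by rewrite ltrDl.
have k2 : `|s ^+ 2 - kappa h / h ^+ 2| <= eta / (2 * (`|N| + 1)).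
  by near: h; apply: cvgr_dist_le => //; rewrite divr_gt0// mulr_gt0// ltr_wpDl.
have -> : s ^+ 2 *: q - s *: v - (2 / h ^+ 2) *: (C h q - q) =
    (s ^+ 2 - kappa h / h ^+ 2) *: N - (h ^+ 2)^-1 *: z h.
  have N1 : s ^+ 2 *: N = s ^+ 2 *: q - s *: v.
    by rewrite /N scalerBr scalerA expr2 mulfK ?gt_eqF.
  have z1 : (h ^+ 2)^-1 *: z h = (2 / h ^+ 2) *: (C h q - q) - (kappa h / h ^+ 2) *: N.
    by rewrite /z [LHS]scalerBr !scalerA [_ * 2]mulrC [_ * kappa h]mulrC.
  by rewrite z1 -N1 scalerBl opprB addrA subrK.
apply: (le_trans (ler_normB _ _)); rewrite !normrZ.
have A1 : `|s ^+ 2 - kappa h / h ^+ 2| * `|N| <= eta / 2.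
  apply: (@le_trans _ _ (eta / (2 * (`|N| + 1)) * (`|N| + 1))).
    by apply: ler_pM => //; rewrite lerDl.
  by rewrite invfM mulrA divfK// gt_eqF// ltr_wpDl.
have A2 : `|(h ^+ 2)^-1| * `|z h| <= eta / 2.
  rewrite ger0_norm ?invr_ge0 ?(ltW h20)//.
  apply: (@le_trans _ _ ((h ^+ 2)^-1 * (e * (kappa h / s)))).
    by rewrite ler_wpM2l ?invr_ge0 ?(ltW h20).
  have -> : (h ^+ 2)^-1 * (e * (kappa h / s)) = e / s * (kappa h / h ^+ 2) by ring.
  apply: (@le_trans _ _ (e / s * (s ^+ 2 + 1))).
    by apply: ler_wpM2l k1; exact/ltW/divr_gt0.
  rewrite le_eqVlt; apply/orP; left; apply/eqP; rewrite /e; field.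
  by rewrite !gt_eqF// addr_gt0.
lra.
Unshelve. all: by end_near. Qed.

End Resolvent.

(** * The transform of the solution operator *)

Section SolutionTransform.
Context {R : realType} {X : completeNormedModType R}.
Notation mu := (@lebesgue_measure R).
Variables (D : set X) (A : X -> X) (C S : R -> X -> X) (k : R -> R).
Hypotheses (hC : generates_cosine D A C) (Cb : bounded_family C).
Hypotheses (hS : solution_operator k D A S) (Sb : bounded_family S).
Implicit Types (s t : R) (v z : X) (f : X -> R).

Lemma functional_orbit_measurable (U : R -> X -> X) f v : strongly_continuous_family U -> contraction_functional f ->
  measurable_fun (`[0, +oo[ : set R) (fun t => f (U t v)).
Proof.
by move=> hU cf; apply: (measurable_functional_pos cf (g := U^~ v)) => t; exact: family_continuous_pos.
Qed.

Lemma functional_orbit_lap_integrable (U : R -> X -> X) f v s : strongly_continuous_family U -> bounded_family U ->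
  contraction_functional f -> 0 < s -> lap_integrable (fun t => f (U t v)) s.
Proof.
move=> hU [M UM] cf s0.
apply: (bounded_lap_integrable (B := M * `|v|) s0 (functional_orbit_measurable v hU cf)) => t t0.
by have [_ fb] := cf; apply: (le_trans (fb _)); exact: UM.
Qed.

Section AtPoint.
Variables (s l : R) (f : X -> R).
Hypotheses (s0 : 0 < s) (l0 : 0 < l) (Ik : lap_integrable k s) (Lk : lap k s = (l ^+ 2)^-1).
Hypothesis cf : contraction_functional f.

Let sS : strongly_continuous_family S. Proof. by have [] := hS. Qed.
Let IS v := functional_orbit_lap_integrable v sS Sb cf s0.

Let Ik0 t : 0 <= t -> mu.-integrable `[0, t] (EFin \o k).
Proof.
move=> t0; have I1 : mu.-integrable `[0, t] (EFin \o (fun x => expR (- s * x) * k x)).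
  by apply: integrableS Ik => // x; rewrite /= !in_itv/= andbT => /andP[].
have := @integrable_mul_bounded _ _ _ mu `[0, t] (fun x => expR (- (- s) * x)) _ (expR (s * t)) _ _ _ I1 => H.
apply: eq_integrable (H _ _ _) => //.
- by move=> x _ /=; rewrite mulrA -expRD -mulrDl addNr mul0r expR0 mul1r.
- exact: measurable_expM.
- move=> x; rewrite /= in_itv/= => /andP[x0 xt].
  by rewrite ger0_norm ?expR_ge0// opprK ler_expR ler_wpM2l// ltW.
Qed.

Let volterra z t : D z -> 0 <= t -> f (S t z) = f z + conv k (fun x => f (S x (A z))) t.
Proof.
move=> Dz t0; have [_ _ SA HV] := hS; have [M SM] := Sb.
have H := HV t z t0 Dz.
have E x : `[0, t]%classic x -> f (k (t - x) *: A (S x z)) = k (t - x) * f (S x (A z)).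
  rewrite /= in_itv/= => /andP[x0 _].
  by rewrite (functionalZ cf); have [_ ->] := SA x z x0 Dz.
have Ifk : mu.-integrable `[0, t] (EFin \o (fun x => k (t - x) * f (S x (A z)))).
  have mU : measurable_fun (`[0, t] : set R) (fun x => f (S x (A z))).
    apply: measurable_funS (functional_orbit_measurable (A z) sS cf) => // x.
    by rewrite /= !in_itv/= andbT => /andP[].
  have Irk : mu.-integrable `[0, t] (EFin \o (fun x : R => k (t - x))) by apply: integrable_reflect; exact: Ik0.
  have H1 : mu.-integrable `[0, t] (EFin \o (fun x : R => f (S x (A z)) * k (t - x))).
    apply: (integrable_mul_bounded (M := M * `|A z|)) => // x; rewrite /= in_itv/= => /andP[x0 _].
    by have [_ fb] := cf; apply: (le_trans (fb _)); exact: SM.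
  by apply: eq_integrable H1 => // x _ /=; rewrite mulrC.
have Ig : mu.-integrable `[0, t] (EFin \o (f \o (fun x : R => k (t - x) *: A (S x z)))).
  by apply: eq_integrable Ifk => // x; rewrite inE => xt /=; rewrite -E.
have EQ : \int[mu]_(x in `[0, t]) f (k (t - x) *: A (S x z)) = f (S t z - z).
  by apply: (bochner_functional _ cf H Ig).
rewrite (functionalB cf) in EQ.
have -> : conv k (fun x => f (S x (A z))) t = f (S t z) - f z.
  by rewrite -EQ; apply: eq_Rintegral => x; rewrite inE => xt; rewrite -E.
by rewrite addrC subrK.
Qed.

Let lap_volterra z : D z -> lap (fun t => f (S t z)) s = f z / s + (l ^+ 2)^-1 * lap (fun t => f (S t (A z))) s.
Proof.
move=> Dz; have [Ic Lc] := lap_conv Ik (IS (A z)).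
rewrite -Lk -Lc -(lap_cst (f z) s0) -(lapD (lap_integrable_cst _ s0) Ic).
by apply: eq_lap => t t0; rewrite volterra.
Qed.

(** Apply the transformed Volterra equation to the resolvent value q of v, for
    which A q = l^2 q - l v: the terms in q cancel. *)
Lemma solution_transform v :
  lap (fun t => f (S t v)) s = l / s * lap (fun t => f (C t v)) l.
Proof.
have [q [qE Dq Aq]] := cosine_resolvent hC Cb v l0.
have [Sl _ _] := sS.
rewrite -qE//; have := lap_volterra Dq; rewrite Aq.
have E t : 0 <= t -> l ^+ 2 * f (S t q) + - l * f (S t v) = f (S t (l ^+ 2 *: q - l *: v)).
  move=> t0; rewrite -scaleNr Sl// (functionalD cf) (functionalZ cf); congr (_ + _).
  have := Sl t t0 (- l) v 0; rewrite addr0 => ->.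
  have -> : S t 0 = 0 by have := Sl t t0 (-1) 0 0; rewrite scaleN1r addNr => ->; rewrite scaleN1r addNr.
  by rewrite addr0 (functionalZ cf).
rewrite -(eq_lap _ E) (lapD (lap_integrableZ _ (IS q)) (lap_integrableZ _ (IS v))) !lapZ//.
move=> H; have l20 : l != 0 by rewrite gt_eqF.
have s00 : s != 0 by rewrite gt_eqF.
have : f q / s = l^-1 * lap (fun t => f (S t v)) s.
  move: H; rewrite mulrDr mulrA mulVf ?expf_neq0// mul1r.
  have -> : (l ^+ 2)^-1 * (- l * lap (fun t => f (S t v)) s) = - (l^-1 * lap (fun t => f (S t v)) s) by field.
  lra.
move=> H1; have -> : l / s * f q = l * (f q / s) by field.
by rewrite H1 mulrA divff// mul1r.
Qed.

End AtPoint.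
End SolutionTransform.

Section Steps.
Context {R : realType}.
Implicit Types (F : R -> R) (t x y : R) (n i : nat).

Definition grid n i : R := i%:R / n.+1%:R.
(** (n + 1)^2 cells of length 1 / (n + 1), so that the mesh decreases while the range
    [0, n + 1[ grows. *)
Definition step F n x : R := \sum_(i < n.+1 ^ 2) F (grid n i) * \1_(`[grid n i, grid n i.+1[) x.

Lemma grid_ge0 n i : 0 <= grid n i. Proof. by rewrite /grid divr_ge0. Qed.

Lemma grid_le n i : grid n i <= grid n i.+1.
Proof. by rewrite /grid ler_pM2r ?invr_gt0// ler_nat. Qed.

Lemma stepE F n x : 0 <= x -> step F n x =
  if (Num.truncn (x * n.+1%:R) < n.+1 ^ 2)%N then F (grid n (Num.truncn (x * n.+1%:R))) else 0.
Proof.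
move=> x0; have H i : \1_(`[grid n i, grid n i.+1[) x = (Num.truncn (x * n.+1%:R) == i)%:R :> R.
  rewrite indicE; congr (nat_of_bool _)%:R.
  rewrite mem_setE in_itv/= truncn_eq; last exact: mulr_ge0.
  by rewrite /grid ler_pdivrMr// ltr_pdivlMr.
rewrite /step; under eq_bigr => i _ do rewrite H.
case: ifPn => [h|h].
  rewrite (bigD1 (Ordinal h))//= eqxx mulr1 big1 ?addr0// => i ih.
  by case: eqP => [e|_]; [rewrite -val_eqE/= e eqxx in ih|rewrite mulr0].
rewrite big1// => i _; case: eqP => [e|_]; last by rewrite mulr0.
by rewrite e ltn_ord in h.
Qed.

Lemma grid_truncn n x : 0 <= x -> grid n (Num.truncn (x * n.+1%:R)) <= x < grid n (Num.truncn (x * n.+1%:R)) + n.+1%:R^-1.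
Proof.
move=> x0; have := @truncn_itv R (x * n.+1%:R); rewrite mulr_ge0// => /(_ isT)/andP[h1 h2].
rewrite /grid ler_pdivrMr// h1/= -[X in _ + X]mul1r -mulrDl ltr_pdivlMr//.
by rewrite natr1.
Qed.

Lemma step_bound F n x (B : R) : (forall t, 0 <= t -> `|F t| <= B) -> 0 <= x -> `|step F n x| <= B.
Proof.
move=> FB x0; rewrite stepE//; case: ifP => _; first by apply: FB; exact: grid_ge0.
by rewrite normr0; apply: le_trans (FB 0 (lexx 0)).
Qed.

Lemma measurable_step F n (D : set R) : measurable_fun D (step F n).
Proof.
by apply: measurable_sum => i; apply: measurable_funM.
Qed.

Let in_range n x : 0 <= x -> x < n.+1%:R -> (Num.truncn (x * n.+1%:R) < n.+1 ^ 2)%N.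
Proof.
move=> x0 xn; rewrite -(ltr_nat R); have := @truncn_itv R (x * n.+1%:R).
rewrite mulr_ge0// => /(_ isT)/andP[h1 _]; apply: (le_lt_trans h1).
by rewrite natrX expr2 ltr_pM2r.
Qed.

Lemma step_uniform F (T : R) : 0 <= T -> (forall x, 0 <= x <= T -> {for x, continuous F}) ->
  forall e : R, 0 < e -> \forall n \near \oo, forall x, 0 <= x <= T -> `|F x - step F n x| <= e.
Proof.
move=> T0 cF e e0; have [d d0 Hd] := segment_uniformly_continuous cF e0.
near=> n; move=> x xT; have /andP[x0 xT'] := xT.
have xn : x < n.+1%:R.
  apply: (le_lt_trans xT'); apply: (@lt_trans _ _ n%:R); last by rewrite ltr_nat.
  near: n; exact: nbhs_infty_gtr.
rewrite stepE// in_range//; apply: Hd => //.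
have /andP[h1 h2] := grid_truncn n x0; rewrite ger0_norm ?subr_ge0//.
have h3 : n.+1%:R^-1 < d :> R.
  by near: n; have := @cvg_harmonic R => /cvgr_lt; apply.
have ab (p q r z : R) : p <= z -> z < p + q -> q < r -> z - p < r by lra.
exact: ab h1 h2 h3.
Unshelve. all: by end_near. Qed.

Lemma step_cvg F x : 0 <= x -> (forall y, 0 <= y -> {for y, continuous F}) ->
  step F n x @[n --> \oo] --> F x.
Proof.
move=> x0 cF; apply/cvgrPdist_le => e e0.
have H : forall y, 0 <= y <= x -> {for y, continuous F} by move=> y /andP[y0 _]; exact: cF.
by apply: filterS (step_uniform x0 H e0) => n; apply; rewrite x0 lexx.
Qed.

Lemma lap_sum (n : nat) (u : nat -> R -> R) s : (forall i, lap_integrable (u i) s) ->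
  lap_integrable (fun t => \sum_(i < n) u i t) s /\
  lap (fun t => \sum_(i < n) u i t) s = \sum_(i < n) lap (u i) s.
Proof.
move=> Iu; split.
  have := integrable_sumr (index_enum 'I_n) _ (fun i : 'I_n => Iu i) => /(_ (measurable_itv _)).
  by apply: eq_integrable => // t _ /=; rewrite mulr_sumr.
rewrite /lap -Rintegral_sum//; last by move=> i; exact: Iu.
by apply: eq_Rintegral => t _; rewrite mulr_sumr.
Qed.

Lemma lap_interval x y s : 0 < s -> 0 <= x -> x <= y ->
  lap_integrable (\1_(`[x, y[)) s /\ lap (\1_(`[x, y[)) s = (expR (- (x * s)) - expR (- (y * s))) / s.
Proof.
move=> s0 x0 xy; have I1 := lap_integrable_cst 1 s0.
have [Ix Lx] := lap_delay x0 I1; have [Iy Ly] := lap_delay (le_trans x0 xy) I1.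
have E t : 0 <= t -> delay x (fun=> 1) t + -1 * delay y (fun=> 1) t = \1_(`[x, y[) t.
  move=> _; rewrite indicE mem_setE in_itv/= /delay.
  by case: (leP y t) => yt; [rewrite (le_trans xy yt)/=; ring|case: ifP => _ /=; ring].
split; first exact: eq_lap_integrable E (lap_integrableD Ix (lap_integrableZ (-1) Iy)).
rewrite -(eq_lap _ E) (lapD Ix (lap_integrableZ (-1) Iy)) (lapZ _ Iy) Lx Ly lap_cst//.
by rewrite !mulNr ![s * _]mulrC; ring.
Qed.

End Steps.

(** * Subordination of scalar functions *)

Section Subordination.
Context {R : realType} {X : completeNormedModType R} (m : nat) (c : R) (cs al : 'I_m -> R).
Hypothesis hal : forall j : 'I_m, 1 <= al j < 2.
Hypothesis hc : 0 < c.
Hypothesis hcs : forall j : 'I_m, 0 < cs j.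
Variable w : R -> R -> R.
Hypothesis hw : propagation_function c cs al w.
Notation mu := (@lebesgue_measure R).
Notation T := (measurableTypeR R).
Implicit Types (x y t s : R) (v : X).
Local Notation lam := (symbol_sqrt c cs al).
Local Notation W := (propagation_extension w).
Local Notation pos := (`[0, +oo[%classic : set T).
Variable phi : R -> probability T R.
Hypothesis Hphi : forall t, 0 < t ->
  [/\ forall a b : R, 0 <= a -> a <= b -> phi t `[a, b[%classic = (W a t - W b t)%:E,
      phi t pos = 1%E
    & phi t `](t / Num.sqrt c), +oo[%classic = 0%E].

Lemma bounded_phi_integrable t (B : R) (u : R -> R) : 0 <= B -> measurable_fun (`[0, +oo[ : set R) u ->
  (forall x, 0 <= x -> `|u x| <= B) -> (phi t).-integrable pos (EFin \o u).
Proof.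
move=> B0 mu_ uB; apply: measurable_bounded_integrable => //.
  by apply: le_lt_trans (probability_le1 _ _) _ => //; rewrite ltry.
exists B; split; first by rewrite realE B0.
move=> y /ltW By x; rewrite /= in_itv/= andbT => x0; apply: le_trans By; exact: uB.
Qed.

Section Scalar.
Variables (F : R -> R) (B : R).
Hypotheses (mF : measurable_fun (`[0, +oo[ : set R) F) (FB : forall x, 0 <= x -> `|F x| <= B).
Hypothesis cF : forall x, 0 <= x -> {for x, continuous F}.

Let B0 : 0 <= B. Proof. by apply: le_trans (FB (lexx 0)). Qed.

Definition subordinate (F : R -> R) t := \int[phi t]_(x in pos) F x.

(** Written in terms of W rather than of phi t: in this form the transform in t is a
    finite sum of known ones. *)
Definition step_subordinate (F : R -> R) n t : R :=
  \sum_(i < n.+1 ^ 2) F (grid n i) * (W (grid n i) t - W (grid n i.+1) t).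

Let IF t : (phi t).-integrable pos (EFin \o F).
Proof. exact: bounded_phi_integrable B0 mF FB. Qed.

Let Istep t n : (phi t).-integrable pos (EFin \o step F n).
Proof.
apply: (bounded_phi_integrable _ B0); first exact: measurable_step.
by move=> x x0; apply: step_bound.
Qed.

Lemma step_subordinateE n t : 0 < t -> \int[phi t]_(x in pos) step F n x = step_subordinate F n t.
Proof.
move=> t0; have [ab _ _] := Hphi t0.
have I1 i : (phi t).-integrable pos (EFin \o \1_(`[grid n i, grid n i.+1[)).
  apply: (bounded_phi_integrable _ ler01); first exact: measurable_indic.
  by move=> x _; rewrite indicE ger0_norm// lern1 leq_b1.
rewrite /step Rintegral_sum//; last by move=> i; apply: integrable_scale => //; exact: I1.
rewrite /step_subordinate; apply: eq_bigr => i _; rewrite RintegralZl//; congr (_ * _); rewrite /Rintegral integral_indic//.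
have -> : `[grid n i, grid n i.+1[ `&` pos = `[grid n i, grid n i.+1[%classic.
  apply/seteqP; split => x; first by move=> [].
  move=> xg; split => //; move: xg; rewrite /= !in_itv/= andbT => /andP[gx _].
  exact: le_trans (grid_ge0 _ _) gx.
transitivity (fine (W (grid n i) t - W (grid n i.+1) t)%:E) => //; congr fine.
by apply: ab; [exact: grid_ge0|exact: grid_le].
Qed.

Lemma step_subordinate_bound n t : 0 < t -> `|step_subordinate F n t| <= B.
Proof.
move=> t0; rewrite -step_subordinateE//; have [_ P1 _] := Hphi t0.
have IB : (phi t).-integrable pos (EFin \o (fun=> B)).
  by apply: (bounded_phi_integrable _ B0) => // x _; rewrite ger0_norm.
apply: (le_trans (le_normr_Rintegral _ (Istep t n))) => //.
have H x : pos x -> `|step F n x| <= B by rewrite /= in_itv/= andbT => x0; exact: step_bound.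
apply: (le_trans (le_Rintegral _ (integrable_norm (Istep t n)) IB H)) => //.
by rewrite Rintegral_cst//= P1/= mulr1.
Qed.

Lemma step_subordinate_cvg t : 0 < t -> step_subordinate F n t @[n --> \oo] --> subordinate F t.
Proof.
move=> t0; under eq_fun do rewrite -step_subordinateE//.
have IB : (phi t).-integrable pos (EFin \o (fun=> B)).
  by apply: (bounded_phi_integrable _ B0) => // x _; rewrite ger0_norm.
have [] // := @Rintegral_dominated_cvg _ _ _ (phi t) pos (step F) F (fun=> B).
- by move=> n; exact: measurable_step.
- by move=> x; rewrite /= in_itv/= andbT => x0; exact: step_cvg.
- by move=> n x; rewrite /= in_itv/= andbT => x0; exact: step_bound.
Qed.

Variables (M a : R).
Hypothesis Ma : propagation_bound w M a.
Let a0 : 0 <= a. Proof. by have [] := Ma. Qed.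

Lemma lap_step_subordinate n s : a < s ->
  lap_integrable (step_subordinate F n) s /\
  lap (step_subordinate F n) s = lam s / s * lap (step F n) (lam s).
Proof.
move=> as0; have s0 : 0 < s := le_lt_trans a0 as0.
have l0 : 0 < lam s by exact: symbol_sqrt_gt0.
have Hi i : lap_integrable (fun t => F (grid n i) * (W (grid n i) t - W (grid n i.+1) t)) s /\
    lap (fun t => F (grid n i) * (W (grid n i) t - W (grid n i.+1) t)) s =
    F (grid n i) * ((expR (- (grid n i * lam s)) - expR (- (grid n i.+1 * lam s))) / s).
  have [I1 L1] := extension_transform hal hc hcs hw Ma (grid_ge0 n i) as0.
  have [I2 L2] := extension_transform hal hc hcs hw Ma (grid_ge0 n i.+1) as0.
  have E t : 0 <= t -> W (grid n i) t + -1 * W (grid n i.+1) t = W (grid n i) t - W (grid n i.+1) t by move=> _; ring.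
  have I3 := eq_lap_integrable E (lap_integrableD I1 (lap_integrableZ (-1) I2)).
  split; first exact: lap_integrableZ.
  by rewrite lapZ// -(eq_lap _ E) (lapD I1 (lap_integrableZ (-1) I2)) (lapZ _ I2) L1 L2; ring.
have [I1 L1] := lap_sum (n.+1 ^ 2) (fun i => (Hi i).1).
have Gi i := lap_interval l0 (grid_ge0 n i) (grid_le n i).
have [I2 L2] := lap_sum (n.+1 ^ 2) (fun i => lap_integrableZ (F (grid n i)) (Gi i).1).
split => //; rewrite [LHS]L1 [X in _ = _ * X]L2 mulr_sumr; apply: eq_bigr => i _.
rewrite (Hi i).2 lapZ; last by have [] := Gi i.
by rewrite (Gi i).2; field; rewrite !gt_eqF.
Qed.

(** The transform of W x t - W y t in t at s is lam s / s times the transform at lam s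
    of the indicator of [x, y[. This is the relation for steps, and F is their limit. *)
Lemma lap_subordinate s : a < s ->
  lap_integrable (fun t => if 0 < t then subordinate F t else 0) s /\
  lap (fun t => if 0 < t then subordinate F t else 0) s = lam s / s * lap F (lam s).
Proof.
move=> as0; have s0 : 0 < s := le_lt_trans a0 as0.
have l0 : 0 < lam s by exact: symbol_sqrt_gt0.
pose p (u : R -> R) t := if 0 < t then u t else 0.
have Hn n := lap_step_subordinate n as0.
have E n t : 0 <= t -> t != 0 -> step_subordinate F n t = p (step_subordinate F n) t.
  by move=> t_ge0 t0; rewrite /p lt_neqAle eq_sym t0 t_ge0.
have Hp n := lap_ext_off (lexx 0) s0 (Hn n).1 (E n).
have [I L] : lap_integrable (p (subordinate F)) s /\
    lap (p (step_subordinate F n)) s @[n --> \oo] --> lap (p (subordinate F)) s.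
  apply: (lap_dominated_cvg (G := fun=> B)) => [n|t t0||n t t0].
  - by have [I _] := Hp n; exact: lap_integrable_measurable I.
  - by rewrite /p; case: ifPn => t0'; [exact: step_subordinate_cvg|exact: cvg_cst].
  - exact: lap_integrable_cst.
  - by rewrite /p; case: ifPn => t0'; [exact: step_subordinate_bound|rewrite normr0].
split => //.
have [_ L2] : lap_integrable F (lam s) /\ lap (step F n) (lam s) @[n --> \oo] --> lap F (lam s).
  apply: (lap_dominated_cvg (G := fun=> B)) => [n|t t0||n t t0].
  - exact: measurable_step.
  - exact: step_cvg.
  - exact: lap_integrable_cst.
  - exact: step_bound.
have L3 : lap (p (step_subordinate F n)) s @[n --> \oo] --> lam s / s * lap F (lam s).
  under eq_fun do rewrite -(Hp _).2 (Hn _).2.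
  by apply: cvgM => //; exact: cvg_cst.
exact: (cvg_unique _ L L3).
Qed.

(** phi tau lives on [0, tau / sqrt c], so for tau <= t + 1 the steps of F
    approximate uniformly in tau; each of them is right-continuous with W. *)
Lemma subordinate_right_cvg t : 0 < t -> subordinate F y @[y --> t^'+] --> subordinate F t.
Proof.
move=> t0; apply/cvgrPdist_le => e e0.
have e3 : 0 < e / 3 by rewrite divr_gt0.
have sc : 0 < Num.sqrt c by rewrite sqrtr_gt0.
pose Tm := (t + 1) / Num.sqrt c.
have Tm0 : 0 <= Tm by rewrite divr_ge0 ?ltW// addr_gt0.
have [n Hn] := filter_ex (step_uniform Tm0 (fun x xT => cF (proj1 (andP xT))) e3).
have close y : 0 < y -> y <= t + 1 -> `|subordinate F y - step_subordinate F n y| <= e / 3.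
  move=> y0 yt; rewrite -step_subordinateE// /subordinate -(RintegralB _ (IF y) (Istep y n))//.
  have [_ P1 P2] := Hphi y0.
  pose tail : set T := `](y / Num.sqrt c), +oo[%classic.
  have mt : measurable tail by exact: measurable_itv.
  pose b x : R := e / 3 + 2 * B * \1_tail x.
  have I1 : (phi y).-integrable pos (EFin \o (fun x => F x - step F n x)).
    by have := integrableB _ (IF y) (Istep y n) => /(_ (measurable_itv _)); apply: eq_integrable.
  have It : (phi y).-integrable pos (EFin \o (fun x => 2 * B * \1_tail x)).
    apply: (@bounded_phi_integrable y (2 * B)).
    - by rewrite mulr_ge0.
    - by apply: measurable_funM => //; exact: measurable_indic.
    - move=> x _; rewrite normrM ger0_norm ?mulr_ge0// -[leRHS]mulr1 ler_wpM2l ?mulr_ge0//.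
      by rewrite indicE ger0_norm// lern1 leq_b1.
  have Ic : (phi y).-integrable pos (EFin \o (fun=> e / 3)).
    by apply: (bounded_phi_integrable _ (ltW e3)) => // x _; rewrite ger0_norm// ltW.
  have Ib : (phi y).-integrable pos (EFin \o b).
    by have := integrableD _ Ic It => /(_ (measurable_itv _)); apply: eq_integrable.
  apply: (le_trans (le_normr_Rintegral _ I1)) => //.
  have Hb x : pos x -> `|F x - step F n x| <= b x.
    rewrite /= in_itv/= andbT => x0; rewrite /b indicE.
    have [xT|xT] := leP x (y / Num.sqrt c).
      apply: (@le_trans _ _ (e / 3)); last by rewrite lerDl mulr_ge0// mulr_ge0.
      apply: Hn; rewrite x0/=; apply: (le_trans xT).
      by rewrite /Tm ler_pM2r ?invr_gt0.
    rewrite mem_set; last by rewrite /tail/= in_itv/= xT.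
    have h1 := FB x0; have h2 := step_bound n FB x0.
    rewrite mulr1; apply: (le_trans (ler_normB _ _)); lra.
  apply: (le_trans (le_Rintegral _ (integrable_norm I1) Ib Hb)) => //.
  have z0 : phi y (tail `&` pos) = 0%E.
    apply/eqP; rewrite eq_le measure_ge0 andbT -P2.
    by apply: le_measure; [rewrite inE; exact: measurableI|rewrite inE; exact: mt|move=> x []].
  have I1t : (phi y).-integrable pos (EFin \o \1_tail).
    apply: (bounded_phi_integrable _ ler01); first exact: measurable_indic.
    by move=> x _; rewrite indicE ger0_norm// lern1 leq_b1.
  have -> : \int[phi y]_(x in pos) b x = \int[phi y]_(x in pos) (e / 3) + 2 * B * \int[phi y]_(x in pos) \1_tail x.
    by rewrite -RintegralZl// -RintegralD.
  have -> : \int[phi y]_(x in pos) \1_tail x = 0.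
    by rewrite -[RHS]/(fine 0%E) -z0; congr fine; exact: integral_indic.
  by rewrite Rintegral_cst//= P1/= mulr1 mulr0 addr0.
have cn : step_subordinate F n y @[y --> t^'+] --> step_subordinate F n t.
  apply: cvg_bigsum => i; apply: cvgM; first exact: cvg_cst.
  by apply: cvgB; exact: (extension_right_cvg hw).
near=> y.
have yt : y <= t + 1 by near: y; apply: nbhs_right_le; rewrite ltrDl.
have ty : t < y by [].
have h1 := close t t0 ltac:(by rewrite lerDl).
have h2 := close y (lt_trans t0 ty) yt.
have h3 : `|step_subordinate F n t - step_subordinate F n y| <= e / 3.
  by near: y; exact: cvgr_dist_le.
have -> : subordinate F t - subordinate F y = (subordinate F t - step_subordinate F n t)
  + (step_subordinate F n t - step_subordinate F n y) - (subordinate F y - step_subordinate F n y) by ring.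
apply: (le_trans (ler_normB _ _)); apply: (@le_trans _ _ (e / 3 + e / 3 + e / 3)); last lra.
by apply: lerD => //; apply: (le_trans (ler_normD _ _)); exact: lerD.
Unshelve. all: by end_near. Qed.

End Scalar.
End Subordination.

(** * Monotone functions with a density *)

Section Density.
Context {R : realType}.
Notation mu := (@lebesgue_measure R).
Notation pos := (`[0, +oo[%classic : set (measurableTypeR R)).
Variables (G : R -> R) (L : R).
Hypotheses (Gd : forall x : R, 0 < x -> derivable G x 1 /\ {for x, continuous (derive1 G)})
  (Gn : forall x y : R, 0 < x -> x <= y -> G y <= G x)
  (G0 : G x @[x --> 0^'+] --> L) (Gy : G x @[x --> +oo] --> 0).
Implicit Types (x y t : R).

Let p x := - derive1 G x.

Let p_ge0 x : 0 < x -> 0 <= p x.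
Proof.
move=> x0; have [D _] := Gd x0.
have d : is_derive x 1 G (derive1 G x) by apply: DeriveDef => //; rewrite derive1E.
have C := is_derive_quotient_cvg d.
rewrite /p oppr_ge0 -(cvg_lim _ C)//; apply: limr_le; first by apply/cvg_ex; exists (derive1 G x).
apply: nearW => n; rewrite mulr_ge0_le0// subr_le0; apply: Gn => //.
by rewrite lerDl invr_ge0.
Qed.

Let cp x : 0 < x -> {for x, continuous p}.
Proof. by move=> x0; have [_ c] := Gd x0; exact: cvgN. Qed.

Let cG x : 0 < x -> {for x, continuous G}.
Proof. by move=> x0; have [D _] := Gd x0; apply/differentiable_continuous/derivable1_diffP. Qed.

Let mp : measurable_fun (`]0, +oo[ : set R) p.
Proof.
by apply: open_continuous_measurable_fun => // x; rewrite inE/= in_itv/= andbT; exact: cp.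
Qed.

Let mpS (A : set (measurableTypeR R)) : measurable A -> A `<=` `]0, +oo[ -> measurable_fun A (EFin \o p).
Proof. by move=> mA A0; apply/measurable_EFinP; apply: measurable_funS mp. Qed.

Let integral_cc x y : 0 < x -> x <= y -> (\int[mu]_(z in `[x, y]) (p z)%:E = (G x - G y)%:E)%E.
Proof.
move=> x0; rewrite le_eqVlt => /predU1P[<-|xy]; first by rewrite set_itv1 integral_set1 subrr.
have pos_of z : x <= z -> 0 < z by exact: lt_le_trans.
have cNG z : 0 < z -> {for z, continuous (fun u : R => - G u)}.
  by move=> z0; apply: (@continuousN _ R); exact: cG.
have dNG z : 0 < z -> derivable (fun u : R => - G u) z 1.
  by move=> z0; have [Dz _] := Gd z0; exact: derivableN.
rewrite (@continuous_FTC2 _ p (fun z => - G z) x y xy).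
- by rewrite -EFinB; congr EFin; ring.
- by apply: continuous_in_subspaceT => z; rewrite inE/= in_itv/= => /andP[xz _]; apply: cp; exact: pos_of.
- split.
  + by move=> z; rewrite in_itv/= => /andP[/ltW xz _]; exact: dNG (pos_of z xz).
  + by apply: (@cvg_at_right_filter R R); exact: cNG.
  + by apply: (@cvg_at_left_filter R R); apply: cNG; exact: pos_of (ltW xy).
- move=> z; rewrite in_itv/= => /andP[/ltW xz _]; have [D _] := Gd (pos_of z xz).
  by rewrite /p !derive1E deriveN.
Qed.

Let integral_co x y : 0 < x -> x <= y -> (\int[mu]_(z in `[x, y[) (p z)%:E = (G x - G y)%:E)%E.
Proof.
move=> x0 xy; rewrite -integral_cc// -integral_itv_bndo_bndc//.
by apply: mpS => // z; rewrite /= !in_itv/= andbT => /andP[xz _]; exact: lt_le_trans xz.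
Qed.

Let integral_oo y : 0 < y -> (\int[mu]_(z in `]0%R, y[) (p z)%:E = (L - G y)%:E)%E.
Proof.
move=> y0; pose I (i : nat) : set (measurableTypeR R) := `[i.+1%:R^-1, y[%classic.
have I0 i : I i `<=` `]0, +oo[.
  move=> z; rewrite /I/= !in_itv/= andbT => /andP[iz _]; apply: lt_le_trans iz.
  by rewrite invr_gt0.
have C1 : (\int[mu]_(x in I i) (p x)%:E)%E @[i --> \oo] --> (\int[mu]_(x in \bigcup_i I i) (p x)%:E)%E.
  apply: ge0_nondecreasing_set_cvg_integral.
  - move=> i j ij; apply/subsetPset => z; rewrite /I/= !in_itv/= => /andP[iz ->].
    by rewrite andbT; apply: le_trans iz; rewrite lef_pV2 ?posrE// ler_nat.
  - by move=> i; exact: measurable_itv.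
  - by move=> i; apply: mpS => //; exact: measurable_itv.
  - by move=> i z /I0; rewrite /= in_itv/= andbT lee_fin => /p_ge0.
have U : \bigcup_i I i = `]0, y[%classic.
  apply/seteqP; split => [z [i _]|z].
    move=> Iz; have := I0 i z Iz; move: Iz; rewrite /I/= !in_itv/= andbT => /andP[_ ->].
    by move=> ->.
  rewrite /= in_itv/= => /andP[z0 zy].
  have /cvgr_lt/(_ _ z0)[i _ Hi] := @cvg_harmonic R.
  by exists i => //; rewrite /I/= in_itv/= zy andbT; apply/ltW/(Hi i)/leqnn.
have C2 : (\int[mu]_(x in I i) (p x)%:E)%E @[i --> \oo] --> (L - G y)%:E.
  have C3 : (G i.+1%:R^-1 - G y) @[i --> \oo] --> L - G y.
    apply: cvgB; last exact: cvg_cst.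
    have /cvg_at_rightP := G0; apply; split; [by move=> i; rewrite invr_gt0|exact: cvg_harmonic].
  have CE : (G i.+1%:R^-1 - G y)%:E @[i --> \oo] --> (L - G y)%:E.
    by apply: cvg_EFin; [exact: nearW|exact: C3].
  move: CE; apply: cvg_trans; apply: near_eq_cvg; near=> i.
  rewrite /I integral_co ?invr_gt0//.
  near: i; have /cvgr_le := @cvg_harmonic R; exact.
by rewrite -U; exact: (cvg_unique _ C1 C2).
Unshelve. all: by end_near. Qed.

(** At 0, where G may fail to be differentiable, 0 is a value that preserves
    measurability and sign. *)
Definition density x := if 0 < x then - derive1 G x else 0.

Lemma measurable_density : measurable_fun (`[0, +oo[ : set R) density.
Proof.
apply/measurable_fun_itv_obnd_cbndP; apply: eq_measurable_fun mp => x.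
by rewrite inE/= in_itv/= andbT /density => ->.
Qed.

Lemma density_ge0 x : 0 <= density x.
Proof. by rewrite /density; case: ifP => // x0; exact: p_ge0. Qed.

Lemma integral_density (A : set (measurableTypeR R)) : measurable A -> A `<=` pos ->
  (\int[mu]_(x in A) (density x)%:E = \int[mu]_(x in A `&` `]0%R, +oo[) (p x)%:E)%E.
Proof.
move=> mA A0; rewrite integral_mkcondr; apply: eq_integral => x; rewrite inE => Ax.
rewrite /patch mem_setE in_itv/= andbT /density; by case: ifP.
Qed.

Lemma integrable_density : mu.-integrable pos (EFin \o density).
Proof.
apply/integrableP; split; first by apply/measurable_EFinP; exact: measurable_density.
under eq_integral do rewrite /= ger0_norm ?density_ge0//.
rewrite integral_density//.
have -> : pos `&` `]0, +oo[ = `]0, +oo[%classic.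
  by apply/seteqP; split => [x []//|x x0]; split => //; move: x0; rewrite /= !in_itv/= !andbT => /ltW.
pose I (i : nat) : set (measurableTypeR R) := `]0%R, i.+1%:R[%classic.
have I0 i : I i `<=` `]0, +oo[ by move=> z; rewrite /I/= !in_itv/= andbT => /andP[].
have C1 : (\int[mu]_(x in I i) (p x)%:E)%E @[i --> \oo] --> (\int[mu]_(x in \bigcup_i I i) (p x)%:E)%E.
  apply: ge0_nondecreasing_set_cvg_integral.
  - move=> i j ij; apply/subsetPset => z; rewrite /I/= !in_itv/= => /andP[-> iz].
    by apply: lt_le_trans iz _; rewrite ler_nat.
  - by move=> i; exact: measurable_itv.
  - by move=> i; apply: mpS => //; exact: measurable_itv.
  - by move=> i z /I0; rewrite /= in_itv/= andbT lee_fin => /p_ge0.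
have U : \bigcup_i I i = `]0, +oo[%classic.
  apply/seteqP; split => [z [i _]|z]; first exact: I0.
  rewrite /= in_itv/= andbT => z0.
  have [_ H] := andP (truncn_itv (ltW z0)).
  by exists (Num.truncn z) => //; rewrite /I/= in_itv/= z0.
have C2 : (\int[mu]_(x in I i) (p x)%:E)%E @[i --> \oo] --> L%:E.
  have C3 : (L - G i.+1%:R) @[i --> \oo] --> L.
    rewrite -[X in _ --> X]subr0; apply: cvgB; first exact: cvg_cst.
    apply: (cvg_comp _ _ _ Gy).
    have := @cvgr_idn R; rewrite -(cvg_shiftS (fun n => n%:R : R)); exact.
  have CE : (L - G i.+1%:R)%:E @[i --> \oo] --> L%:E.
    by apply: cvg_EFin; [exact: nearW|exact: C3].
  by move: CE; apply: cvg_trans; apply: near_eq_cvg; apply: nearW => i; rewrite /I integral_oo.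
have -> : (\int[mu]_(x in `]0%R, +oo[) (p x)%:E = L%:E)%E by rewrite -U; exact: (cvg_unique _ C1 C2).
exact: ltry.
Qed.

Lemma Rintegral_density_interval x y : 0 <= x -> x <= y ->
  \int[mu]_(z in pos) (\1_(`[x, y[) z * density z) =
  (if x <= 0 then L else G x) - (if y <= 0 then L else G y).
Proof.
move=> x0 xy.
have sub : `[x, y[ `<=` pos by move=> z; rewrite /= !in_itv/= andbT => /andP[xz _]; exact: le_trans xz.
have E : (\int[mu]_(z in pos) (\1_(`[x, y[) z * density z)%:E = \int[mu]_(z in `[x, y[ `&` `]0%R, +oo[) (p z)%:E)%E.
  rewrite -integral_density// -[in RHS](setIidr sub) integral_mkcondr.
  apply: eq_integral => z _; rewrite /patch indicE.
  by case: ifP => _; rewrite ?mul1r ?mul0r.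
rewrite /Rintegral E; have [x0'|x0'] := leP x 0.
  have -> : x = 0 by apply/le_anti; rewrite x0'.
  have -> : `[0, y[ `&` `]0, +oo[ = `]0, y[%classic.
    apply/seteqP; split => z; rewrite /= !in_itv/= !andbT; first by move=> [/andP[_ ->] ->].
    by move=> /andP[z0 ->]; rewrite z0 (ltW z0).
  have [y0|y0] := leP y 0; last by rewrite integral_oo.
  rewrite subrr set_itv_ge ?integral_set0//.
  by rewrite bnd_simp -leNgt.
rewrite (lt_geF (lt_le_trans x0' xy)).
have -> : `[x, y[ `&` `]0, +oo[ = `[x, y[%classic.
  apply/seteqP; split => z; first by case.
  move=> zxy; split => //; move: zxy; rewrite /= !in_itv/= andbT => /andP[xz _]; exact: lt_le_trans xz.
by rewrite integral_co.
Qed.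

End Density.

(** * The subordination formula *)

Lemma Rintegral_truncate {R : realType} (nu : {measure set (measurableTypeR R) -> \bar R}) (T : R) (f : R -> R) :
  0 <= T -> nu.-integrable (`[0, +oo[ : set (measurableTypeR R)) (EFin \o f) ->
  \int[nu]_(x in (`]T, +oo[ : set (measurableTypeR R))) f x = 0 ->
  \int[nu]_(x in (`[0, T] : set (measurableTypeR R))) f x =
  \int[nu]_(x in (`[0, +oo[ : set (measurableTypeR R))) f x.
Proof.
move=> T0 If z0.
have E : (`[0, +oo[%classic : set (measurableTypeR R)) = `[0, T] `|` `]T, +oo[.
  apply/seteqP; split => x; rewrite /= !in_itv/= !andbT.
    by move=> ->; case: (leP x T) => _; [left|right].
  by case=> [/andP[]//|Tx]; exact: le_trans (ltW Tx).
rewrite E Rintegral_setU ?z0 ?addr0//; first by rewrite -E.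
rewrite disj_set2E; apply/eqP/seteqP; split => // x []; rewrite /= !in_itv/= andbT => /andP[_ xT].
by rewrite ltNge xT.
Qed.

(** A single point is negligible, so the value at 0 of an integrand is immaterial. *)
Lemma integrable_off_zero {R : realType} (T : R) (u u' : R -> R) :
  (forall x : R, 0 < x -> x <= T -> u x = u' x) ->
  (@lebesgue_measure R).-integrable `[0, T] (EFin \o u') ->
  (@lebesgue_measure R).-integrable `[0, T] (EFin \o u) /\
  \int[@lebesgue_measure R]_(x in `[0, T]) u x = \int[@lebesgue_measure R]_(x in `[0, T]) u' x.
Proof.
move=> uu' Iu'.
have Iu'o : (@lebesgue_measure R).-integrable `]0, T] (EFin \o u').
  by apply: integrableS Iu' => // x; rewrite /= !in_itv/= => /andP[/ltW -> ->].
have uo x : x \in (`]0, T]%classic : set R) -> (EFin \o u') x = (EFin \o u) x.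
  by rewrite inE/= in_itv/= => /andP[x0 xT] /=; rewrite uu'.
have Iuo : (@lebesgue_measure R).-integrable `]0, T] (EFin \o u).
  exact: eq_integrable Iu'o.
have mu1 : measurable_fun (`[0, T] : set R) (EFin \o u).
  by apply/emeasurable_fun_itv_obnd_cbndP; exact: (measurable_int _ Iuo).
split.
  apply/integrableP; split => //; rewrite -integral_itv_obnd_cbnd; first by have /integrableP[] := Iuo.
  by apply: measurableT_comp => //; exact: (measurable_int _ Iuo).
rewrite -!Rintegral_itv_obnd_cbnd//; apply: eq_Rintegral => x.
by rewrite inE/= in_itv/= => /andP[x0 xT]; exact: uu'.
Qed.

Section Conclusion.
Context {R : realType} {X : completeNormedModType R} (m : nat) (c : R) (cs al : 'I_m -> R).
Hypothesis hal : forall j : 'I_m, 1 <= al j < 2.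
Hypothesis hc : 0 < c.
Hypothesis hcs : forall j : 'I_m, 0 < cs j.
Variable w : R -> R -> R.
Hypothesis hw : propagation_function c cs al w.
Notation mu := (@lebesgue_measure R).
Notation T := (measurableTypeR R).
Implicit Types (x y t s : R) (v : X) (f : X -> R).
Local Notation lam := (symbol_sqrt c cs al).
Local Notation W := (propagation_extension w).
Local Notation pos := (`[0, +oo[%classic : set T).
Variable phi : R -> probability T R.
Hypothesis Hphi : forall t, 0 < t ->
  [/\ forall a b : R, 0 <= a -> a <= b -> phi t `[a, b[%classic = (W a t - W b t)%:E,
      phi t pos = 1%E
    & phi t `](t / Num.sqrt c), +oo[%classic = 0%E].
Variables (D : set X) (A : X -> X) (k : R -> R) (C S : R -> X -> X).
Hypotheses (hC : generates_cosine D A C) (Cb : bounded_family C).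
Hypothesis hk : has_laplace_transform k (fun s => (charfun c cs al s)^-1).
Hypotheses (hS : solution_operator k D A S) (Sb : bounded_family S).

Let sC : strongly_continuous_family C. Proof. by have [[]] := hC. Qed.
Let sS : strongly_continuous_family S. Proof. by have [] := hS. Qed.

(** Reflecting the orbit makes it continuous at 0 from both sides. *)
Let orbit f v x := f (C `|x| v).

Let measurable_orbit f v : contraction_functional f -> measurable_fun (`[0, +oo[ : set R) (orbit f v).
Proof.
move=> cf; apply: eq_measurable_fun (functional_orbit_measurable v sC cf) => x.
by rewrite inE/= in_itv/= andbT => x0; rewrite /orbit ger0_norm.
Qed.

Let continuous_orbit f v x : contraction_functional f -> 0 <= x -> {for x, continuous (orbit f v)}.
Proof.
move=> cf; rewrite le_eqVlt => /predU1P[<-|x0]; last first.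
  apply: (@continuous_comp _ _ _ (fun y : R => `|y|) (fun y => f (C y v))); first exact: norm_continuous.
  apply: (@continuous_comp _ _ _ (C^~ v) f); last exact: functional_continuous.
  by rewrite gtr0_norm//; exact: family_continuous_pos.
have O0 : orbit f v 0 = f (C 0 v) by rewrite /orbit normr0.
rewrite /prop_for /continuous_at O0; apply/cvgrPdist_lt => e e0.
have H : f (C y v) @[y --> 0^'+] --> f (C 0 v).
  by apply: continuous_cvg; [exact: functional_continuous|exact: family_continuous0].
have /cvgrPdist_lt/(_ e e0)[d /= d0 Hd] := H.
exists d => //= y yd; have [->|y0] := eqVneq y 0; first by rewrite O0 subrr normr0.
by apply: Hd; rewrite ?normr_gt0//= sub0r normrN normr_id; move: yd; rewrite /= sub0r normrN.
Qed.

Let orbit_bound f v : contraction_functional f -> exists2 B : R, 0 <= B & forall x : R, 0 <= x -> `|orbit f v x| <= B.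
Proof.
move=> [_ fb]; have [M M1 CM] := bounded_family_ge1 Cb.
exists (M * `|v|) => [|x x0]; first by rewrite mulr_ge0// (le_trans ler01).
by apply: (le_trans (fb _)); exact: CM.
Qed.

(** Both sides are right-continuous in t and have the transform
    lam / s * lap (f (C v)) lam at s; a difference with zero transform has both
    signs. *)
Lemma subordination_functional f v t : contraction_functional f -> 0 < t ->
  \int[phi t]_(x in pos) f (C x v) = f (S t v).
Proof.
move=> cf t0; have [B B0 FB] := orbit_bound v cf.
have mF := measurable_orbit v cf; have cF x := @continuous_orbit f v x cf.
have [M [a Ma]] := propagation_bounded hw; have a0 : 0 <= a by have [] := Ma.
have [K [_ HK]] := hk.
pose N y := if 0 < y then subordinate phi (orbit f v) y else 0.
pose s0 := Num.max K a + 1.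
have as0 s : s0 <= s -> a < s.
  by apply: lt_le_trans; apply: (@le_lt_trans _ _ (Num.max K a)); rewrite ?ltrDl// le_max lexx orbT.
have Ks0 s : s0 <= s -> K < s.
  by apply: lt_le_trans; apply: (@le_lt_trans _ _ (Num.max K a)); rewrite ?ltrDl// le_max lexx.
have key s : s0 <= s -> [/\ lap_integrable N s, lap_integrable (fun y => f (S y v)) s &
    lap N s = lap (fun y => f (S y v)) s].
  move=> ss; have s_gt0 : 0 < s := le_lt_trans a0 (as0 s ss).
  have l0 : 0 < lam s by exact: symbol_sqrt_gt0.
  have [I1 L1] := lap_subordinate hal hc hcs hw Hphi FB cF Ma (as0 s ss).
  have [Ik Lk] := HK s (Ks0 s ss).
  have I2 := functional_orbit_lap_integrable v sS Sb cf s_gt0.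
  split => //.
  rewrite [LHS]L1 (@solution_transform _ _ D A C S k hC Cb hS Sb s (lam s) f s_gt0 l0 Ik _ cf v); last first.
    by rewrite symbol_sqrtK.
  by congr (_ * _); apply: eq_lap => y y0; rewrite /orbit ger0_norm.
have alt0 : alt (fun=> 0 : R).
  by move=> n; elim: n => [|n IH]; split => // ; apply: alt_upto_ext IH => s _; rewrite subrr.
have sgn e : 0 <= e * N t + (- e) * f (S t v).
  have H s : s0 <= s -> lap_integrable (fun y => e * N y + (- e) * f (S y v)) s /\
      lap (fun y => e * N y + (- e) * f (S y v)) s = 0.
    move=> ss; have [I1 I2 E] := key s ss; split.
      by apply: lap_integrableD; exact: lap_integrableZ.
    by rewrite (lapD (lap_integrableZ e I1) (lap_integrableZ (- e) I2)) !lapZ// E; ring.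
  have cN : N y @[y --> t^'+] --> N t.
    have := subordinate_right_cvg hc hw Hphi mF FB cF t0.
    rewrite {2}/N t0; apply: cvg_trans; apply: near_eq_cvg; near=> y.
    by rewrite /N (lt_trans t0).
  apply: (alt_lap_ge0 (H s0 (lexx _)).1 alt0 _ (fun s ss => (H s ss).2) t0).
    by apply: le_lt_trans (as0 s0 (lexx _)).
  apply: cvgD; apply: cvgM; [exact: cvg_cst|exact: cN|exact: cvg_cst|].
  apply: continuous_cvg; first exact: functional_continuous.
  by apply: cvg_at_right_filter; exact: family_continuous_pos.
have E : N t = f (S t v) by have := sgn 1; have := sgn (- 1); lra.
rewrite -E /N t0 /subordinate; apply: eq_Rintegral => x.
by rewrite inE/= in_itv/= andbT => x0; rewrite /orbit ger0_norm.
Unshelve. all: by end_near. Qed.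

Let orbit_phi_integrable f v t : contraction_functional f -> (phi t).-integrable pos (EFin \o (fun x => f (C x v))).
Proof.
move=> cf; have [B B0 FB] := orbit_bound v cf.
apply: (@bounded_phi_integrable R phi t B (fun x => f (C x v)) B0); first exact: (functional_orbit_measurable v sC cf).
by move=> x x0; have := FB x x0; rewrite /orbit (ger0_norm x0).
Qed.

(** The Bochner integral exists because orbits are continuous and bounded; its value is
    then determined by functionals. *)
Lemma bochner_subordination v t (Y : set T) : 0 < t -> measurable Y -> Y `<=` pos ->
  (forall f, contraction_functional f -> \int[phi t]_(x in Y) f (C x v) = f (S t v)) ->
  bochner_integral (phi t) Y (C^~ v) (S t v).
Proof.
move=> t0 mY Ypos H; have [M M1 CM] := bounded_family_ge1 Cb.
have Y0 x : Y x -> 0 <= x by move=> /Ypos; rewrite /= in_itv/= andbT.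
have fin : (phi t Y < +oo)%E by apply: le_lt_trans (probability_le1 _ mY) _; rewrite ltry.
have [I HI] : exists I, bochner_integral (phi t) Y (C^~ v) I.
  apply: (@bochner_exists _ _ (phi t) Y (C^~ v) (fun=> M * `|v|)) => //.
  - by move=> x x0; exact: family_continuous_pos.
  - exact: finite_measure_integrable_cst.
  - by move=> x /Y0; exact: CM.
suff <- : I = S t v by [].
apply: functional_separation => f cf; rewrite -H// -(bochner_functional mY cf HI)//.
apply: integrableS (orbit_phi_integrable v t cf) => //.
Qed.

Lemma bochner_subordination_pos v t : 0 < t -> bochner_integral (phi t) pos (C^~ v) (S t v).
Proof.
move=> t0; apply: bochner_subordination => //.
by move=> f cf; exact: subordination_functional.
Qed.

Lemma bochner_subordination_finite v t : 0 < t ->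
  bochner_integral (phi t) (`[0, t / Num.sqrt c] : set T) (C^~ v) (S t v).
Proof.
move=> t0; have [_ _ P0] := Hphi t0.
apply: bochner_subordination => //.
  by move=> x; rewrite /= !in_itv/= andbT => /andP[].
move=> f cf; rewrite -subordination_functional//; apply: Rintegral_truncate.
- by rewrite divr_ge0 ?sqrtr_ge0// ltW.
- exact: orbit_phi_integrable.
- rewrite /Rintegral null_set_integral//.
  apply: (measurable_int (phi t)); apply: integrableS (orbit_phi_integrable v t cf) => //.
  by move=> x; rewrite /= !in_itv/= !andbT => /ltW; apply: le_trans; rewrite divr_ge0 ?sqrtr_ge0// ltW.
Qed.

Section Smooth.
Variable t : R.
Hypotheses (t0 : 0 < t) (wt : continuously_derivable_in_x w t).
Let G x := w x t.
Let d : R -> R := density G.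
Let b := t / Num.sqrt c.
Let b0 : 0 <= b. Proof. by rewrite divr_ge0 ?sqrtr_ge0// ltW. Qed.

Let G_antitone x y : 0 < x -> x <= y -> G y <= G x.
Proof.
move=> x0 xy; have [M [a Ma]] := propagation_bounded hw.
have := extension_antitone hal hc hcs hw Ma (ltW x0) xy t0.
by rewrite /propagation_extension !leNgt x0 (lt_le_trans x0 xy).
Qed.

Let G_cvg0 : G x @[x --> 0^'+] --> (1 : R).
Proof. by have [_ _ _ /(_ t t0)[<-]] := hw. Qed.

Let G_cvgy : G x @[x --> +oo] --> 0.
Proof. by have [_ _ _ _ /(_ t t0)] := hw. Qed.

Let G_front x : b < x -> G x = 0.
Proof.
move=> bx; have [M [a Ma]] := propagation_bounded hw; have x0 : 0 < x := le_lt_trans b0 bx.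
have := extension_support hal hc hcs hw Ma (ltW x0) t0.
rewrite /propagation_extension leNgt x0; apply.
by rewrite -ltr_pdivrMr ?sqrtr_gt0.
Qed.

Let d_front x : b < x -> d x = 0.
Proof.
move=> bx; have x0 : 0 < x := le_lt_trans b0 bx.
rewrite /d /density x0 derive1E (@near_eq_derive _ _ _ _ (fun=> 0) x 1).
- by rewrite derive_cst oppr0.
- by near=> y; apply: G_front; near: y; exact: lt_nbhsr.
Unshelve. all: by end_near. Qed.

Let d_ge0 x : 0 <= d x. Proof. exact: (density_ge0 wt G_antitone). Qed.

Let Id : mu.-integrable pos (EFin \o d).
Proof. exact: (integrable_density wt G_antitone G_cvg0 G_cvgy). Qed.

Let Rintegral_density_step F n : \int[mu]_(x in pos) (step F n x * d x) = step_subordinate w F n t.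
Proof.
have I1 i : mu.-integrable pos (EFin \o (fun x => \1_(`[grid n i, grid n i.+1[) x * d x)).
  apply: (@integrable_mul_bounded _ _ _ mu pos _ _ 1) => //.
  by move=> x _; rewrite indicE ger0_norm// lern1 leq_b1.
transitivity (\int[mu]_(x in pos) \sum_(i < n.+1 ^ 2) F (grid n i) * (\1_(`[grid n i, grid n i.+1[) x * d x)).
  by apply: eq_Rintegral => x _; rewrite /step mulr_suml; apply: eq_bigr => i _; rewrite mulrA.
rewrite Rintegral_sum//; last by move=> i; apply: integrable_scale => //; exact: I1.
apply: eq_bigr => i _; rewrite RintegralZl//; congr (_ * _).
by rewrite (Rintegral_density_interval wt G_antitone G_cvg0 (grid_ge0 n i) (grid_le n i)).
Qed.

Let Rintegral_density_orbit f v : contraction_functional f ->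
  mu.-integrable pos (EFin \o (fun x => orbit f v x * d x)) /\
  \int[mu]_(x in pos) (orbit f v x * d x) = f (S t v).
Proof.
move=> cf; have [B B0 FB] := orbit_bound v cf.
have cF x := @continuous_orbit f v x cf.
have [I1 C1] : mu.-integrable pos (EFin \o (fun x => orbit f v x * d x)) /\
    \int[mu]_(x in pos) (step (orbit f v) n x * d x) @[n --> \oo] --> \int[mu]_(x in pos) (orbit f v x * d x).
  apply: (@Rintegral_dominated_cvg _ _ _ mu pos (fun n x => step (orbit f v) n x * d x) _ (fun x => B * d x)) => //.
  - by move=> n; apply: measurable_funM; [exact: measurable_step|exact: measurable_density].
  - by move=> x; rewrite /= in_itv/= andbT => x0; apply: cvgM; [exact: step_cvg|exact: cvg_cst].
  - exact: (integrable_scale B _ Id).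
  - move=> n x; rewrite /= in_itv/= andbT => x0; rewrite normrM (ger0_norm (d_ge0 x)).
    by apply: ler_wpM2r; [exact: d_ge0|exact: step_bound].
split => //.
have C2 := step_subordinate_cvg Hphi FB cF t0.
have E n : \int[mu]_(x in pos) (step (orbit f v) n x * d x) = step_subordinate w (orbit f v) n t.
  exact: Rintegral_density_step.
rewrite (eq_cvg _ _ E) in C1.
rewrite (cvg_unique _ C1 C2)// -subordination_functional//; apply: eq_Rintegral => x.
by rewrite inE/= in_itv/= andbT => x0; rewrite /orbit ger0_norm.
Qed.

(** Against the steps of an orbit, both the density and phi t integrate to the
    increments of w. *)
Lemma bochner_subordination_density v :
  bochner_integral mu `[0, b] (fun x => - derive1 G x *: C x v) (S t v).
Proof.
have [M M1 CM] := bounded_family_ge1 Cb.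
have M0 : 0 <= M * `|v| by rewrite mulr_ge0// (le_trans ler01).
have dE x : 0 < x -> - derive1 G x = d x by rewrite /d /density => ->.
have sub : `[0, b] `<=` pos by move=> x; rewrite /= !in_itv/= andbT => /andP[].
have Idb : mu.-integrable `[0, b] (EFin \o (fun x => (M * `|v|) * d x)).
  by apply: integrableS (integrable_scale _ _ Id).
have dN (x : R) : 0 < x -> x <= b -> M * `|v| * `|derive1 G x| = M * `|v| * d x.
  by move=> x0 _; congr (_ * _); rewrite -normrN dE// ger0_norm.
have [I1 _] := integrable_off_zero dN Idb.
have [I HI] : exists I, bochner_integral mu `[0, b] (fun x => - derive1 G x *: C x v) I.
  apply: (@bochner_exists _ _ mu `[0, b] _ (fun x => (M * `|v|) * `|derive1 G x|)) => //.
  - by move=> x; rewrite /= in_itv/= => /andP[].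
  - by rewrite [X in (X < _)%E]lebesgue_measure_itv/=; case: ifP => _; rewrite -?EFinB ?ltry.
  - move=> x x0; have [_ cG] := wt x0; apply: cvgZ; first exact: cvgN.
    exact: family_continuous_pos.
  - move=> x; rewrite /= in_itv/= => /andP[x0 _]; rewrite normrZ normrN mulrC.
    by apply: ler_wpM2r => //; exact: CM.
suff <- : I = S t v by [].
apply: functional_separation => f cf.
have [I2 E2] := Rintegral_density_orbit v cf.
have I2b : mu.-integrable `[0, b] (EFin \o (fun x => orbit f v x * d x)).
  by apply: integrableS I2.
have fd (x : R) : 0 < x -> x <= b -> f (- derive1 G x *: C x v) = orbit f v x * d x.
  by move=> x0 _; rewrite (functionalZ cf) dE// mulrC /orbit (gtr0_norm x0).
have [I3 E3] := integrable_off_zero fd I2b.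
rewrite -(bochner_functional _ cf HI)// E3 -E2; apply: Rintegral_truncate => //.
rewrite (@eq_Rintegral _ _ _ _ _ (fun=> 0)); first by rewrite Rintegral_cst// mul0r.
by move=> x; rewrite inE/= in_itv/= andbT => bx; rewrite d_front// mulr0.
Qed.

End Smooth.
End Conclusion.

Theorem corollary3p2 (R : realType) (X : completeNormedModType R)
  (m : nat) (c : R) (cs al : 'I_m -> R)
  (hal : forall j : 'I_m, 0 < al j < 2)
  (hal_dec : forall i j : 'I_m, (i < j)%N -> al j < al i)
  (hal_last : forall j : 'I_m, j.+1 = m -> 2 - al j <= 1)
  (hc : 0 < c) (hcs : forall j : 'I_m, 0 < cs j)
  (D : set X) (A : X -> X)
  (hAlin : linear_operator D A) (hAclosed : closed_operator D A)
  (hAunb : unbounded_operator D A) (hDdense : closure D = setT)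
  (S2 : R -> X -> X) (hS2 : generates_cosine D A S2) (hS2b : bounded_family S2)
  (k : R -> R)
  (hk : has_laplace_transform k (fun s => (charfun c cs al s)^-1))
  (S : R -> X -> X) (hS : solution_operator k D A S) (hSb : bounded_family S)
  (w : R -> R -> R) (hw : propagation_function c cs al w) :
  exists phi : R -> probability (measurableTypeR R) R,
    forall t : R, 0 < t ->
      [/\ neg_x_derivative w t (phi t),
          phi t `[0, +oo[%classic = 1%E,
          forall v, bochner_integral (phi t) `[0, +oo[ (fun tau => S2 tau v) (S t v),
          forall v, bochner_integral (phi t) `[0, t / Num.sqrt c]
            (fun tau => S2 tau v) (S t v)
        & continuously_derivable_in_x w t ->
          forall v, bochner_integral (@lebesgue_measure R) `[0, t / Num.sqrt c]
            (fun tau => - derive1 (fun x => w x t) tau *: S2 tau v) (S t v)].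
Proof.
have hal1 (j : 'I_m) : 1 <= al j < 2.
  have /andP[_ ->] := hal j; rewrite andbT.
  have m0 : (m.-1 < m)%N by rewrite ltn_predL (leq_ltn_trans _ (ltn_ord j)).
  have := hal_last (Ordinal m0) ltac:(by rewrite /= (ltn_predK m0)) => al_last.
  have [jm|jm] := eqVneq (j : nat) m.-1.
    have -> : j = Ordinal m0 by exact: val_inj.
    lra.
  have jlt : (j < Ordinal m0)%N by rewrite /=; have := ltn_ord j; move/eqP: jm; lia.
  have := hal_dec _ _ jlt; lra.
have [phi Hphi] := propagation_measure hal1 hc hcs hw.
exists phi => t t0; have [ab P1 _] := Hphi t t0.
split => //.
- move=> a b a0 ab'; rewrite ab ?(ltW a0)//.
  by rewrite /propagation_extension !leNgt a0 (lt_le_trans a0 ab').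
- by move=> v; exact: (bochner_subordination_pos hal1 hc hcs hw Hphi hS2 hS2b hk hS hSb).
- by move=> v; exact: (bochner_subordination_finite hal1 hc hcs hw Hphi hS2 hS2b hk hS hSb).
- by move=> wt v; exact: (bochner_subordination_density hal1 hc hcs hw Hphi hS2 hS2b hk hS hSb).
Qed.
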